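(* For all real $\mu\geq 12$, $$\mathscr{N}^{\mathtt{N}}_{\mathcal{B}_1^2}(\mu)\geq\frac{\mu^2}{4}+0.0014\,\mu.$$
   Context: $\mathcal{B}_1^2\subset\mathbb{R}^2$ is the unit disk. $\mathscr{N}^{\mathtt{N}}_{\mathcal{B}_1^2}(\mu)$ is the number (counted with multiplicity) of eigenvalues of the Neumann Laplacian $-\Delta$ on the disk that are $\le\mu^2$. *)

(* Defs.v *)
From mathcomp Require Import all_boot all_order all_algebra.
From mathcomp Require Import all_classical all_reals all_analysis.

Set Implicit Arguments.
Unset Strict Implicit.
Unset Printing Implicit Defensive.
Import Order.TTheory GRing.Theory Num.Theory numFieldNormedType.Exports.
Local Open Scope classical_set_scope.
Local Open Scope ring_scope.

Section planar_neumann_laplacian.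
Variable R : realType.
Implicit Types (Omega : set (R * R)) (u v f phi : R * R -> R).

Definition leb2 : {measure set (measurableTypeR R * measurableTypeR R) -> \bar R} :=
  (lebesgue_measure \x lebesgue_measure)%E.

(* axis_vec false, axis_vec true are the two vectors of the canonical basis;
   partial derivatives and gradients are indexed by bool accordingly *)
Definition axis_vec (i : bool) : R * R := if i then (0, 1) else (1, 0).

Definition partial (i : bool) phi : R * R -> R := fun z => 'D_(axis_vec i) phi z.

Definition smooth phi :=
  forall (s : seq bool) (z : R * R), differentiable (foldr partial phi s) z.

Definition test_function Omega phi :=
  let K := closure [set z | phi z != 0] in
  [/\ smooth phi, compact K & K `<=` Omega].

Definition L2 Omega u :=
  @measurable_fun _ _ (measurableTypeR R * measurableTypeR R)%type R Omega u /\
  leb2.-integrable Omega (EFin \o (fun z => u z ^+ 2)).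

Definition weak_partial Omega (i : bool) u g :=
  forall phi, test_function Omega phi ->
    \int[leb2]_(z in Omega) (u z * partial i phi z) =
    - \int[leb2]_(z in Omega) (g z * phi z).

(* u is in the Sobolev space H^1(Omega), with weak gradient g *)
Definition H1_gradient Omega u (g : bool -> R * R -> R) :=
  L2 Omega u /\ (forall i, L2 Omega (g i) /\ weak_partial Omega i u (g i)).

(* The graph of the Neumann Laplacian, i.e. of the self-adjoint operator on
   L^2(Omega) associated with the Dirichlet form on all of H^1(Omega): u is in
   its domain and is mapped to f. Elements of L^2(Omega) are represented by
   functions, whose values outside Omega and on null sets are irrelevant. *)
Definition neumann_laplacian Omega u f :=
  L2 Omega f /\
  exists2 gu, H1_gradient Omega u gu &
    forall v gv, H1_gradient Omega v gv ->
      \int[leb2]_(z in Omega) (\sum_i gu i z * gv i z) =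
      \int[leb2]_(z in Omega) (f z * v z).

Definition neumann_eigenspace Omega (lambda : R) : set (R * R -> R) :=
  [set u | neumann_laplacian Omega u (fun z => lambda * u z)].

Definition ae_zero Omega u := {ae leb2, forall z, Omega z -> u z = 0}.

Definition neumann_eigenvalue Omega (lambda : R) :=
  exists2 u, neumann_eigenspace Omega lambda u & ~ ae_zero Omega u.

Definition ae_free Omega (n : nat) (e : 'I_n -> R * R -> R) :=
  forall c : 'I_n -> R,
    ae_zero Omega (fun z => \sum_i c i * e i z) -> forall i, c i = 0.

(* dimension of the eigenspace in L^2(Omega) *)
Definition multiplicity Omega (lambda : R) : \bar R :=
  ereal_sup [set n%:R%:E | n in [set n : nat |
    exists e : 'I_n -> R * R -> R,
      (forall i, neumann_eigenspace Omega lambda (e i)) /\ ae_free Omega e]].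

Definition neumann_counting Omega (mu : R) : \bar R :=
  \esum_(lambda in [set l | neumann_eigenvalue Omega l /\ l <= mu ^+ 2])
    multiplicity Omega lambda.

Definition unit_disk : set (R * R) := [set z | z.1 ^+ 2 + z.2 ^+ 2 < 1].

End planar_neumann_laplacian.

(* Main.v *)
Require Import Defs.
From mathcomp Require Import all_boot all_order all_algebra.
From mathcomp Require Import all_classical all_reals all_analysis.
From mathcomp Require Import Rstruct Rstruct_topology measurable_realfun.
From mathcomp Require ring lra.
From Coquelicot Require Coquelicot.
From Stdlib Require Reals Lra Lia Psatz ZArith.

(** The Neumann eigenfunctions of the disk are explicit: for an order [m >= 0] and
    a zero [x > 0] of [J_m'], the functions [J_m (x r) cos (m t)] and
    [J_m (x r) sin (m t)] belong to the eigenvalue [x^2], and for [m = 0] the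
    point [x = 0] gives the constants. For a lower
    bound of the counting function it suffices to supply independent
    eigenfunctions, and the proof has two halves: the zeros of [J_m'] in
    [(0, mu]], counted twice for [m > 0] and once for [m = 0] together with the
    origin, number at least [mu^2 / 4 + 0.0014 mu] ([bessel_count]), and each of
    them contributes to the counting function as expected ([counting_bessel]).

    Zeros. In terms of [T = x^2 / 4], the functions [(2/x)^m J_m (x)] and
    [(2/x)^m x J_m' (x)] are entire; they are called [H m] and [N m]. Let
    [theta_m (x) = sqrt (x^2 - m^2) - m acos (m / x)] for [x >= m]. In the
    variable [theta_m], Bessel's equation, normalised, is an oscillator
    [Y'' + (1 + V) Y = 0] with [V >= 0], so consecutive zeros of [J_m] are at
    phase distance at most [pi], and a zero of [J_m'] follows a zero of [J_m]
    within [pi / 2]. If the first zero of [J_m] has phase at most [0.8 pi] and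
    the first zero of [J_m'] has phase at most [0.3 pi], an induction shows that
    [[0, x]] contains at least [theta_m (x) / pi + 7/10] zeros of [J_m'], rounded
    down ([zeros_of_phase]). The bounds for the first zeros come from polynomial
    trial functions in a Picone inequality, uniformly in [m >= 20], and from the
    signs of partial sums of the series at rational points for [m < 20].

    Lattice points. By the previous paragraph, the weighted number of zeros is at
    least the number of points [(m, n)] with [n >= 1] and
    [pi (n - 7/10) <= theta_|m| (mu)], where [m] ranges over the integers. At the
    level [n] the admissible [m] fill an interval of length [2 mu cos (alpha_n)],
    hence number at least [2 mu cos (alpha_n) - 1]. This length is a convex
    function of the level, so the trapezoidal rule bounds from above, in terms of
    the sum of the lengths, the area of the region under the graph of the phase,
    which accounts for [mu^2 / 4]. The shift [7/10] leaves a gain of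
    [0.019 mu - 0.7] at least, which suffices when [mu >= 40]
    ([count_large]). For [12 <= mu <= 40] a table of sign changes of [N m] at
    integers shows that there are at least [i + 2] weighted zeros [T <= i] for
    every integer [i] between [36] and [400] ([count_moderate]).

    Eigenfunctions. The eigenspaces are defined by the weak formulation, tested on
    all of [H^1]. The functions above lie in an algebra of functions, generated by
    the coordinates and the smooth functions of the radius, on which partial
    derivatives are computed by the usual rules ([radial_algebra]). Green's
    identity for an eigenfunction [u] and a function [v] of [H^1] follows by
    testing the weak gradient of [v] against the gradient of [u] times a smooth
    radial cutoff; the commutator with the cutoff is controlled by the
    radial derivative of [u], which is of the order of the distance to the circle
    ([green_identity]). Eigenfunctions that share an eigenvalue but not the order
    [m] vanish to different orders at the origin, and are therefore independent
    ([separated_independent]). *)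

Module BesselZeros.
Import Reals Lra Lia Psatz ZArith Coquelicot List.ListNotations.
Local Notation "m + n" := (Nat.add m n) : nat_scope.
Local Notation "m * n" := (Nat.mul m n) : nat_scope.
Local Notation "m - n" := (Nat.sub m n) : nat_scope.
Local Notation "m <= n" := (Peano.le m n) : nat_scope.
Local Notation "m < n" := (Peano.lt m n) : nat_scope.
Local Open Scope R_scope.

(** * Bessel functions as entire series *)

Definition bessel_coef (m k : nat) : R :=
  (-1) ^ k / (INR (fact k) * INR (fact (m + k)%nat)).

(** [H m (x^2/4)] is [(2/x)^m] times the Bessel function [J_m x]: an entire
    function of [T], positive at [T = 0]. *)
Definition H (m : nat) (T : R) : R := PSeries (bessel_coef m) T.

Lemma bessel_coefS m k :
  INR (S k) * bessel_coef m (S k) = - bessel_coef (S m) k.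
Proof.
rewrite /bessel_coef.
have -> : (m + S k)%nat = (S m + k)%nat by lia.
rewrite (_ : fact (S k) = (S k * fact k)%nat) // mult_INR.
have := INR_fact_neq_0 k; have := INR_fact_neq_0 (S m + k)%nat.
have := not_0_INR (S k) ltac:(lia).
move=> h1 h2 h3; rewrite (_ : (-1) ^ S k = - (-1) ^ k) /=; last by ring.
by field; split.
Qed.

Lemma bessel_coefD m k :
  bessel_coef m k = INR (S m + k)%nat * bessel_coef (S m) k.
Proof.
rewrite /bessel_coef.
rewrite (_ : fact (S m + k)%nat = (S (m + k)%nat * fact (m + k)%nat)%nat) //.
rewrite mult_INR.
have := INR_fact_neq_0 k; have := INR_fact_neq_0 (m + k)%nat.
have := not_0_INR (S (m + k)%nat) ltac:(lia).
move=> h1 h2 h3.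
rewrite (_ : (S m + k)%nat = S (m + k)%nat) //.
by field; split.
Qed.

Lemma bessel_coef_neq0 m k : bessel_coef m k <> 0.
Proof.
rewrite /bessel_coef; apply: Rmult_integral_contrapositive_currified.
  by apply: pow_nonzero; lra.
apply: Rinv_neq_0_compat; apply: Rmult_integral_contrapositive_currified;
  exact: INR_fact_neq_0.
Qed.

Lemma bessel_coef_radius m : CV_radius (bessel_coef m) = p_infty.
Proof.
apply: CV_radius_infinite_DAlembert; first by move=> n; exact: bessel_coef_neq0.
apply: (is_lim_seq_le_le (fun=> 0) _ (fun n => / INR (S n))).
- move=> n; split; first exact: Rabs_pos.
  have e : bessel_coef m (S n) / bessel_coef m n
           = - / (INR (S n) * INR (S m + n)%nat).
    have := bessel_coefS m n; have := bessel_coefD m n.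
    have := bessel_coef_neq0 m n; have := not_0_INR (S n) ltac:(lia).
    have := not_0_INR (S m + n)%nat ltac:(lia).
    move=> h1 h2 h3 h4 h5.
    have h6 : bessel_coef (S m) n <> 0 by exact: bessel_coef_neq0.
    apply: (Rmult_eq_reg_l (INR (S n))) => //.
    rewrite h4 /Rdiv -Rmult_assoc h5.
    by field; split.
  rewrite e Rabs_Ropp Rabs_right; last first.
    apply: Rle_ge; apply: Rlt_le; apply: Rinv_0_lt_compat.
    by apply: Rmult_lt_0_compat; apply: lt_0_INR; lia.
  apply: Rinv_le_contravar; first by apply: lt_0_INR; lia.
  have h : 1 <= INR (S m + n)%nat.
    by rewrite (_ : 1 = INR 1) //; apply: le_INR; lia.
  have := pos_INR (S n); nra.
- exact: is_lim_seq_const.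
- have h := (is_lim_seq_incr_1 (fun n => / INR n) 0).1.
  apply: h; apply: (is_lim_seq_inv _ p_infty) => //; exact: is_lim_seq_INR.
Qed.

(** [((2/x)^m J_m)' = - (2/x)^(m+1) J_(m+1)], for the derivative with respect to
    [T = x^2 / 4]. *)
Lemma H_derive m T : is_derive (H m) T (- H (S m) T).
Proof.
have -> : - H (S m) T = PSeries (PS_derive (bessel_coef m)) T.
  rewrite /H -PSeries_opp; apply: PSeries_ext => n.
  by rewrite /PS_derive /PS_opp bessel_coefS.
by apply: is_derive_PSeries; rewrite bessel_coef_radius.
Qed.

Lemma ex_pseries_bessel m T : ex_pseries (bessel_coef m) T.
Proof. by apply: CV_radius_inside; rewrite bessel_coef_radius. Qed.

(** The three-term recurrence [J_m + J_(m+2) = (2(m+1)/x) J_(m+1)]. *)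
Lemma H_rec m T : T * H (S (S m)) T - INR (S m) * H (S m) T + H m T = 0.
Proof.
rewrite -PSeries_incr_1 -PSeries_scal.
have e1 := ex_pseries_incr_1 _ _ (ex_pseries_bessel (S (S m)) T).
have e2 : ex_pseries (PS_scal (INR (S m)) (bessel_coef (S m))) T.
  by apply: ex_pseries_scal; [exact: Rmult_comm | exact: ex_pseries_bessel].
rewrite -PSeries_minus // -PSeries_plus; last 2 first.
- exact: ex_pseries_minus.
- exact: ex_pseries_bessel.
rewrite (PSeries_ext _ (fun=> 0)) ?PSeries_const_0 // => k.
rewrite /PS_plus /PS_minus /PS_plus /PS_opp /PS_scal /PS_incr_1.
case: k => [|k].
  have := bessel_coefD m 0; rewrite (_ : (S m + 0)%nat = S m); last by lia.
  set M := INR (S m); rewrite /plus /scal /= /mult /= /zero /opp /=; lra.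
have := bessel_coefD m (S k); rewrite plus_INR (S_INR k).
have := bessel_coefS (S m) k; rewrite (S_INR k).
set M := INR (S m); rewrite /plus /opp /scal /= /mult /=.
set a := bessel_coef (S (S m)) k; set b := bessel_coef (S m) (S k) => h ->.
lra.
Qed.

Lemma H_at0 m : H m 0 = / INR (fact m).
Proof.
rewrite /H PSeries_0 /bessel_coef /=.
by rewrite (_ : (m + 0)%nat = m); [field; exact: INR_fact_neq_0 | lia].
Qed.

(** [N m (x^2/4)] is [(2/x)^m] times [x J_m' x]; its zeros [T >= 0] are the
    Neumann eigenvalues [4 T] of order [m]. *)
Definition N (m : nat) (T : R) : R := INR m * H m T - 2 * T * H (S m) T.

Lemma N_derive m T : is_derive (N m) T (INR m * H (S m) T - 2 * H m T).
Proof.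
have r := H_rec m T; rewrite S_INR in r.
have -> : INR m * H (S m) T - 2 * H m T
  = INR m * (- H (S m) T) - (2 * H (S m) T + 2 * T * (- H (S (S m)) T)) by lra.
apply: is_derive_minus.
  exact: (is_derive_scal (H m) T (INR m) _ (H_derive m T)).
apply: (is_derive_mult (fun t => 2 * t) (H (S m)) T 2).
- by auto_derive; [|ring].
- exact: H_derive.
- exact: Rmult_comm.
Qed.

(** * Certified signs of the series *)

(** Leibniz bounds for an alternating series whose terms decrease from an even
    order on. *)
Lemma alternating_bounds (u : nat -> R) (l : R) (n0 : nat) :
  is_series (fun k => (-1) ^ k * u k) l -> Nat.Even n0 ->
  (forall k, (n0 <= k)%nat -> 0 <= u (S k) <= u k) ->
  sum_n (fun k => (-1) ^ k * u k) (S n0) <= l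
    <= sum_n (fun k => (-1) ^ k * u k) n0.
Proof.
move=> hs [h e] hu; set a := fun k => _.
have sgn j : (-1) ^ (n0 + 2 * j)%nat = 1.
  rewrite e (_ : (2 * h + 2 * j)%nat = (2 * (h + j)%nat)%nat).
    by rewrite pow_mult (_ : (-1) ^ 2 = 1) ?pow1 //; ring.
  lia.
have up K : (-1) ^ K = 1 -> (n0 <= K)%nat -> sum_n a (S (S K)) <= sum_n a K.
  move=> eK hK; rewrite !sum_Sn /plus /= /a -!tech_pow_Rmult eK -/a.
  have := hu (S K) (Nat.le_trans _ _ _ hK (Nat.le_succ_diag_r K)); lra.
have lo K : (-1) ^ K = 1 -> (n0 <= K)%nat ->
    sum_n a (S K) <= sum_n a (S (S (S K))).
  move=> eK hK; rewrite [in X in _ <= X]sum_Sn [in X in _ <= X]sum_Sn.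
  rewrite /plus /= {3 4}/a -!tech_pow_Rmult eK.
  have h2 : (n0 <= S (S K))%nat by lia.
  have := hu _ h2; lra.
have {}up j : sum_n a (n0 + 2 * j)%nat <= sum_n a n0.
  elim: j => [|j IH]; first by right; congr (sum_n a _); lia.
  rewrite (_ : (n0 + 2 * S j)%nat = S (S (n0 + 2 * j)%nat)); last by lia.
  by apply: Rle_trans IH; apply: up => //; lia.
have {}lo j : sum_n a (S n0) <= sum_n a (S (n0 + 2 * j)%nat).
  elim: j => [|j IH]; first by right; congr (sum_n a _); lia.
  rewrite (_ : (n0 + 2 * S j)%nat = S (S (n0 + 2 * j)%nat)); last by lia.
  by apply: (Rle_trans _ _ _ IH); apply: lo => //; lia.
have sub f : (forall j, (f j < f (S j))%nat) ->
    is_lim_seq (fun j => sum_n a (f j)) l.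
  move=> hf; apply: (is_lim_seq_subseq (sum_n a)) => //.
  exact: eventually_subseq.
split.
  apply: (is_lim_seq_le (fun=> sum_n a (S n0))
    (fun j => sum_n a (S (n0 + 2 * j)%nat)) (sum_n a (S n0)) l) => //.
    exact: is_lim_seq_const.
  by apply: sub => j; lia.
apply: (is_lim_seq_le (fun j => sum_n a (n0 + 2 * j)%nat)
    (fun=> sum_n a n0) l (sum_n a n0)) => //.
  by apply: sub => j; lia.
exact: is_lim_seq_const.
Qed.

(** The combinations [A H_m + B T H_m'], where [H_m' = - H_(m+1)]; the choices
    [(A, B) = (1, 0)] and [(m, 2)] give [H m] and [N m]. *)
Lemma bessel_combination_series (A B : R) m T :
  is_series (fun k => (-1) ^ k * ((A + B * INR k) * T ^ k
                        / (INR (fact k) * INR (fact (m + k)%nat))))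
    (A * H m T - B * (T * H (S m) T)).
Proof.
have e0 : is_series (fun k => bessel_coef m k * T ^ k) (H m T).
  apply: Series_correct; have := ex_pseries_bessel m T.
  by apply: ex_series_ext => k; rewrite pow_n_pow /scal /= /mult /=; ring.
have e1 : is_series (fun k => INR k * bessel_coef m k * T ^ k)
    (- (T * H (S m) T)).
  have e : is_series (fun k => bessel_coef (S m) k * T ^ k) (H (S m) T).
    apply: Series_correct; have := ex_pseries_bessel (S m) T.
    by apply: ex_series_ext => k; rewrite pow_n_pow /scal /= /mult /=; ring.
  have {}e := is_series_scal (- T) _ _ e.
  apply: is_series_decr_1.
  rewrite (_ : plus _ _ = scal (- T) (H (S m) T)).
    2: by rewrite /plus /opp /scal /= /mult /=; ring.
  apply: is_series_ext e => k; rewrite bessel_coefS -tech_pow_Rmult.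
  by rewrite /scal /= /mult /=; ring.
have := is_series_plus _ _ _ _ (is_series_scal A _ _ e0)
                               (is_series_scal B _ _ e1).
rewrite (_ : plus _ _ = A * H m T - B * (T * H (S m) T)).
  2: by rewrite /plus /scal /= /mult /=; ring.
apply: is_series_ext => k; rewrite /plus /scal /= /mult /= /bessel_coef.
field; split; exact: INR_fact_neq_0.
Qed.

(** The partial sum of order [n] at [T = p/q], cleared of its denominator
    [n! (m+n)! q^n], together with [(-p)^n]. *)
Fixpoint scaled_sum (A B m p q : Z) (n : nat) : Z * Z :=
  match n with
  | O => (A, 1%Z)
  | S n' => let (X, P) := scaled_sum A B m p q n' in
            let k := Z.of_nat n in let P' := (- p * P)%Z in
            ((X * (k * (m + k) * q) + P' * (A + B * k))%Z, P')
  end.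

Lemma scaled_sumS A B m p q n : let k := Z.of_nat (S n) in
  scaled_sum A B m p q (S n) =
  (((scaled_sum A B m p q n).1 * (k * (m + k) * q)
    + - p * (scaled_sum A B m p q n).2 * (A + B * k))%Z,
   (- p * (scaled_sum A B m p q n).2)%Z).
Proof. by rewrite /=; case: (scaled_sum _ _ _ _ _ n). Qed.

Lemma scaled_sumE (A B p q : Z) (m n : nat) :
  (0 < q)%Z ->
  IZR (scaled_sum A B (Z.of_nat m) p q n).2 = (-1) ^ n * IZR p ^ n /\
  IZR (scaled_sum A B (Z.of_nat m) p q n).1 =
  sum_n (fun k => (-1) ^ k * ((IZR A + IZR B * INR k) * (IZR p / IZR q) ^ k
                              / (INR (fact k) * INR (fact (m + k)%nat)))) n
            * (INR (fact n) * INR (fact (m + n)%nat) * IZR q ^ n).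
Proof.
move=> hq; have hq' : IZR q <> 0 by apply: not_0_IZR; lia.
elim: n => [|n [eP eX]].
  split=> /=; first by ring.
  rewrite sum_O (_ : (m + 0)%nat = m) /=; last by lia.
  by field; exact: INR_fact_neq_0.
rewrite scaled_sumS [fst (_, _)]/fst [snd (_, _)]/snd.
rewrite plus_IZR !mult_IZR plus_IZR opp_IZR eP eX sum_Sn plus_IZR mult_IZR.
split; first by rewrite -!tech_pow_Rmult; ring.
rewrite -!INR_IZR_INZ.
have -> : (m + S n)%nat = S (m + n)%nat by lia.
have f k : INR (fact (S k)) = INR (S k) * INR (fact k).
  by rewrite -mult_INR.
rewrite (_ : forall a b : R, plus a b = a + b) // !f.
have -> : INR (S (m + n)%nat) = INR m + INR (S n).
  by rewrite !S_INR plus_INR; ring.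
set s := sum_n _ _.
rewrite /Rdiv Rpow_mult_distr pow_inv.
have h1 := INR_fact_neq_0 n; have h2 := INR_fact_neq_0 (m + n)%nat.
have h3 : INR (S n) <> 0 by apply: not_0_INR; lia.
have h4 : INR m + INR (S n) <> 0 by rewrite -plus_INR; apply: not_0_INR; lia.
have h5 : IZR q ^ n <> 0 by exact: pow_nonzero.
rewrite -!tech_pow_Rmult.
by field; repeat split.
Qed.

(** The quotient of the terms of orders [k + 1] and [k] is at most
    [2 T / ((k + 1) (m + k + 1))], since [A + B (k + 1) <= 2 (A + B k)] for
    [k >= 1]; the last condition makes it at most [1] from the order [n] on. *)
Definition large_order (m p q : Z) (n : nat) : bool :=
  let k := Z.of_nat n in
  [&& Nat.even n, (1 <=? k)%Z & (2 * p <=? q * ((k + 1) * (m + k + 1)))%Z].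

(** For even [n], the partial sums of the orders [n + 1] and [n] are a lower and
    an upper bound of the value. *)
Definition positive_at A B m p q n :=
  large_order m p q n && (0 <? (scaled_sum A B m p q (S n)).1)%Z.
Definition negative_at A B m p q n :=
  large_order m p q n && ((scaled_sum A B m p q n).1 <? 0)%Z.

Lemma sign_bounds (A B p q : Z) (m n : nat) :
  (0 <= A)%Z -> (0 <= B)%Z -> (0 <= p)%Z -> (0 < q)%Z ->
  large_order (Z.of_nat m) p q n ->
  let T := IZR p / IZR q in
  let l := IZR A * H m T - IZR B * (T * H (S m) T) in
  ((0 < (scaled_sum A B (Z.of_nat m) p q (S n)).1)%Z -> 0 < l) /\
  (((scaled_sum A B (Z.of_nat m) p q n).1 < 0)%Z -> l < 0).
Proof.
move=> hA hB hp hq /and3P[/Nat.even_spec ev /Z.leb_le n1 /Z.leb_le big] T l.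
have hA' : 0 <= IZR A by exact: (IZR_le 0).
have hB' : 0 <= IZR B by exact: (IZR_le 0).
have hp' : 0 <= IZR p by exact: (IZR_le 0).
have hq' : 0 < IZR q by exact: (IZR_lt 0).
have hT : 0 <= T.
  by apply: Rmult_le_pos => //; apply: Rlt_le; exact: Rinv_0_lt_compat.
have fp k : 0 < INR (fact k) by exact: INR_fact_lt_0.
set u := fun k => (IZR A + IZR B * INR k) * T ^ k
                  / (INR (fact k) * INR (fact (m + k)%nat)).
have u0 k : 0 <= u k.
  apply: Rmult_le_pos.
    apply: Rmult_le_pos; last exact: pow_le.
    by have := pos_INR k; nra.
  apply: Rlt_le; apply: Rinv_0_lt_compat; exact: Rmult_lt_0_compat.
have hu k : (n <= k)%nat -> 0 <= u (S k) <= u k.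
  move=> nk; split; first exact: u0.
  have e : u (S k) * (INR (S k) * INR (S (m + k)%nat))
           = (IZR A + IZR B * INR (S k)) * (T * T ^ k)
                  / (INR (fact k) * INR (fact (m + k)%nat)).
    rewrite /u (_ : (m + S k)%nat = S (m + k)%nat); last by lia.
    have f j : INR (fact (S j)) = INR (S j) * INR (fact j).
      by rewrite -mult_INR.
    rewrite !f -tech_pow_Rmult.
    have := fp k; have := fp (m + k)%nat.
    have : INR (S k) <> 0 by apply: not_0_INR; lia.
    have : INR (S (m + k)%nat) <> 0 by apply: not_0_INR; lia.
    by move=> *; field; repeat split=> //; lra.
  have c1 : 0 < INR (S k) * INR (S (m + k)%nat).
    by apply: Rmult_lt_0_compat; apply: lt_0_INR; lia.
  apply: (Rmult_le_reg_r _ _ _ c1); rewrite e /u.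
  rewrite /Rdiv; set d := / (_ * _).
  have hd : 0 <= d.
    by apply: Rlt_le; apply: Rinv_0_lt_compat; exact: Rmult_lt_0_compat.
  have hk : 0 <= T ^ k by exact: pow_le.
  have c2 : 2 * T <= INR (S k) * INR (S (m + k)%nat).
    have : 2 * IZR p <= IZR q * (INR (S k) * INR (S (m + k)%nat)).
      rewrite !INR_IZR_INZ -!mult_IZR; apply: IZR_le; nia.
    rewrite /T /Rdiv => h; apply: (Rmult_le_reg_l (IZR q)) => //.
    by field_simplify; lra.
  have c3 : IZR A + IZR B * INR (S k) <= 2 * (IZR A + IZR B * INR k).
    have : 1 <= INR k by rewrite (_ : 1 = INR 1) //; apply: le_INR; lia.
    rewrite S_INR; nra.
  have c4 : (IZR A + IZR B * INR (S k)) * T <=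
      (IZR A + IZR B * INR k) * (INR (S k) * INR (S (m + k)%nat)).
    have hY : 0 <= IZR A + IZR B * INR k by have := pos_INR k; nra.
    have := Rmult_le_compat_r _ _ _ hT c3.
    have := Rmult_le_compat_l _ _ _ hY c2; lra.
  have hkd : 0 <= T ^ k * d by exact: Rmult_le_pos.
  move: (Rmult_le_compat_r _ _ _ hkd c4).
  set c := INR (S k) * _; lra.
have [lo up] := alternating_bounds _ _ _ (bessel_combination_series
   (IZR A) (IZR B) m T) ev hu.
have [_ e1] := scaled_sumE A B p q m (S n) hq.
have [_ e2] := scaled_sumE A B p q m n hq.
have pos k : 0 < INR (fact k) * INR (fact (m + k)%nat) * IZR q ^ k.
  apply: Rmult_lt_0_compat; last exact: pow_lt.
  exact: Rmult_lt_0_compat.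
split=> [/(IZR_lt 0)|/IZR_lt].
  rewrite e1 => h; apply: Rlt_le_trans lo.
  apply: (Rmult_lt_reg_r _ _ _ (pos (S n))); rewrite Rmult_0_l; exact: h.
rewrite e2 => h; apply: (Rle_lt_trans _ _ _ up).
apply: (Rmult_lt_reg_r _ _ _ (pos n)); rewrite Rmult_0_l; exact: h.
Qed.

(** * Monotonicity and intermediate values *)

Lemma derive_continuity_pt f x l : is_derive f x l -> continuity_pt f x.
Proof.
move=> h; apply: derivable_continuous_pt.
by exists l; apply/is_derive_Reals.
Qed.

Lemma mean_value f df a b : a < b ->
  (forall x, a <= x <= b -> is_derive f x (df x)) ->
  exists2 c, a < c < b & f b - f a = df c * (b - a).
Proof.
move=> ab h; have [|c [e hc]] := MVT_cor2 f df a b ab.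
  by move=> c hc; apply/is_derive_Reals; exact: h.
by exists c.
Qed.

Lemma derive_ge0_le f df a b : a <= b ->
  (forall x, a <= x <= b -> is_derive f x (df x)) ->
  (forall x, a < x < b -> 0 <= df x) -> f a <= f b.
Proof.
move=> [ab|->] h pos; last by lra.
have [c hc e] := mean_value _ _ _ _ ab h.
by have := pos c hc; nra.
Qed.

Lemma derive_le0_le f df a b : a <= b ->
  (forall x, a <= x <= b -> is_derive f x (df x)) ->
  (forall x, a < x < b -> df x <= 0) -> f b <= f a.
Proof.
move=> [ab|->] h neg; last by lra.
have [c hc e] := mean_value _ _ _ _ ab h.
by have := neg c hc; nra.
Qed.

Lemma zero_between f a b : a < b ->
  (forall x, a <= x <= b -> continuity_pt f x) -> f a * f b < 0 ->
  exists2 z, a < z < b & f z = 0.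
Proof.
move=> ab cf s.
have nz z : a <= z <= b -> f z = 0 -> a < z < b.
  move=> [h1 h2] fz; split.
    by case: h1 => // e; rewrite e fz in s; lra.
  by case: h2 => // e; rewrite -e fz in s; lra.
case: (Rlt_dec (f a) 0) => fa.
  have fb : 0 < f b by nra.
  by have [z [hz fz]] := Ranalysis5.IVT_interv f a b cf ab fa fb; exists z; first exact: nz.
have fa0 : f a <> 0 by move=> e; rewrite e in s; lra.
have fa' : 0 < f a by lra.
have fb : f b < 0 by nra.
have fa'' : - f a < 0 by lra.
have fb'' : 0 < - f b by lra.
have cN x : a <= x <= b -> continuity_pt (fun x => - f x) x.
  by move=> hx; apply: continuity_pt_opp; exact: cf.
have [z [hz fz]] := Ranalysis5.IVT_interv (fun x => - f x) a b cN ab fa'' fb''.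
by exists z; [apply: nz => //; lra | lra].
Qed.

Lemma nonzero_positive f a b : 0 < f b ->
  (forall x, a < x <= b -> continuity_pt f x) ->
  (forall x, a < x <= b -> f x <> 0) -> forall x, a < x <= b -> 0 < f x.
Proof.
move=> fb cf nz x hx; case: (Rlt_dec 0 (f x)) => // fx.
have fx' : f x < 0 by have := nz x hx; lra.
have xb : x < b by case: (proj2 hx) => // e; rewrite e in fx'; lra.
have [||z hz fz] := zero_between f x b xb.
- by move=> t ht; apply: cf; lra.
- nra.
by case: (nz z _ fz); lra.
Qed.

(** * Oscillation in the phase variable *)

(** For the order [M] and the argument [x], [w = sqrt (x^2 - M^2)] and
    [phase M w] is the WKB phase [sqrt (x^2 - M^2) - M acos (M / x)]. *)
Definition phase (M w : R) : R := w - M * atan (w / M).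

(** The value of [T = x^2 / 4] at [w = sqrt (x^2 - M^2)]. *)
Definition arg (M w : R) : R := (w ^ 2 + M ^ 2) / 4.

Lemma phase_derive M w : 0 <= M -> 0 < w ->
  is_derive (phase M) w (w ^ 2 / (w ^ 2 + M ^ 2)).
Proof.
move=> [hM|<-] hw; rewrite /phase.
  auto_derive; first by [].
  by field; split; [nra | lra].
apply: (is_derive_ext (fun x => x)); first by move=> t; rewrite Rmult_0_l; lra.
rewrite (_ : _ / _ = 1); last by field; nra.
by auto_derive.
Qed.

Lemma phase_lt M a b : 0 <= M -> 0 < a -> a < b -> phase M a < phase M b.
Proof.
move=> hM ha ab.
have [x hx|c hc e] := mean_value (phase M) (fun w => w ^ 2 / (w ^ 2 + M ^ 2)) a b ab.
  by apply: phase_derive => //; lra.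
have : 0 < c ^ 2 / (c ^ 2 + M ^ 2) by apply: Rdiv_lt_0_compat; nra.
nra.
Qed.

Lemma phase_inverse M a b t : 0 <= M -> 0 < a -> a < b ->
  phase M a < t <= phase M b -> exists2 c, a < c <= b & phase M c = t.
Proof.
move=> hM ha ab [h1 [h2|->]]; last by exists b; lra.
have [||c hc e] := zero_between (fun x => phase M x - t) a b ab.
- move=> x hx; apply: continuity_pt_minus; last exact: continuity_pt_const.
  by apply: derive_continuity_pt; apply: phase_derive => //; lra.
- nra.
by exists c; lra.
Qed.

Section SturmSteps.

(** [y] and [q] stand for [J_M(x)] and [x J_M'(x)]. *)
Variables (M : R) (y q : R -> R).
Hypothesis M0 : 0 <= M.
Hypothesis dy : forall w, 0 < w -> is_derive y w (w / (w ^ 2 + M ^ 2) * q w).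
Hypothesis dq : forall w, 0 < w ->
  is_derive q w (- (w ^ 3 / (w ^ 2 + M ^ 2) * y w)).

Let cy w : 0 < w -> continuity_pt y w.
Proof. by move=> hw; apply: derive_continuity_pt (dy w hw). Qed.

Let cq w : 0 < w -> continuity_pt q w.
Proof. by move=> hw; apply: derive_continuity_pt (dq w hw). Qed.

(** In the variable [t = phase], [Y = sqrt w * y] solves [Y'' + (1 + V) Y = 0]
    with [V >= 0], so by Sturm comparison with [sin] it cannot keep a sign on
    an interval of length [pi] that begins at a zero; below, [W] is the
    Wronskian of [Y] and [sin (t - t0)]. *)
Lemma no_long_positive a b : 0 < a -> a < b -> y a = 0 ->
  phase M b = phase M a + PI -> ~ (forall w, a < w <= b -> 0 < y w).
Proof.
move=> ha ab ya eb pos.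
pose s w := sin (phase M w - phase M a); pose c w := cos (phase M w - phase M a).
pose W w := (q w * s w + ((w ^ 2 + M ^ 2) / w ^ 2 / 2 * s w - w * c w) * y w)
            / sqrt w.
pose dW w := - ((w ^ 2 + 5 * M ^ 2) / (4 * w ^ 4) * sqrt w * y w * s w).
have dWw w : a <= w <= b -> is_derive W w (dW w).
  move=> hw; have w0 : 0 < w by lra.
  have d1 := dy w w0; have d2 := dq w w0; have d3 := phase_derive M w M0 w0.
  rewrite /W /s /c; auto_derive.
    repeat split=> //; try by [exists (w / (w ^ 2 + M ^ 2) * q w) |
      exists (- (w ^ 3 / (w ^ 2 + M ^ 2) * y w)) |
      exists (w ^ 2 / (w ^ 2 + M ^ 2))].
    - nra.
    - by have := sqrt_lt_R0 w w0; lra.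
  rewrite (is_derive_unique _ _ _ d1) (is_derive_unique _ _ _ d2).
  rewrite (is_derive_unique _ _ _ d3) /dW /s.
  set S := sin _; set C := cos _.
  have := sqrt_sqrt w (Rlt_le _ _ w0); have := sqrt_lt_R0 w w0.
  move: (sqrt w) => r r0 e; rewrite -!e in w0 *.
  by field; split; nra.
have phase_mono u v : a <= u -> u <= v -> phase M u <= phase M v.
  by move=> au [uv|->]; [apply: Rlt_le; apply: phase_lt => //; lra | lra].
have y_ge0 w : a <= w <= b -> 0 <= y w.
  move=> [[h1|<-] h2]; last by rewrite ya; lra.
  by apply: Rlt_le; apply: pos.
have : W b <= W a.
  apply: (derive_le0_le W dW) => //; first by lra.
  move=> w hw; rewrite /dW.
  have h1 : 0 <= s w.
    apply: sin_ge_0; first by have := phase_mono a w ltac:(lra) ltac:(lra); lra.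
    by have := phase_mono w b ltac:(lra) ltac:(lra); lra.
  have h2 : 0 <= y w by apply: y_ge0; lra.
  have h3 : 0 <= (w ^ 2 + 5 * M ^ 2) / (4 * w ^ 4).
    apply: Rmult_le_pos; first by nra.
    by apply: Rlt_le; apply: Rinv_0_lt_compat; have := pow_lt w 4; nra.
  have h4 := sqrt_pos w.
  have := Rmult_le_pos _ _ (Rmult_le_pos _ _ (Rmult_le_pos _ _ h3 h4) h2) h1.
  lra.
rewrite /W /s /c ya eb.
rewrite (_ : phase M a + PI - phase M a = PI); last by ring.
rewrite (_ : phase M a - phase M a = 0); last by ring.
rewrite sin_PI cos_PI sin_0.
have yb : 0 < y b by apply: pos; lra.
have rb : 0 < sqrt b by apply: sqrt_lt_R0; lra.
have : 0 < b * y b / sqrt b by apply: Rdiv_lt_0_compat => //; nra.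
rewrite /Rdiv; lra.
Qed.

(** As long as [q > 0], [y] grows from its zero and stays positive; but then
    [D = q sin - w y cos] decreases from [0], because [D' = - y cos], whereas it
    would end with the positive value [q b]. *)
Lemma no_long_growth a b : 0 < a -> a < b -> y a = 0 ->
  phase M b = phase M a + PI / 2 -> ~ (forall w, a < w <= b -> 0 < q w).
Proof.
move=> ha ab ya eb pos.
pose s w := sin (phase M w - phase M a); pose c w := cos (phase M w - phase M a).
pose D w := q w * s w - w * y w * c w.
have dDw w : a <= w <= b -> is_derive D w (- (y w * c w)).
  move=> hw; have w0 : 0 < w by lra.
  have d1 := dy w w0; have d2 := dq w w0; have d3 := phase_derive M w M0 w0.
  rewrite /D /s /c; auto_derive.
    repeat split=> //; try by [exists (w / (w ^ 2 + M ^ 2) * q w) |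
      exists (- (w ^ 3 / (w ^ 2 + M ^ 2) * y w)) |
      exists (w ^ 2 / (w ^ 2 + M ^ 2))].
  rewrite (is_derive_unique _ _ _ d1) (is_derive_unique _ _ _ d2).
  rewrite (is_derive_unique _ _ _ d3).
  by rewrite /Rminus; set S := sin _; set C := cos _; field; nra.
have phase_mono u v : a <= u -> u <= v -> phase M u <= phase M v.
  by move=> au [uv|->]; [apply: Rlt_le; apply: phase_lt => //; lra | lra].
have y_ge0 w : a <= w <= b -> 0 <= y w.
  move=> [h1 h2]; rewrite -ya.
  apply: (derive_ge0_le y (fun w => w / (w ^ 2 + M ^ 2) * q w)) => //.
    by move=> x hx; apply: dy; lra.
  move=> x hx; apply: Rmult_le_pos.
    by apply: Rlt_le; apply: Rdiv_lt_0_compat; nra.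
  by apply: Rlt_le; apply: pos; lra.
have : D b <= D a.
  apply: (derive_le0_le D (fun w => - (y w * c w))) => //; first by lra.
  move=> w hw.
  have h1 : 0 <= c w.
    apply: cos_ge_0.
      by have := phase_mono a w ltac:(lra) ltac:(lra); have := PI_RGT_0; lra.
    by have := phase_mono w b ltac:(lra) ltac:(lra); lra.
  by have := y_ge0 w ltac:(lra); nra.
rewrite /D /s /c ya eb.
rewrite (_ : phase M a + PI / 2 - phase M a = PI / 2); last by ring.
rewrite (_ : phase M a - phase M a = 0); last by ring.
rewrite sin_PI2 cos_PI2 sin_0.
have := pos b ltac:(lra); lra.
Qed.

End SturmSteps.

Section NextZeros.

Variables (M : R) (y q : R -> R).
Hypothesis M0 : 0 <= M.
Hypothesis dy : forall w, 0 < w -> is_derive y w (w / (w ^ 2 + M ^ 2) * q w).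
Hypothesis dq : forall w, 0 < w ->
  is_derive q w (- (w ^ 3 / (w ^ 2 + M ^ 2) * y w)).

Let dyN w : 0 < w ->
  is_derive (fun w => - y w) w (w / (w ^ 2 + M ^ 2) * - q w).
Proof.
move=> w0; rewrite (_ : _ * - _ = opp (w / (w ^ 2 + M ^ 2) * q w)).
  by apply: is_derive_opp; exact: dy.
by rewrite /opp /=; ring.
Qed.

Let dqN w : 0 < w ->
  is_derive (fun w => - q w) w (- (w ^ 3 / (w ^ 2 + M ^ 2) * - y w)).
Proof.
move=> w0; rewrite (_ : - (_ * - _) = opp (- (w ^ 3 / (w ^ 2 + M ^ 2) * y w))).
  by apply: is_derive_opp; exact: dq.
by rewrite /opp /=; ring.
Qed.

Lemma next_zero_y a b : 0 < a -> y a = 0 -> phase M a + PI <= phase M b ->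
  a < b -> exists2 z, a < z <= b & phase M z <= phase M a + PI /\ y z = 0.
Proof.
move=> ha ya hb ab; have pi0 := PI_RGT_0.
have [|c hc ec] := phase_inverse M a b (phase M a + PI) M0 ha ab; first by lra.
apply: Classical_Prop.NNPP => no.
have nz w : a < w <= c -> y w <> 0.
  move=> hw yw; apply: no; exists w; first by lra.
  split=> //; rewrite -ec; case: (proj2 hw) => [h|->]; last by lra.
  by apply: Rlt_le; apply: phase_lt => //; lra.
have cy w : a < w <= c -> continuity_pt y w.
  by move=> hw; apply: derive_continuity_pt; apply: dy; lra.
case: (Rlt_dec 0 (y c)) => yc.
  apply: (no_long_positive M y q M0 dy dq a c ha _ ya ec); first by lra.
  exact: nonzero_positive.
apply: (no_long_positive M _ _ M0 dyN dqN a c ha _ _ ec); [by lra | by lra |].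
apply: nonzero_positive.
- by have := nz c; lra.
- by move=> w hw; apply: continuity_pt_opp; exact: cy.
- by move=> w hw; have := nz w hw; lra.
Qed.

Lemma next_zero_q a b : 0 < a -> y a = 0 -> phase M a + PI / 2 <= phase M b ->
  a < b -> exists2 z, a < z <= b & q z = 0.
Proof.
move=> ha ya hb ab; have pi0 := PI_RGT_0.
have [|c hc ec] := phase_inverse M a b (phase M a + PI / 2) M0 ha ab.
  by lra.
apply: Classical_Prop.NNPP => no.
have nz w : a < w <= c -> q w <> 0.
  by move=> hw qw; apply: no; exists w => //; lra.
have cq w : a < w <= c -> continuity_pt q w.
  by move=> hw; apply: derive_continuity_pt; apply: dq; lra.
case: (Rlt_dec 0 (q c)) => qc.
  apply: (no_long_growth M y q M0 dy dq a c ha _ ya ec); first by lra.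
  exact: nonzero_positive.
apply: (no_long_growth M _ _ M0 dyN dqN a c ha _ _ ec); [by lra | by lra |].
apply: nonzero_positive.
- by have := nz c; lra.
- by move=> w hw; apply: continuity_pt_opp; exact: cq.
- by move=> w hw; have := nz w hw; lra.
Qed.

Lemma zero_q_between a b : 0 < a -> a < b -> y a = 0 -> y b = 0 ->
  exists2 z, a < z < b & q z = 0.
Proof.
move=> ha ab ya yb.
have [x hx|c hc e] := mean_value y (fun w => w / (w ^ 2 + M ^ 2) * q w) a b ab.
  by apply: dy; lra.
exists c => //; move: e; rewrite ya yb => e.
have h : 0 < c / (c ^ 2 + M ^ 2) by apply: Rdiv_lt_0_compat; nra.
have : c / (c ^ 2 + M ^ 2) * q c = 0 by nra.
by case/Rmult_integral; lra.
Qed.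

End NextZeros.

(** [y] and [q] are, up to the common factor [2^m], the functions [J_m(x)] and
    [x J_m'(x)] in terms of [w = sqrt (x^2 - m^2)]. *)
Definition y (m : nat) (w : R) : R :=
  exp (INR m / 2 * ln (w ^ 2 + INR m ^ 2)) * H m (arg (INR m) w).
Definition q (m : nat) (w : R) : R :=
  exp (INR m / 2 * ln (w ^ 2 + INR m ^ 2)) * N m (arg (INR m) w).

Lemma arg_derive M w : is_derive (arg M) w (w / 2).
Proof. by rewrite /arg; auto_derive; [|field]. Qed.

Lemma scale_derive M w : 0 < w ->
  is_derive (fun w => exp (M / 2 * ln (w ^ 2 + M ^ 2))) w
    (M * w / (w ^ 2 + M ^ 2) * exp (M / 2 * ln (w ^ 2 + M ^ 2))).
Proof.
move=> w0; auto_derive; first by nra.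
set e := exp _; rewrite (_ : M * 1 = M); last by ring.
by field; nra.
Qed.

Lemma y_derive m w : 0 < w ->
  is_derive (y m) w (w / (w ^ 2 + INR m ^ 2) * q m w).
Proof.
move=> w0; have d1 := scale_derive (INR m) w w0.
have d2 := is_derive_comp _ _ _ _ _ (H_derive m (arg (INR m) w))
                                    (arg_derive (INR m) w).
have := is_derive_mult _ _ _ _ _ d1 d2 Rmult_comm.
rewrite /y /q; set e := exp _.
congr is_derive; rewrite /plus /mult /scal /= /mult /= /N.
by set h := H m _; set g := H (S m) _; rewrite /arg; field; nra.
Qed.

Lemma q_derive m w : 0 < w ->
  is_derive (q m) w (- (w ^ 3 / (w ^ 2 + INR m ^ 2) * y m w)).
Proof.
move=> w0; have d1 := scale_derive (INR m) w w0.
have d2 := is_derive_comp _ _ _ _ _ (N_derive m (arg (INR m) w))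
                                    (arg_derive (INR m) w).
have := is_derive_mult _ _ _ _ _ d1 d2 Rmult_comm.
rewrite /y /q; set e := exp _.
congr is_derive; rewrite /plus /mult /scal /= /mult /= /N.
by set h := H m _; set g := H (S m) _; rewrite /arg; field; nra.
Qed.

Lemma y_eq0 m w : y m w = 0 <-> H m (arg (INR m) w) = 0.
Proof.
rewrite /y; split=> [|->]; last by ring.
by case/Rmult_integral => //; have := exp_pos (INR m / 2 * ln (w ^ 2 + INR m ^ 2)); lra.
Qed.

Lemma q_eq0 m w : q m w = 0 <-> N m (arg (INR m) w) = 0.
Proof.
rewrite /q; split=> [|->]; last by ring.
by case/Rmult_integral => //; have := exp_pos (INR m / 2 * ln (w ^ 2 + INR m ^ 2)); lra.
Qed.

(** * Turning point and trial functions *)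

Lemma H_continuity m T : continuity_pt (H m) T.
Proof. exact: derive_continuity_pt (H_derive m T). Qed.

Lemma N_continuity m T : continuity_pt (N m) T.
Proof. exact: derive_continuity_pt (N_derive m T). Qed.

Lemma H_at0_gt0 m : 0 < H m 0.
Proof. by rewrite H_at0; apply: Rinv_0_lt_compat; exact: INR_fact_lt_0. Qed.

Lemma N_at0 m : N m 0 = INR m * H m 0.
Proof. by rewrite /N; ring. Qed.

Lemma positive_near0 f : continuity_pt f 0 -> 0 < f 0 ->
  exists2 e, 0 < e & forall x, 0 <= x <= e -> 0 < f x.
Proof.
move=> cf f0; have [d [d0 hd]] := cf (f 0) f0.
exists (d / 2) => [|x [h1 h2]]; first by lra.
case: (Req_dec x 0) => [->//|nx].
have : R_dist (f x) (f 0) < f 0.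
  apply: hd; split; first by split=> //; lra.
  by rewrite /= /R_dist Rabs_right; lra.
by rewrite /R_dist => /Rabs_def2; lra.
Qed.

(** Where [x J_m' > 0], [J_m] increases from [J_m(0) >= 0]. *)
Lemma N_gt0_H_gt0 m T1 : (forall T, 0 <= T < T1 -> 0 < N m T) ->
  forall T, 0 <= T <= T1 -> 0 < H m T.
Proof.
move=> hN T hT.
have [e e0 he] := positive_near0 (H m) (H_continuity m 0) (H_at0_gt0 m).
case: (Rle_dec T e) => Te; first by apply: he; lra.
pose z t := exp (INR m / 2 * ln t) * H m t.
pose dz t := exp (INR m / 2 * ln t) * N m t / (2 * t).
have : z e <= z T.
  apply: (derive_ge0_le z dz); first by lra.
    move=> x hx; rewrite /z /dz /N.
    have d := H_derive m x; auto_derive.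
      by repeat split; [lra | exists (- H (S m) x)].
    rewrite (is_derive_unique _ _ _ d); set E := exp _; field; lra.
  move=> x hx; rewrite /dz; apply: Rlt_le; apply: Rdiv_lt_0_compat; last by lra.
  by apply: Rmult_lt_0_compat; [exact: exp_pos | apply: hN; lra].
rewrite /z => h.
have h1 : 0 < H m e by apply: he; lra.
have := Rmult_lt_0_compat _ _ (exp_pos (INR m / 2 * ln e)) h1.
have := exp_pos (INR m / 2 * ln T); nra.
Qed.

(** [x (x J_m J_m')' = (x J_m')^2 + (m^2 - x^2) J_m^2], so [x J_m J_m'] increases
    up to the turning point [x = m], and neither factor vanishes before it. *)
Lemma before_turning_point m T : (0 < m)%nat -> 0 <= T <= INR m ^ 2 / 4 ->
  0 < H m T /\ 0 < N m T.
Proof.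
move=> m0 hT; have M0 : 0 < INR m by exact: lt_0_INR.
have hN0 : 0 < N m 0.
  by rewrite N_at0; apply: Rmult_lt_0_compat => //; exact: H_at0_gt0.
have [e1 e10 he1] := positive_near0 (H m) (H_continuity m 0) (H_at0_gt0 m).
have [e2 e20 he2] := positive_near0 (N m) (N_continuity m 0) hN0.
pose e := Rmin e1 e2.
have [ee1 ee2] : e <= e1 /\ e <= e2 by split; [exact: Rmin_l | exact: Rmin_r].
have e0 : 0 < e by apply: Rmin_pos.
pose K t := exp (INR m * ln t) * (H m t * N m t).
pose dK t := exp (INR m * ln t) / t *
  (N m t ^ 2 / 2 + 2 * H m t ^ 2 * (INR m ^ 2 / 4 - t)).
have pos t : 0 <= t <= INR m ^ 2 / 4 -> 0 < H m t * N m t.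
  move=> ht; case: (Rle_dec t e) => te.
    by apply: Rmult_lt_0_compat; [apply: he1 | apply: he2]; lra.
  have : K e <= K t.
    apply: (derive_ge0_le K dK); first by lra.
      move=> x hx; rewrite /K /dK.
      have d1 := H_derive m x; have d2 := N_derive m x; auto_derive.
        repeat split; first by lra.
          by exists (- H (S m) x).
        by exists (INR m * H (S m) x - 2 * H m x).
      rewrite (is_derive_unique _ _ _ d1) (is_derive_unique _ _ _ d2) /N.
      by set E := exp _; field; lra.
    move=> x hx; rewrite /dK; apply: Rmult_le_pos.
      by apply: Rlt_le; apply: Rdiv_lt_0_compat; [exact: exp_pos | lra].
    have := pow2_ge_0 (N m x); have := pow2_ge_0 (H m x); nra.
  rewrite /K => h.
  have h0 : 0 < H m e * N m e.
    by apply: Rmult_lt_0_compat; [apply: he1 | apply: he2]; lra.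
  have := Rmult_lt_0_compat _ _ (exp_pos (INR m * ln e)) h0.
  have := exp_pos (INR m * ln t); nra.
have aux f : (forall x, continuity_pt f x) -> 0 < f 0 ->
    (forall t, 0 <= t <= INR m ^ 2 / 4 -> f t <> 0) -> 0 < f T.
  move=> cf f0 nz; case: (Rlt_dec 0 (f T)) => // fT.
  have fT' : f T < 0 by have := nz T hT; lra.
  have T0 : 0 < T.
    by case: (proj1 hT) => // e'; rewrite -e' in fT'; lra.
  have [|z hz fz] := zero_between f 0 T T0 (fun x _ => cf x); first by nra.
  by case: (nz z _ fz); lra.
split; apply: aux => //.
- exact: H_continuity.
- exact: H_at0_gt0.
- by move=> t /pos h e'; rewrite e' in h; lra.
- exact: N_continuity.
- by move=> t /pos h e'; rewrite e' in h; lra.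
Qed.

Lemma H_turning_point_gt0 m : 0 < H m (arg (INR m) 0).
Proof.
have -> : arg (INR m) 0 = INR m ^ 2 / 4 by rewrite /arg; field.
case: m => [|m]; last first.
  by apply: (proj1 (before_turning_point _ _ _ _)); [lia | nra].
by rewrite (_ : _ / 4 = 0) ?H_at0 /=; lra.
Qed.

Lemma zero_after_turning_point f M T w1 : (forall x, continuity_pt f x) ->
  0 < f (arg M 0) -> (forall t, 0 <= t <= M ^ 2 / 4 -> 0 < f t) ->
  0 <= T -> f T <= 0 -> T <= arg M w1 -> 0 < w1 ->
  exists2 w, 0 < w <= w1 & f (arg M w) = 0.
Proof.
move=> cf f0 pos T0 fT Tw w10.
have TM : M ^ 2 / 4 < T.
  by case: (Rlt_dec (M ^ 2 / 4) T) => // h; have := pos T; lra.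
pose w := sqrt (4 * T - M ^ 2).
have ew : w * w = 4 * T - M ^ 2 by apply: sqrt_sqrt; lra.
have w0 : 0 < w by apply: sqrt_lt_R0; lra.
have aw : arg M w = T by rewrite /arg /= ; lra.
have ww1 : w <= w1.
  by apply: Rnot_lt_le => h; move: Tw; rewrite /arg; nra.
case: fT => [fT|fT]; last by exists w; [lra | rewrite aw].
have [||z hz fz] := zero_between (fun v => f (arg M v)) 0 w w0.
- move=> x _; apply: (continuity_pt_comp (arg M) f); last exact: cf.
  exact: derive_continuity_pt (arg_derive M x).
- by rewrite aw; nra.
by exists z => //; lra.
Qed.

Lemma zero_of_H m T w1 : 0 <= T -> H m T <= 0 -> T <= arg (INR m) w1 ->
  0 < w1 -> exists2 w, 0 < w <= w1 & H m (arg (INR m) w) = 0.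
Proof.
move=> T0 hT Tw w10; have hm := H_turning_point_gt0 m.
apply: (zero_after_turning_point (H m) _ T) => //; first exact: H_continuity.
case: m hm {hT Tw} => [|m] hm t ht; last first.
  by apply: (proj1 (before_turning_point _ _ _ _)); [lia | lra].
have -> : t = 0 by move: ht; rewrite /=; lra.
by rewrite H_at0 /=; lra.
Qed.

Lemma zero_of_N m T w1 : (0 < m)%nat -> 0 <= T -> N m T <= 0 ->
  T <= arg (INR m) w1 -> 0 < w1 ->
  exists2 w, 0 < w <= w1 & N m (arg (INR m) w) = 0.
Proof.
move=> m0 T0 hT Tw w10.
have pos t : 0 <= t <= INR m ^ 2 / 4 -> 0 < N m t.
  by move=> ht; apply: (proj2 (before_turning_point _ _ m0 ht)).
apply: (zero_after_turning_point (N m) _ T) => //; first exact: N_continuity.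
apply: pos; rewrite /arg /=; nra.
Qed.

Section TrialFunctions.

(** Picone inequality for the Bessel equation: as long as [J_m > 0], the
    Dirichlet form of a trial function exceeds the boundary value given by the
    logarithmic derivative of [J_m].  The variable [u] is affine in [x^2] and
    adapted to the width [m^(1/3)] of the turning point region; the turning
    point is [u = a]. *)
Variables (m : nat) (eta a : R).
Hypothesis eta0 : 0 < eta.
Hypothesis m_eta : INR m ^ 2 * eta ^ 3 = 4.

Let kappa := 1 - eta * a.
Let T u := (kappa + eta * u) / eta ^ 3.

Variables (f df G : R -> R) (L : R).
Hypothesis f_derive : forall u, is_derive f u (df u).
Hypothesis G_derive : forall u, is_derive G u
  ((kappa + eta * u) ^ 2 * df u ^ 2 + eta * (kappa + eta * u) * f u * df u
   + (eta ^ 2 / 4 + a - u) * f u ^ 2).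
Hypothesis f0 : f 0 = 0.
Hypothesis L0 : 0 < L.

Lemma picone : (forall u, 0 <= u <= L -> 0 < H m (T u)) ->
  eta * (kappa + eta * L) * f L ^ 2 * N m (T L) / (2 * H m (T L)) <= G L - G 0.
Proof.
move=> pos.
pose B u := eta * (kappa + eta * u) * f u ^ 2 * (N m (T u) / (2 * H m (T u))).
pose dB u := (kappa + eta * u) ^ 2 * df u ^ 2
  + eta * (kappa + eta * u) * f u * df u + (eta ^ 2 / 4 + a - u) * f u ^ 2
  - ((kappa + eta * u) * df u + eta * f u / 2
     - eta * f u * (N m (T u) / H m (T u)) / 2) ^ 2.
have Bd u : 0 <= u <= L -> is_derive B u (dB u).
  move=> hu; have h := pos u hu.
  have dT : is_derive T u (/ eta ^ 2).
    by rewrite /T; auto_derive; [nra | field; lra].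
  have d1 := H_derive m (T u); have d2 := N_derive m (T u).
  have d3 := f_derive u.
  rewrite /B; auto_derive.
    repeat split; try by eexists; exact: dT.
    - by exists (df u).
    - by eexists; exact: d2.
    - by eexists; exact: d1.
    - by lra.
  rewrite (is_derive_unique _ _ _ d1) (is_derive_unique _ _ _ d2).
  rewrite (is_derive_unique _ _ _ d3) (is_derive_unique _ _ _ dT) /dB /N.
  have -> : eta ^ 2 / 4 + a - u
          = eta ^ 2 * (INR m ^ 2 / 4 - T u) + eta ^ 2 / 4.
    rewrite /T /kappa; have -> : INR m ^ 2 = 4 / eta ^ 3.
      by rewrite -m_eta; field; lra.
    by field; lra.
  have -> : kappa + eta * u = eta ^ 3 * T u by rewrite /T; field; lra.
  set t := T u in h *; set g := H (S m) t; set h0 := H m t in h *.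
  by field; split; lra.
have : G 0 - B 0 <= G L - B L.
  apply: (derive_ge0_le (fun u => G u - B u) (fun u =>
    ((kappa + eta * u) ^ 2 * df u ^ 2 + eta * (kappa + eta * u) * f u * df u
    + (eta ^ 2 / 4 + a - u) * f u ^ 2) - dB u)); first by lra.
    by move=> u hu; apply: is_derive_minus; [exact: G_derive | exact: Bd].
  move=> u hu; rewrite /dB; set X := _ - _ / 2; have := pow2_ge_0 X; lra.
rewrite /B f0 => h.
rewrite (_ : _ / _ = eta * (kappa + eta * L) * f L ^ 2
                     * (N m (T L) / (2 * H m (T L)))); last first.
  by have := pos L ltac:(lra) => ?; field; lra.
lra.
Qed.

Hypothesis kappa0 : 0 <= kappa.

(** A trial function with nonpositive energy forces [J_m], or in the second case
    [J_m'], to lose its sign before the end of the interval. *)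
Lemma trial_dirichlet : f L = 0 -> G L < G 0 ->
  exists2 u, 0 <= u <= L & H m (T u) <= 0.
Proof.
move=> fL hG; apply: Classical_Prop.NNPP => no.
have pos u : 0 <= u <= L -> 0 < H m (T u).
  by move=> hu; apply: Rnot_le_lt => h; apply: no; exists u.
by have := picone pos; rewrite fL /Rdiv; lra.
Qed.

Lemma trial_neumann : f L <> 0 -> G L <= G 0 ->
  exists2 t, 0 <= t <= T L & N m t <= 0.
Proof.
move=> fL hG; apply: Classical_Prop.NNPP => no.
have e3 : 0 < eta ^ 3 by exact: pow_lt.
have TL : 0 < T L by apply: Rdiv_lt_0_compat => //; nra.
have posN t : 0 <= t <= T L -> 0 < N m t.
  by move=> ht; apply: Rnot_le_lt => h; apply: no; exists t.
have posH : forall t, 0 <= t <= T L -> 0 < H m t.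
  by apply: N_gt0_H_gt0 => t ht; apply: posN; lra.
have Tle u : 0 <= u <= L -> 0 <= T u <= T L.
  move=> hu; split; first by apply: Rdiv_le_0_compat => //; nra.
  by apply: Rmult_le_compat_r; [apply: Rlt_le; exact: Rinv_0_lt_compat | nra].
have := picone (fun u hu => posH _ (Tle u hu)).
have h1 : 0 < H m (T L) by apply: posH; lra.
have h2 : 0 < N m (T L) by apply: posN; lra.
have h3 : 0 < f L ^ 2 by rewrite -Rsqr_pow2; exact: Rsqr_pos_lt.
have h4 : 0 < kappa + eta * L by nra.
suff : 0 < eta * (kappa + eta * L) * f L ^ 2 * N m (T L) / (2 * H m (T L)).
  by lra.
by apply: Rdiv_lt_0_compat; repeat apply: Rmult_lt_0_compat => //; lra.
Qed.

End TrialFunctions.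

(** * First zeros of large order *)

(** A convergent of the continued fraction of [atan]. *)
Lemma atan_ge_pade x : 0 <= x ->
  x * (105 + 55 * x ^ 2) / (105 + 90 * x ^ 2 + 9 * x ^ 4) <= atan x.
Proof.
move=> x0.
pose f t := atan t - t * (105 + 55 * t ^ 2) / (105 + 90 * t ^ 2 + 9 * t ^ 4).
pose df t := 576 * t ^ 8
  / ((1 + t ^ 2) * (105 + 90 * t ^ 2 + 9 * t ^ 4) ^ 2).
have Q t : 0 < 105 + 90 * t ^ 2 + 9 * t ^ 4 by nra.
have : f 0 <= f x.
  apply: (derive_ge0_le f df) => // t ht.
    rewrite /f /df; have := Q t => hQ; auto_derive; first by lra.
    by field; split; nra.
  rewrite /df; apply: Rmult_le_pos; first by have := pow_le t 8; lra.
  apply: Rlt_le; apply: Rinv_0_lt_compat; apply: Rmult_lt_0_compat; first by nra.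
  by apply: pow_lt; exact: Q.
rewrite /f atan_0; lra.
Qed.

Lemma atan_le_taylor x : 0 <= x -> atan x <= x - x ^ 3 / 3 + x ^ 5 / 5.
Proof.
move=> x0.
pose f t := t - t ^ 3 / 3 + t ^ 5 / 5 - atan t.
have : f 0 <= f x.
  apply: (derive_ge0_le f (fun t => t ^ 6 / (1 + t ^ 2))) => // t ht.
    by rewrite /f; auto_derive => //; field; nra.
  by apply: Rdiv_le_0_compat; [apply: pow_le; lra | nra].
rewrite /f atan_0; lra.
Qed.

Lemma PI_gt : 31415 / 10000 < PI.
Proof.
have := Machin_4_5_239; have := atan_ge_pade (/ 5) ltac:(lra).
have := atan_le_taylor (/ 239) ltac:(lra); lra.
Qed.

Lemma PI_lt : PI < 31417 / 10000.
Proof.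
have := Machin_4_5_239; have := atan_ge_pade (/ 239) ltac:(lra).
have := atan_le_taylor (/ 5) ltac:(lra); lra.
Qed.

Lemma phase_le_pade M x : 0 < M -> 0 <= x ->
  phase M (M * x)
  <= M * x ^ 3 * (35 + 9 * x ^ 2) / (105 + 90 * x ^ 2 + 9 * x ^ 4).
Proof.
move=> M0 x0; rewrite /phase (_ : M * x / M = x); last by field; lra.
have Q : 0 < 105 + 90 * x ^ 2 + 9 * x ^ 4 by nra.
rewrite (_ : _ / _ = M * (x - x * (105 + 55 * x ^ 2)
                               / (105 + 90 * x ^ 2 + 9 * x ^ 4))).
  by have := atan_ge_pade x x0; nra.
by field; lra.
Qed.

Lemma phase_le_taylor M x : 0 < M -> 0 < x ->
  phase M (M * x)
  <= M * (x - PI / 2 + (/ x - (/ x) ^ 3 / 3 + (/ x) ^ 5 / 5)).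
Proof.
move=> M0 x0; rewrite /phase (_ : M * x / M = x); last by field; lra.
have ix : 0 < / x by exact: Rinv_0_lt_compat.
have := atan_le_taylor (/ x) (Rlt_le _ _ ix).
by rewrite atan_inv //; nra.
Qed.

(** [eta] is [(4 / m^2)^(1/3)]: the unit of [x^2 / m^2] in which Bessel's equation
    near the turning point becomes Airy's equation. *)
Lemma scale_exists m : (0 < m)%nat ->
  exists2 eta, 0 < eta & INR m ^ 2 * eta ^ 3 = 4.
Proof.
move=> m0; have M0 : 0 < INR m by exact: lt_0_INR.
exists (exp (ln (4 / INR m ^ 2) / 3)); first exact: exp_pos.
have -> : exp (ln (4 / INR m ^ 2) / 3) ^ 3 = exp (ln (4 / INR m ^ 2)).
  set l := ln _; rewrite -{2}(_ : l / 3 + l / 3 + l / 3 = l); last by field.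
  by rewrite !exp_plus; ring.
rewrite exp_ln; first by field; lra.
by apply: Rdiv_lt_0_compat; [lra | exact: pow_lt].
Qed.

Lemma scale_small m eta : (20 <= m)%nat -> 0 < eta ->
  INR m ^ 2 * eta ^ 3 = 4 -> eta <= 2155 / 10000.
Proof.
move=> m20 e0 e; apply: Rnot_lt_le => h.
have : INR 20 <= INR m by exact: le_INR.
rewrite (_ : INR 20 = 20); last by rewrite /=; lra.
move=> hM; have h2 : 4644 / 100000 < eta ^ 2 by nra.
have h3 : 1 / 100 < eta ^ 3 by rewrite -tech_pow_Rmult; nra.
have h4 : 400 <= INR m ^ 2 by nra.
nra.
Qed.

(** In both applications the trial interval ends at the point [u = a + s] with
    [s] bounded, where the phase is about [2 s^(3/2) / 3]. *)
Lemma phase_trial_le m eta s c : (0 < m)%nat -> 0 < eta ->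
  INR m ^ 2 * eta ^ 3 = 4 -> 0 < s -> 0 <= c ->
  4 * s ^ 3 * (35 + 9 * (eta * s)) ^ 2
    <= c ^ 2 * (105 + 90 * (eta * s) + 9 * (eta * s) ^ 2) ^ 2 ->
  exists2 w, 0 < w &
    arg (INR m) w = (1 + eta * s) / eta ^ 3 /\ phase (INR m) w <= c.
Proof.
move=> m0 e0 e s0 c0 h; have M0 : 0 < INR m by exact: lt_0_INR.
have es : 0 < eta * s by nra.
pose x := sqrt (eta * s).
have x0 : 0 < x by exact: sqrt_lt_R0.
have xx : x ^ 2 = eta * s by rewrite /x /= Rmult_1_r sqrt_sqrt; lra.
exists (INR m * x); first by nra.
split.
  rewrite /arg Rpow_mult_distr xx.
  apply: (Rmult_eq_reg_r (eta ^ 3)); last by have := pow_lt eta 3 e0; lra.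
  rewrite (_ : (1 + eta * s) / eta ^ 3 * eta ^ 3 = 1 + eta * s); last by field; lra.
  rewrite (_ : _ * eta ^ 3 = INR m ^ 2 * eta ^ 3 * (1 + eta * s) / 4); last by field.
  by rewrite e; field.
apply: (Rle_trans _ _ _ (phase_le_pade _ _ M0 (Rlt_le _ _ x0))).
have -> : x ^ 4 = (eta * s) ^ 2 by rewrite -xx; ring.
rewrite xx; set Q := 105 + _ + _ in h *.
have Q0 : 0 < Q by rewrite /Q; nra.
set Y := INR m * x ^ 3 * (35 + 9 * (eta * s)).
have eY : Y ^ 2 = 4 * s ^ 3 * (35 + 9 * (eta * s)) ^ 2.
  rewrite /Y (_ : (INR m * x ^ 3 * (35 + 9 * (eta * s))) ^ 2
    = INR m ^ 2 * (x ^ 2) ^ 3 * (35 + 9 * (eta * s)) ^ 2); last by ring.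
  by rewrite xx -e; ring.
have : Y <= c * Q.
  have cQ : 0 <= c * Q by nra.
  apply: Rnot_lt_le => lt; move: h; rewrite -eY; nra.
move=> hY; apply: (Rmult_le_reg_r Q) => //.
by rewrite /Rdiv Rmult_assoc Rinv_l; lra.
Qed.

(** The trial function [(L - u) u^2] imitates [J_m], which is small well before the
    turning point [u = a]. As [eta] tends to [0] the problem becomes Airy's, whose
    first zero corresponds to the phase [0.76 pi]; the terms in [eta] of [a] and
    [s] keep the estimate valid up to [eta = 0.2155], that is down to [m = 20]. *)
Lemma first_zero_H_large m : (20 <= m)%nat ->
  exists2 w, 0 < w & H m (arg (INR m) w) = 0 /\ phase (INR m) w <= 8 / 10 * PI.
Proof.
move=> m20; have m0 : (0 < m)%nat by lia.
have [eta e0 e] := scale_exists m m0.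
have e1 := scale_small m eta m20 e0 e.
(* 25132 / 10000 is slightly less than 8 pi / 10 *)
pose a := 2 + 2 * eta; pose s := 24 / 10 + 26 / 10 * eta; pose L := a + s.
pose k := 1 - eta * a.
have [|||w w0 [aw pw]] := phase_trial_le m eta s (25132 / 10000) m0 e0 e.
- by rewrite /s; lra.
- by lra.
- by rewrite /s; nra.
pose f u := (L - u) * u ^ 2; pose df u := 2 * L * u - 3 * u ^ 2.
pose G u := eta * (k + eta * u) * f u ^ 2 / 2
  + k ^ 2 * (4 * L ^ 2 * u ^ 3 / 3 - 3 * L * u ^ 4 + 9 * u ^ 5 / 5)
  + 2 * k * eta * (L ^ 2 * u ^ 4 - 12 * L * u ^ 5 / 5 + 3 * u ^ 6 / 2)
  + eta ^ 2 * (4 * L ^ 2 * u ^ 5 / 5 - 2 * L * u ^ 6 + 9 * u ^ 7 / 7)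
  - (L ^ 2 * u ^ 6 / 6 - 2 * L * u ^ 7 / 7 + u ^ 8 / 8)
  + (a - eta ^ 2 / 4) * (L ^ 2 * u ^ 5 / 5 - L * u ^ 6 / 3 + u ^ 7 / 7).
have L0 : 0 < L by rewrite /L /a /s; lra.
have k0 : 0 <= k by rewrite /k /a; nra.
have [|||||u hu hH] := trial_dirichlet m eta a e0 e f df G L _ _ _ L0.
- by move=> u; rewrite /f /df; auto_derive => //; ring.
- by move=> u; rewrite /G /f /df -/k; auto_derive => //; field.
- by rewrite /f; ring.
- by rewrite /f; ring.
- have -> : G 0 = 0 by rewrite /G /f; field.
  have -> : G L = L ^ 5 * (2 / 15 * k ^ 2 + 1 / 5 * k * eta * L
      + 3 / 35 * eta ^ 2 * L ^ 2 - L ^ 3 / 168 + (a - eta ^ 2 / 4) * L ^ 2 / 105).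
    by rewrite /G /f; field.
  suff : 2 / 15 * k ^ 2 + 1 / 5 * k * eta * L + 3 / 35 * eta ^ 2 * L ^ 2
         - L ^ 3 / 168 + (a - eta ^ 2 / 4) * L ^ 2 / 105 < 0.
    by have := pow_lt L 5 L0; nra.
  rewrite (_ : L = 44 / 10 + 46 / 10 * eta); last by rewrite /L /a /s; field.
  by rewrite /k /a; nra.
have e3 := pow_lt eta 3 e0.
have [||v hv v0] := zero_of_H m ((1 - eta * a + eta * u) / eta ^ 3) w _ hH _ w0.
- by apply: Rdiv_le_0_compat => //; move: k0; rewrite /k; nra.
- rewrite aw; apply: Rmult_le_compat_r.
    by apply: Rlt_le; exact: Rinv_0_lt_compat.
  by move: (proj2 hu); rewrite /L; nra.
exists v; first by lra.
split=> //; have := PI_gt.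
case: (proj2 hv) => [lt|->]; last by lra.
by have := phase_lt (INR m) v w (pos_INR m) (proj1 hv) lt; lra.
Qed.

(** With a free end, the linear trial function is enough: in the Airy limit the
    first zero of the derivative has phase [0.22 pi]. *)
Lemma first_zero_N_large m : (20 <= m)%nat ->
  exists2 w, 0 < w & N m (arg (INR m) w) = 0 /\ phase (INR m) w <= 3 / 10 * PI.
Proof.
move=> m20; have m0 : (0 < m)%nat by lia.
have [eta e0 e] := scale_exists m m0.
have e1 := scale_small m eta m20 e0 e.
(* 94245 / 100000 is slightly less than 3 pi / 10 *)
pose a := 3 / 2; pose L := 11 / 4; pose k := 1 - eta * a.
have [|||w w0 [aw pw]] := phase_trial_le m eta (5 / 4) (94245 / 100000) m0 e0 e.
- by lra.
- by lra.
- by nra.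
pose G u := k ^ 2 * u + k * eta * u ^ 2 + eta ^ 2 * u ^ 3 / 3
  + eta * k * u ^ 2 / 2 + eta ^ 2 * u ^ 3 / 3
  + (eta ^ 2 / 4 + a) * u ^ 3 / 3 - u ^ 4 / 4.
have L0 : 0 < L by rewrite /L; lra.
have k0 : 0 <= k by rewrite /k /a; nra.
have [||||||t ht hN] :=
    trial_neumann m eta a e0 e (fun u => u) (fun=> 1) G L _ _ _ L0.
- by move=> u; auto_derive.
- by move=> u; rewrite /G -/k; auto_derive => //; field.
- by [].
- by [].
- by lra.
- by rewrite /G /L /k /a; nra.
have [|v hv v0] := zero_of_N m t w m0 (proj1 ht) hN _ w0.
- rewrite aw; apply: (Rle_trans _ _ _ (proj2 ht)); right.
  by rewrite /L /a; congr (_ / _); field.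
exists v; first by lra.
split=> //; have := PI_gt.
case: (proj2 hv) => [lt|->]; last by lra.
by have := phase_lt (INR m) v w (pos_INR m) (proj1 hv) lt; lra.
Qed.

(** * First zeros of small order *)

(** For the orders below [20], a point [x = m sqrt (1 + (a/200)^2)] beyond the
    first zero is sampled; there [w / m = a/200]. *)
Definition sample_num (m a : Z) : Z := (m ^ 2 * (a ^ 2 + 200 ^ 2))%Z.
Definition sample_den : Z := (4 * 200 ^ 2)%Z.

Lemma sample_arg m a :
  IZR (sample_num (Z.of_nat m) a) / IZR sample_den
  = arg (INR m) (INR m * (IZR a / 200)).
Proof.
rewrite /sample_num /sample_den /arg !mult_IZR plus_IZR -!(pow_IZR _ 2) -INR_IZR_INZ.
by field.
Qed.

Lemma sample_H m a : (0 < m)%nat -> (0 < a)%Z ->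
  negative_at 1 0 (Z.of_nat m) (sample_num (Z.of_nat m) a) sample_den 60 ->
  forall c, phase (INR m) (INR m * (IZR a / 200)) <= c ->
  exists2 w, 0 < w & H m (arg (INR m) w) = 0 /\ phase (INR m) w <= c.
Proof.
move=> m0 a0 /andP[big /Z.ltb_lt neg] c hc; have M0 : 0 < INR m by exact: lt_0_INR.
have a0' : 0 < IZR a by exact: (IZR_lt 0).
have [||||_ /(_ neg)] := sign_bounds 1 0 (sample_num (Z.of_nat m) a)
   sample_den m 60 _ _ _ _ big; [lia | lia | rewrite /sample_num; nia | by [] |].
rewrite sample_arg => hneg.
have w0 : 0 < INR m * (IZR a / 200) by nra.
have [||w hw hH] := zero_of_H m (arg (INR m) (INR m * (IZR a / 200))) _ _ _
  (Rle_refl _) w0; [rewrite /arg; nra | lra |].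
exists w; first by lra.
split=> //; apply: Rle_trans hc.
case: (proj2 hw) => [lt|->]; last by lra.
by apply: Rlt_le; apply: phase_lt => //; lra.
Qed.

Lemma sample_N m a : (0 < m)%nat -> (0 < a)%Z ->
  negative_at (Z.of_nat m) 2 (Z.of_nat m) (sample_num (Z.of_nat m) a)
    sample_den 60 ->
  forall c, phase (INR m) (INR m * (IZR a / 200)) <= c ->
  exists2 w, 0 < w & N m (arg (INR m) w) = 0 /\ phase (INR m) w <= c.
Proof.
move=> m0 a0 /andP[big /Z.ltb_lt neg] c hc; have M0 : 0 < INR m by exact: lt_0_INR.
have a0' : 0 < IZR a by exact: (IZR_lt 0).
have [||||_ /(_ neg)] := sign_bounds (Z.of_nat m) 2 (sample_num (Z.of_nat m) a)
   sample_den m 60 _ _ _ _ big; [lia | lia | rewrite /sample_num; nia | by [] |].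
rewrite sample_arg -INR_IZR_INZ => hneg.
have w0 : 0 < INR m * (IZR a / 200) by nra.
have [||w hw hH] := zero_of_N m (arg (INR m) (INR m * (IZR a / 200))) _ m0 _ _
  (Rle_refl _) w0; [rewrite /arg; nra | rewrite /N; lra |].
exists w; first by lra.
split=> //; apply: Rle_trans hc.
case: (proj2 hw) => [lt|->]; last by lra.
by apply: Rlt_le; apply: phase_lt => //; lra.
Qed.

(** [phase_le_pade] at [w / m = a/200], with denominators cleared. *)
Definition phase_le_at (m a num den : Z) : bool :=
  (den * (m * a ^ 3 * (35 * 200 ^ 2 + 9 * a ^ 2))
   <=? num * (200 * (105 * 200 ^ 4 + 90 * a ^ 2 * 200 ^ 2 + 9 * a ^ 4)))%Z.

Lemma phase_le_atP m a num den : (0 < m)%nat -> (0 < a)%Z -> (0 < den)%Z ->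
  phase_le_at (Z.of_nat m) a num den ->
  phase (INR m) (INR m * (IZR a / 200)) <= IZR num / IZR den.
Proof.
move=> m0 a0 d0 /Z.leb_le /IZR_le.
have M0 : 0 < INR m by exact: lt_0_INR.
have a0' : 0 < IZR a by exact: (IZR_lt 0).
have d0' : 0 < IZR den by exact: (IZR_lt 0).
have p2 z : IZR (z ^ 2) = IZR z ^ 2 by rewrite (pow_IZR z 2).
have p3 z : IZR (z ^ 3) = IZR z ^ 3 by rewrite (pow_IZR z 3).
have p4 z : IZR (z ^ 4) = IZR z ^ 4 by rewrite (pow_IZR z 4).
rewrite (mult_IZR den) (mult_IZR (_ * _)) (mult_IZR (Z.of_nat m)).
rewrite (plus_IZR (35 * _)) (mult_IZR 35) (mult_IZR 9) (mult_IZR num).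
rewrite (mult_IZR 200) (plus_IZR (_ + _)) (plus_IZR (105 * _)) (mult_IZR 105).
rewrite (mult_IZR (90 * _)) (mult_IZR 90) (mult_IZR 9) !p2 p3 !p4.
rewrite -INR_IZR_INZ => h.
apply: (Rle_trans _ _ _ (phase_le_pade _ _ M0 _)); first by lra.
have Q : 0 < 105 * 200 ^ 4 + 90 * IZR a ^ 2 * 200 ^ 2 + 9 * IZR a ^ 4 by nra.
have -> : INR m * (IZR a / 200) ^ 3 * (35 + 9 * (IZR a / 200) ^ 2) /
    (105 + 90 * (IZR a / 200) ^ 2 + 9 * (IZR a / 200) ^ 4)
  = INR m * IZR a ^ 3 * (35 * 200 ^ 2 + 9 * IZR a ^ 2)
    / (200 * (105 * 200 ^ 4 + 90 * IZR a ^ 2 * 200 ^ 2 + 9 * IZR a ^ 4)).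
  by field; nra.
set D := 200 * _ in h *; have D0 : 0 < D by rewrite /D; lra.
apply: (Rmult_le_reg_r (D * IZR den)); first by nra.
set X := _ * _ * _ in h *.
rewrite (_ : X / D * (D * IZR den) = IZR den * X); last by field; lra.
rewrite (_ : IZR num / IZR den * _ = IZR num * D); last by field; lra.
by move: h; rewrite /X /D /=.
Qed.

(** The entry of index [m >= 1] is a sample just beyond the first zero of [J_m];
    the entry of index [0] is a filler. *)
Definition samples_H : list Z :=
  (0 :: 750 :: 480 :: 378 :: 324 :: 290 :: 266 :: 248 :: 233 :: 221 :: 211
   :: 202 :: 195 :: 189 :: 183 :: 178 :: 173 :: 169 :: 165 :: 162 :: nil)%Z.

(** The analogue for [J_m']. *)
Definition samples_N : list Z :=
  (0 :: 396 :: 278 :: 229 :: 201 :: 182 :: 169 :: 158 :: 150 :: 142 :: 136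
   :: 131 :: 127 :: 123 :: 119 :: 116 :: 113 :: 110 :: 108 :: 106 :: nil)%Z.

Lemma samples_H_negative :
  List.forallb (fun m => let a := List.nth m samples_H 0%Z in
    (0 <? a)%Z && negative_at 1 0 (Z.of_nat m) (sample_num (Z.of_nat m) a)
                    sample_den 60) (List.seq 1 19).
Proof. by vm_compute. Qed.

Lemma samples_H_phase :
  List.forallb (fun m => phase_le_at (Z.of_nat m) (List.nth m samples_H 0%Z)
                           25132 10000) (List.seq 4 16).
Proof. by vm_compute. Qed.

Lemma samples_N_ok :
  List.forallb (fun m => let a := List.nth m samples_N 0%Z in
    [&& (0 <? a)%Z, negative_at (Z.of_nat m) 2 (Z.of_nat m)
       (sample_num (Z.of_nat m) a) sample_den 60
     & phase_le_at (Z.of_nat m) a 94245 100000]) (List.seq 1 19).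
Proof. by vm_compute. Qed.

(** The exact phases of the first zeros lie between [0.75 pi] and [0.77 pi]. The
    Pade bound of the phase is too weak for the orders [1], [2], [3], where the
    sampled ratio [w / m] is large; there the expansion of [atan] at infinity
    serves. *)
Lemma first_zero_H m :
  exists2 w, 0 < w & H m (arg (INR m) w) = 0 /\ phase (INR m) w <= 8 / 10 * PI.
Proof.
have pi1 := PI_gt.
case: (Nat.le_gt_cases 20 m) => [/first_zero_H_large //|m20].
case: (Nat.eq_dec m 0) => [->|m0].
  (* J_0 changes sign before x = sqrt 6 *)
  have [||||_ neg] := sign_bounds 1 0 3 2 0 10 _ _ _ _ erefl; try lia.
  have {}neg : H 0 (3 / 2) < 0 by move: (neg erefl); rewrite /=; lra.
  have w0 : 0 < 5 / 2 - 1 / 20 by lra.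
  have [|||w hw hH] := zero_of_H 0 (3 / 2) (5 / 2 - 1 / 20) _ _ _ w0.
  - by lra.
  - by lra.
  - by rewrite /arg /=; lra.
  exists w; first by lra.
  by split=> //; rewrite /phase /=; lra.
have m1 : (0 < m)%nat by lia.
have M1 : 0 < INR m by exact: lt_0_INR.
have /andP[/Z.ltb_lt a0 neg] := proj1 (List.forallb_forall _ _)
  samples_H_negative m (proj2 (List.in_seq 19 1 m) ltac:(lia)).
apply: (sample_H m _ m1 a0 neg).
case: (Nat.le_gt_cases 4 m) => m4.
  have /phase_le_atP := proj1 (List.forallb_forall _ _) samples_H_phase m
    (proj2 (List.in_seq 16 4 m) ltac:(lia)).
  by move=> /(_ m1 a0 erefl); lra.
have : 0 < IZR (List.nth m samples_H 0%Z) / 200.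
  by have := IZR_lt _ _ a0; lra.
move=> /(phase_le_taylor (INR m) _ M1) h; apply: (Rle_trans _ _ _ h).
move: {h a0 neg M1 m1 m20} m m0 m4 => [|[|[|[|m]]]] m0 m4; try lia;
  rewrite /=; lra.
Qed.

Lemma first_zero_N m : (0 < m)%nat ->
  exists2 w, 0 < w & N m (arg (INR m) w) = 0 /\ phase (INR m) w <= 3 / 10 * PI.
Proof.
move=> m1; have pi1 := PI_gt.
case: (Nat.le_gt_cases 20 m) => [/first_zero_N_large //|m20].
have /and3P[/Z.ltb_lt a0 neg h3] := proj1 (List.forallb_forall _ _)
  samples_N_ok m (proj2 (List.in_seq 19 1 m) ltac:(lia)).
have h := phase_le_atP m _ 94245 100000 m1 a0 erefl h3.
by apply: (sample_N m _ m1 a0 neg); lra.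
Qed.

(** * Zeros counted by the phase *)

(** The zeros are listed in increasing order, rather than counted, since each of
    them will be turned into an eigenvalue. *)
Definition zeros_below (m : nat) (B : R) (k : nat) : Prop :=
  exists z : nat -> R,
    (forall i, (i < k)%nat -> 0 <= z i < B /\ N m (z i) = 0) /\
    (forall i j, (i < j)%nat -> (j < k)%nat -> z i < z j).

Lemma zeros_belowS m B B' k t : zeros_below m B k ->
  0 <= t -> B <= t < B' -> N m t = 0 -> zeros_below m B' (S k).
Proof.
move=> [z [hz inc]] t0 ht Nt.
exists (fun i => if Nat.ltb i k then z i else t); split.
  move=> i hi; case: (Nat.ltb_spec i k) => [/hz|_]; last by lra.
  by move=> [? ?]; split => //; lra.
move=> i j ij jk; case: (Nat.ltb_spec i k) => ik; last by lia.
case: (Nat.ltb_spec j k) => jk'; first exact: inc.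
by have := hz i ik; lra.
Qed.

(** Before its first zero [J_m] must have stopped increasing; for [m = 0] this
    already happens at the origin. *)
Lemma zero_N_before_zero_H m T : 0 < T -> H m T = 0 -> zeros_below m T 1.
Proof.
move=> T0 hT; suff [t ht Nt] : exists2 t, 0 <= t < T & N m t = 0.
  by exists (fun=> t); split=> [i _|i j ? ?]; [split | lia].
case: (Nat.eq_dec m 0) => [->|m0].
  by exists 0; [lra | rewrite /N /=; ring].
have hN0 : 0 < N m 0.
  rewrite N_at0; apply: Rmult_lt_0_compat; last exact: H_at0_gt0.
  by apply: lt_0_INR; lia.
have [t [ht Nt]] : exists t, 0 <= t < T /\ N m t <= 0.
  apply: Classical_Prop.NNPP => no.
  suff : 0 < H m T by lra.
  apply: (N_gt0_H_gt0 m T); last by lra.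
  by move=> t ht; apply: Rnot_le_lt => h; apply: no; exists t.
case: Nt => [Nt|Nt]; last by exists t.
have t0 : 0 < t by case: (proj1 ht) => // e; rewrite -e in Nt; lra.
have [|z hz Nz] := zero_between (N m) 0 t t0 (fun x _ => N_continuity m x).
  by nra.
by exists z => //; lra.
Qed.

Lemma arg_lt M a b : 0 < a -> a < b -> arg M a < arg M b.
Proof. by move=> a0 ab; rewrite /arg; nra. Qed.

(** Starting from a first zero of [J_m], each step finds a further one within the
    phase [pi]; there is a zero of [J_m'] before the first of these zeros and one
    between any two successive ones. *)
Lemma zeros_chain m W k : 0 < W -> (8 / 10 + INR k) * PI <= phase (INR m) W ->
  exists2 w, 0 < w <= W & [/\ H m (arg (INR m) w) = 0,
    phase (INR m) w <= (8 / 10 + INR k) * PI &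
    zeros_below m (arg (INR m) w) (S k)].
Proof.
move=> W0; have pi0 := PI_RGT_0; have M0 := pos_INR m.
have le_of_phase v : 0 < v -> phase (INR m) v <= phase (INR m) W -> v <= W.
  by move=> v0 h; apply: Rnot_lt_le => /(phase_lt _ _ _ M0 W0); lra.
elim: k => [|k IH] hk.
  have [w w0 [hH hp]] := first_zero_H m.
  rewrite /= Rplus_0_r in hk *.
  exists w; first by split=> //; apply: le_of_phase => //; lra.
  split=> //; apply: zero_N_before_zero_H => //.
  by rewrite /arg; nra.
rewrite S_INR in hk *.
have [|w [w0 wW] [hH hp hz]] := IH; first by nra.
have ltwW : w < W.
  by case: wW => // e; rewrite e in hp; nra.
have yw : y m w = 0 by apply/y_eq0.
have [|w' hw' [hp' /y_eq0 hH']] :=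
  next_zero_y (INR m) (y m) (q m) M0 (y_derive m) (q_derive m) w W w0 yw _ ltwW.
  by nra.
exists w'; first by lra.
split=> //; first by nra.
have yw' : y m w' = 0 by apply/y_eq0.
have [v hv /q_eq0 Nv] := zero_q_between (INR m) (y m) (q m) (y_derive m)
  w w' w0 (proj1 hw') yw yw'.
apply: (zeros_belowS _ _ _ _ (arg (INR m) v) hz) => //.
  by rewrite /arg; nra.
by split; [apply: Rlt_le|]; apply: arg_lt; lra.
Qed.

Definition zeros_upto (m : nat) (B : R) (k : nat) : Prop :=
  exists z : nat -> R,
    (forall i, (i < k)%nat -> 0 <= z i <= B /\ N m (z i) = 0) /\
    (forall i j, (i < j)%nat -> (j < k)%nat -> z i < z j).

Lemma zeros_upto_below m B B' k : zeros_below m B k -> B <= B' ->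
  zeros_upto m B' k.
Proof.
move=> [z [hz inc]] BB; exists z; split=> // i /hz[? ?]; split=> //; lra.
Qed.

Lemma zeros_uptoS m B B' k t : zeros_below m B k ->
  0 <= t -> B <= t <= B' -> N m t = 0 -> zeros_upto m B' (S k).
Proof.
move=> [z [hz inc]] t0 ht Nt.
exists (fun i => if Nat.ltb i k then z i else t); split.
  move=> i hi; case: (Nat.ltb_spec i k) => [/hz|_]; last by lra.
  by move=> [? ?]; split => //; lra.
move=> i j ij jk; case: (Nat.ltb_spec i k) => ik; last by lia.
case: (Nat.ltb_spec j k) => jk'; first exact: inc.
by have := hz i ik; lra.
Qed.

(** Both bounds for first zeros lead to the same constant: [3/10 = 1 - 7/10] for
    the first zero of [J_m'], and [8/10 + k + 1/2 = (k + 2) - 7/10] for the zero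
    that follows within a quarter period the zero of [J_m] given by [zeros_chain]. *)
Lemma zeros_of_phase m w n : 0 < w ->
  (INR n - 7 / 10) * PI <= phase (INR m) w ->
  zeros_upto m (arg (INR m) w) n.
Proof.
move=> w0; have pi0 := PI_RGT_0; have M0 := pos_INR m.
have arg0 v : 0 <= arg (INR m) v by rewrite /arg; nra.
case: n => [|[|k]] hn.
- by exists (fun=> 0); split=> [i ?|i j ? ?]; lia.
- suff [t ht Nt] : exists2 t, 0 <= t <= arg (INR m) w & N m t = 0.
    by exists (fun=> t); split=> [i _|i j ? ?]; [split | lia].
  case: (Nat.eq_dec m 0) => [->|m0].
    by exists 0; [have := arg0 w; move: (INR 0) => ?; rewrite /arg; nra
                | rewrite /N /=; ring].
  have [|v v0 [Nv pv]] := first_zero_N m; first by lia.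
  exists (arg (INR m) v) => //; split => //.
  case: (Rle_dec v w) => vw; first by rewrite /arg; nra.
  have /(phase_lt _ _ _ M0 w0) : w < v by lra.
  by rewrite /= in hn; nra.
- rewrite !S_INR in hn.
  have [|v [v0 vw] [hH hp hz]] := zeros_chain m w k w0; first by nra.
  have ltvw : v < w by case: vw => // e; rewrite e in hp; nra.
  have yv : y m v = 0 by apply/y_eq0.
  have [|t ht /q_eq0 Nt] := next_zero_q (INR m) (y m) (q m) M0 (y_derive m)
    (q_derive m) v w v0 yv _ ltvw; first by nra.
  apply: (zeros_uptoS _ _ _ _ (arg (INR m) t) hz) => //.
  split; first by apply: Rlt_le; apply: arg_lt; lra.
  by rewrite /arg; nra.
Qed.

(** * A table of zeros for moderate frequencies *)

(** The dimension of the space of homogeneous harmonic polynomials of degree [m]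
    in two variables. *)
Definition angular_mult (m : nat) : nat := if m is O then 1%nat else 2%nat.

Fixpoint weighted_sum (c : nat -> nat) (n : nat) : nat :=
  if n is S m then (weighted_sum c m + angular_mult m * c m)%nat else 0%nat.

Lemma sign_N m T n : (0 <= T)%Z -> large_order (Z.of_nat m) T 1 n ->
  ((0 < (scaled_sum (Z.of_nat m) 2 (Z.of_nat m) T 1 (S n)).1)%Z
     -> 0 < N m (IZR T)) /\
  (((scaled_sum (Z.of_nat m) 2 (Z.of_nat m) T 1 n).1 < 0)%Z
     -> N m (IZR T) < 0).
Proof.
move=> T0 big.
have [] := sign_bounds (Z.of_nat m) 2 T 1 m n ltac:(lia) ltac:(lia) T0 erefl big.
rewrite -INR_IZR_INZ /N Rdiv_1_r.
by move=> h1 h2; split=> [/h1|/h2]; lra.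
Qed.

(** An even order at which the terms of the series decrease for all [T <= 400],
    and large enough to decide all the signs of the table. *)
Definition order400 : nat := 80.

(** [N m] takes alternating signs at the successive points of [L]; [s] tells
    whether the first of these signs is to be negative. *)
Fixpoint alternates (m : Z) (T : Z) (s : bool) (L : list Z) : bool :=
  if L is a :: L' then
    [&& (T <? a)%Z,
        if s then negative_at m 2 m a 1 order400 else positive_at m 2 m a 1 order400
      & alternates m a (~~ s) L']
  else true.

Fixpoint count_le (i : Z) (L : list Z) : nat :=
  if L is a :: L' then if (a <=? i)%Z then S (count_le i L') else 0%nat
  else 0%nat.

Lemma zeros_of_alternates m L : forall T s k i, (0 <= T <= i)%Z ->
  zeros_below m (IZR T) k -> (if s then 0 < N m (IZR T) else N m (IZR T) < 0) ->
  alternates (Z.of_nat m) T s L ->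
  zeros_below m (IZR i) (k + count_le i L)%nat.
Proof.
elim: L => [|a L IH] T s k i hT hz sT.
  move=> _; rewrite /= Nat.add_0_r; case: hz => z [h inc].
  exists z; split => // j hj; have [[? ?] ?] := h j hj.
  by have := IZR_le _ _ (proj2 hT); lra.
rewrite [count_le _ _]/= => /and3P[/Z.ltb_lt Ta sa alt].
case: Z.leb_spec => ai; last first.
  rewrite Nat.add_0_r; case: hz => z [h inc].
  exists z; split => // j hj; have [[? ?] ?] := h j hj.
  by have := IZR_le _ _ (proj2 hT); lra.
rewrite Nat.add_succ_r -Nat.add_succ_l.
have Ta' := IZR_lt _ _ Ta.
have T0' := IZR_le _ _ (proj1 hT).
have sa' : if ~~ s then 0 < N m (IZR a) else N m (IZR a) < 0.
  move: sa; case: (s) => /andP[big /Z.ltb_lt h].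
    by apply: (proj2 (sign_N m a order400 ltac:(lia) big)).
  by apply: (proj1 (sign_N m a order400 ltac:(lia) big)).
have [|z zT Nz] := zero_between (N m) (IZR T) (IZR a) Ta'
                     (fun x _ => N_continuity m x).
  by move: sT sa'; case: (s) => /= ? ?; nra.
apply: (IH a (~~ s)) => //; first by lia.
by apply: (zeros_belowS _ _ _ _ z hz) => //; lra.
Qed.

Local Open Scope list_scope.

(** The row [m] lists the integers following the successive zeros of [N m] up
    to [400]; the row [0], where [N] vanishes at the origin, begins with [1]. *)
Definition zero_table : list (list Z) :=
  ([[1; 4; 13; 26; 45; 68; 97; 130; 168; 211; 260; 313; 371];
   [1; 8; 19; 35; 56; 82; 112; 148; 189; 235; 285; 341];
   [3; 12; 25; 44; 67; 96; 129; 167; 210; 259; 312; 370];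
   [5; 17; 33; 54; 80; 110; 146; 187; 233; 283; 339; 399];
   [8; 22; 41; 64; 93; 126; 164; 207; 256; 309; 367];
   [11; 28; 49; 75; 106; 142; 183; 229; 279; 335; 395];
   [15; 35; 59; 87; 121; 159; 202; 250; 303; 361];
   [19; 42; 69; 100; 136; 177; 222; 273; 329; 389];
   [24; 50; 79; 113; 152; 195; 243; 296; 354];
   [29; 59; 91; 127; 168; 214; 265; 320; 381];
   [35; 68; 103; 142; 185; 234; 287; 345];
   [42; 78; 115; 157; 203; 254; 310; 370];
   [49; 88; 129; 173; 221; 275; 333; 396];
   [56; 99; 142; 189; 241; 297; 357];
   [64; 111; 157; 206; 260; 319; 382];
   [73; 123; 172; 224; 281; 342];
   [82; 136; 187; 242; 302; 366];
   [92; 149; 204; 261; 323; 390];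
   [102; 163; 221; 281; 346];
   [113; 177; 238; 301; 369];
   [124; 192; 256; 322; 392];
   [136; 208; 275; 344];
   [148; 224; 294; 366];
   [161; 241; 314; 388];
   [174; 258; 334];
   [188; 276; 355];
   [202; 295; 377];
   [217; 313; 399];
   [233; 333];
   [249; 353];
   [265; 374];
   [282; 395];
   [300];
   [318];
   [336];
   [355];
   [375];
   [395]])%Z.

Lemma zero_table_alternates :
  List.forallb (fun m => alternates (Z.of_nat m) 0 true
                           (List.nth m zero_table nil))
    (List.seq 0 (length zero_table)).
Proof. by vm_cast_no_check (erefl true). Qed.

Definition table_count (i : Z) (m : nat) : nat :=
  count_le i (List.nth m zero_table nil).

Lemma table_count_large :
  List.forallb (fun n => let i := (36 + Z.of_nat n)%Z in
     (i + 2 <=? Z.of_nat (weighted_sum (table_count i) (length zero_table)))%Z)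
    (List.seq 0 365).
Proof. by vm_cast_no_check (erefl true). Qed.

Local Opaque scaled_sum.

Lemma table_zeros i m : (1 <= i)%Z -> (m < length zero_table)%nat ->
  zeros_below m (IZR i) (table_count i m).
Proof.
move=> i1 hm.
have := proj1 (List.forallb_forall _ _) zero_table_alternates m
  (proj2 (List.in_seq (length zero_table) 0 m) ltac:(lia)).
rewrite /table_count; case: (Nat.eq_dec m 0) => [->|m0 alt]; last first.
  apply: (zeros_of_alternates m _ 0 true 0) => //; first by lia.
    by exists (fun=> 0); split=> [j ?|j l ? ?]; lia.
  rewrite N_at0; apply: Rmult_lt_0_compat; last exact: H_at0_gt0.
  by apply: lt_0_INR; lia.
have -> : List.nth 0 zero_table nil
  = (1%Z :: List.tl (List.nth 0 zero_table nil)) by [].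
move: (List.tl _) => L.
case/and3P => _ s1 alt.
rewrite [count_le _ _]/= (_ : (1 <=? i)%Z); last by apply/Z.leb_le.
refine (zeros_of_alternates 0 L 1 false 1 i _ _ _ alt); first by lia.
  exists (fun=> 0); split=> [j _|j l ? ?]; last by lia.
  by rewrite N_at0 /=; lra.
move: s1 => /andP[big /Z.ltb_lt h].
by apply: (proj2 (sign_N 0 1 order400 ltac:(lia) big)).
Qed.

(** * Lattice points under the phase *)

(** With [m = mu cos a], the phase of order [m] at [mu] is [mu * leg a]; the
    region under the graph of the phase as a function of [m], between the
    levels [mu * leg a] and [mu * leg b], has area
    [mu^2 * (sector b - sector a)]. *)
Definition leg (a : R) : R := sin a - a * cos a.
Definition sector (a : R) : R := (sin (2 * a) - 2 * a * cos (2 * a)) / 8.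

Lemma leg_derive a : is_derive leg a (a * sin a).
Proof. by rewrite /leg; auto_derive => //; ring. Qed.

Lemma sector_derive a : is_derive sector a (a * sin a * cos a).
Proof.
rewrite /sector; auto_derive => //.
by rewrite sin_2a; field.
Qed.

Lemma leg_le a b : 0 <= a -> a <= b -> b <= PI -> leg a <= leg b.
Proof.
move=> a0 ab bpi; apply: (derive_ge0_le leg (fun t => t * sin t)) => //.
  by move=> x _; exact: leg_derive.
by move=> x hx; apply: Rmult_le_pos; [lra | apply: sin_ge_0; lra].
Qed.

(** The width of the region is a convex function of the level, hence the
    trapezoidal rule overestimates the area. *)
Lemma sector_trapezoid a b : 0 <= a -> a <= b -> b <= PI / 2 ->
  sector b - sector a <= (leg b - leg a) * (cos a + cos b) / 2.
Proof.
move=> a0 ab bpi; have pi0 := PI_RGT_0.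
have inner t : a <= t -> t <= PI / 2 -> 0 <= t * (cos a - cos t) - (leg t - leg a).
  move=> at_ tpi.
  pose h t := t * (cos a - cos t) - (leg t - leg a).
  have : h a <= h t.
    apply: (derive_ge0_le h (fun t => cos a - cos t)) => //.
      move=> x _; have d := leg_derive x; rewrite /h; auto_derive.
        by exists (x * sin x).
      by rewrite (is_derive_unique _ _ _ d); ring.
    by move=> x hx; have := cos_decr_1 a x; lra.
  by rewrite /h; lra.
pose F t := (leg t - leg a) * (cos a + cos t) / 2 - (sector t - sector a).
have : F a <= F b.
  apply: (derive_ge0_le F (fun t =>
    sin t / 2 * (t * (cos a - cos t) - (leg t - leg a)))) => //.
    move=> x _; have d1 := leg_derive x; have d2 := sector_derive x.
    rewrite /F; auto_derive.
      by repeat split; [exists (x * sin x) | exists (x * sin x * cos x)].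
    by rewrite (is_derive_unique _ _ _ d1) (is_derive_unique _ _ _ d2); field.
  move=> x hx; apply: Rmult_le_pos; last by apply: inner; lra.
  by have := sin_ge_0 x; lra.
by rewrite /F; lra.
Qed.

Lemma leg_exists v : 0 < v <= 1 -> exists2 a, 0 < a <= PI / 2 & leg a = v.
Proof.
move=> hv; have pi0 := PI_RGT_0.
have l0 : leg 0 = 0 by rewrite /leg sin_0; ring.
have l1 : leg (PI / 2) = 1 by rewrite /leg sin_PI2 cos_PI2; ring.
case: (proj2 hv) => [v1|->]; last by exists (PI / 2) => //; lra.
have [|||z hz e] := zero_between (fun a => leg a - v) 0 (PI / 2).
- by lra.
- move=> x _; apply: continuity_pt_minus; last exact: continuity_pt_const.
  exact: derive_continuity_pt (leg_derive x).
- by rewrite l0 l1; nra.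
by exists z; lra.
Qed.

(** The order [m] is [mu cos b] for some angle [b >= a], where the phase is
    [mu * leg b >= mu * leg a]. *)
Lemma zeros_of_angle m mu a n : 0 < mu -> 0 < a <= PI / 2 ->
  INR m <= mu * cos a -> (INR n - 7 / 10) * PI <= mu * leg a ->
  zeros_upto m (mu ^ 2 / 4) n.
Proof.
move=> mu0 ha hm hn; have pi0 := PI_RGT_0; have M0 := pos_INR m.
have ca : 0 <= cos a by apply: cos_ge_0; lra.
have ca1 : cos a < 1.
  by rewrite -cos_0; apply: cos_decreasing_1; lra.
have Mmu : INR m < mu by nra.
have mu2 : 0 < mu ^ 2 - INR m ^ 2 by nra.
pose w := sqrt (mu ^ 2 - INR m ^ 2).
have w0 : 0 < w by exact: sqrt_lt_R0.
have ww : w * w = mu ^ 2 - INR m ^ 2 by apply: sqrt_sqrt; lra.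
rewrite (_ : mu ^ 2 / 4 = arg (INR m) w); last first.
  by rewrite /arg (_ : w ^ 2 = mu ^ 2 - INR m ^ 2); [field | rewrite -ww; ring].
apply: zeros_of_phase => //; apply: (Rle_trans _ _ _ hn).
case: (Nat.eq_dec m 0) => [e|m0].
  rewrite /phase e /= Rmult_0_l Rminus_0_r.
  have -> : w = mu.
    by rewrite e /= in ww; have := mu0; nra.
  have := leg_le a (PI / 2); rewrite {2}/leg sin_PI2 cos_PI2 => h.
  have : leg a <= 1 by lra.
  by nra.
have M1 : 0 < INR m by apply: lt_0_INR; lia.
pose b := atan (w / INR m).
have [b1 b2] : - PI / 2 < b < PI / 2 := atan_bound (w / INR m).
have b0 : 0 < b by rewrite -atan_0; apply: atan_increasing; exact: Rdiv_lt_0_compat.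
have cb : 0 < cos b by apply: cos_gt_0; lra.
have tb : sin b * INR m = w * cos b.
  have := tan_atan (w / INR m); rewrite -/b /tan => h.
  have -> : sin b = w / INR m * cos b by rewrite -h; field; lra.
  by field; lra.
have sb : 0 < sin b by apply: sin_gt_0; lra.
have := sin2_cos2 b; rewrite /Rsqr => sc.
have e1 : INR m = mu * cos b.
  have : INR m ^ 2 = (mu * cos b) ^ 2.
    have : (sin b * INR m) * (sin b * INR m) = (w * w) * (cos b * cos b).
      by rewrite tb; ring.
    rewrite ww => h; nra.
  have mc : 0 < mu * cos b by nra.
  by move=> h; apply: Rsqr_inj; rewrite ?Rsqr_pow2; lra.
have e2 : w = mu * sin b.
  have : w * cos b = mu * sin b * cos b by rewrite -tb {1}e1; ring.
  by move=> h; apply: (Rmult_eq_reg_r (cos b)) => //; lra.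
have ab : a <= b.
  apply: Rnot_lt_le => ba.
  have : cos a < cos b by apply: cos_decreasing_1; lra.
  by nra.
have := leg_le a b ltac:(lra) ab ltac:(lra).
rewrite /phase -/b {1}e2 {1}e1 /leg; nra.
Qed.

Section LevelCounting.

Variables (mu : R) (alpha : nat -> R).
Hypothesis mu0 : 0 < mu.

(** The largest level [n <= K] at which [m] is admissible. *)
Fixpoint levels (K m : nat) : nat :=
  if K is S K' then
    if Rle_dec (INR m) (mu * cos (alpha K)) then K else levels K' m
  else 0%nat.

Lemma levels_le K m : (levels K m <= K)%nat.
Proof. by elim: K => //= K IH; case: Rle_dec => ? /=; lia. Qed.

Lemma levelsP K m : levels K m = 0%nat \/
  [/\ (1 <= levels K m)%nat, (levels K m <= K)%nat &
      INR m <= mu * cos (alpha (levels K m))].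
Proof.
elim: K => [|K IH]; first by left.
rewrite /=; case: Rle_dec => h /=; first by right; split; [lia | lia |].
by case: IH => [->|[h1 h2 h3]]; [left | right; split=> //; exact: le_S].
Qed.

Definition row (z : R) (m : nat) : nat := if Rle_dec (INR m) z then 1%nat else 0%nat.

(** The integers in [[-z, z]] number at least [2 z - 1]. *)
Lemma row_sum z M : 0 <= z -> z <= INR M ->
  2 * z - 1 <= INR (weighted_sum (row z) M).
Proof.
move=> z0; have full n : (forall m, (m < n)%nat -> INR m <= z) ->
    2 * INR n - 1 <= INR (weighted_sum (row z) n).
  elim: n => [|n IH] h; first by rewrite /=; lra.
  rewrite [weighted_sum _ _]/= plus_INR mult_INR.
  have -> : row z n = 1%nat.
    by rewrite /row; case: Rle_dec => // hn; case: hn; apply: h; lia.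
  have := IH (fun m hm => h m ltac:(lia)).
  rewrite S_INR Rmult_1_r.
  have : 2 <= INR (angular_mult n) \/ n = 0%nat.
    by case: (n) => [|k]; [right | left; rewrite /=; lra].
  by case=> [|->]; rewrite /=; lra.
elim: M => [|M IH] hz; first by move: hz; rewrite /=; lra.
case: (Rle_dec z (INR M)) => zM.
  rewrite [weighted_sum _ _]/= plus_INR; have := IH zM.
  by have := pos_INR (angular_mult M * row z M)%nat; lra.
apply: (Rle_trans _ (2 * INR (S M) - 1)); first by lra.
apply: full => m hm; have : INR m <= INR M by apply: le_INR; lia.
by lra.
Qed.

Lemma weighted_sum_le c c' M : (forall m, (c m <= c' m)%nat) ->
  (weighted_sum c M <= weighted_sum c' M)%nat.
Proof.
move=> h; elim: M => //= M IH; have := h M; nia.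
Qed.

Lemma weighted_sumD c c' M : weighted_sum (fun m => (c m + c' m)%nat) M
  = (weighted_sum c M + weighted_sum c' M)%nat.
Proof. by elim: M => //= M ->; lia. Qed.

Lemma levels_sum K M : mu <= INR M ->
  (forall n, (1 <= n)%nat -> (n <= K)%nat -> 0 < alpha n <= PI / 2) ->
  sum_f_R0 (fun n => if n is O then 0 else 2 * (mu * cos (alpha n)) - 1) K
  <= INR (weighted_sum (levels K) M).
Proof.
move=> muM; have pi0 := PI_RGT_0; elim: K => [|K IH] h.
  by rewrite [sum_f_R0 _ _]/=; exact: pos_INR.
have [h1 h2] := h (S K) ltac:(lia) ltac:(lia).
have c0 : 0 <= cos (alpha (S K)) by apply: cos_ge_0; lra.
have c1 : cos (alpha (S K)) <= 1 by have := COS_bound (alpha (S K)); lra.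
have IH' := IH (fun n h1 h2 => h n h1 ltac:(lia)).
rewrite [sum_f_R0 _ _]/=.
have := row_sum (mu * cos (alpha (S K))) M ltac:(nra) ltac:(nra).
have /le_INR : (weighted_sum (levels K) M
     + weighted_sum (row (mu * cos (alpha (S K)))) M
     <= weighted_sum (levels (S K)) M)%nat.
  rewrite -weighted_sumD; apply: weighted_sum_le => m.
  rewrite /row /=; have := levels_le K m.
  by case: Rle_dec => ? /=; lia.
by rewrite plus_INR; lra.
Qed.

End LevelCounting.

(** * The weighted count of the zeros *)

Lemma sin_le x : 0 <= x -> sin x <= x.
Proof. by case=> [/sin_lt_x|<-]; rewrite ?sin_0; lra. Qed.

Lemma cos_ge_taylor x : 0 <= x -> 1 - x ^ 2 / 2 <= cos x.
Proof.
move=> x0; pose f t := cos t - (1 - t ^ 2 / 2).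
have : f 0 <= f x.
  apply: (derive_ge0_le f (fun t => t - sin t)) => // t ht.
    by rewrite /f; auto_derive => //; field.
  by have := sin_le t; lra.
by rewrite /f cos_0; lra.
Qed.

Lemma sin_ge_taylor x : 0 <= x -> x - x ^ 3 / 6 <= sin x.
Proof.
move=> x0; pose f t := sin t - (t - t ^ 3 / 6).
have : f 0 <= f x.
  apply: (derive_ge0_le f (fun t => cos t - (1 - t ^ 2 / 2))) => // t ht.
    by rewrite /f; auto_derive => //; field.
  by have := cos_ge_taylor t; lra.
by rewrite /f sin_0; lra.
Qed.

Lemma leg_ge_taylor x : 0 <= x -> x ^ 3 / 3 - x ^ 5 / 30 <= leg x.
Proof.
move=> x0; pose f t := leg t - (t ^ 3 / 3 - t ^ 5 / 30).
have : f 0 <= f x.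
  apply: (derive_ge0_le f (fun t => t * (sin t - (t - t ^ 3 / 6)))) => // t ht.
    have d := leg_derive t; rewrite /f; auto_derive.
      by exists (t * sin t).
    by rewrite (is_derive_unique _ _ _ d); field.
  by apply: Rmult_le_pos; [lra | have := sin_ge_taylor t; lra].
by rewrite /f {1}/leg sin_0; lra.
Qed.

(** [alpha n] is the angle at which the phase attains the level [(n - 7/10) pi]. *)
Lemma angles_exist mu K : 0 < mu -> INR K <= mu / PI + 7 / 10 ->
  exists alpha : nat -> R, forall n, (1 <= n)%nat -> (n <= K)%nat ->
    0 < alpha n <= PI / 2 /\ mu * leg (alpha n) = (INR n - 7 / 10) * PI.
Proof.
move=> mu0; have pi0 := PI_RGT_0; elim: K => [|K IH] hK.
  by exists (fun=> 0); lia.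
have [|alpha ha] := IH; first by rewrite S_INR in hK; lra.
have hv : 0 < (INR (S K) - 7 / 10) * PI / mu <= 1.
  split.
    apply: Rdiv_lt_0_compat => //; apply: Rmult_lt_0_compat => //.
    by have := pos_INR K; rewrite S_INR; lra.
  apply: (Rmult_le_reg_r mu) => //; rewrite /Rdiv Rmult_assoc Rinv_l; last by lra.
  have : (INR (S K) - 7 / 10) * PI <= mu / PI * PI.
    by apply: Rmult_le_compat_r; lra.
  by rewrite /Rdiv (Rmult_assoc mu) Rinv_l; lra.
have [a a0 ea] := leg_exists _ hv.
exists (fun n => if Nat.eqb n (S K) then a else alpha n) => n n1 nK.
case: Nat.eqb_spec => [->|ne]; last by apply: ha; lia.
by split=> //; rewrite ea; field; lra.
Qed.

Section Trapezoids.

Variables (mu : R) (alpha : nat -> R) (K : nat).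
Hypothesis mu0 : 0 < mu.
Hypothesis alphaP : forall n, (1 <= n)%nat -> (n <= K)%nat ->
  0 < alpha n <= PI / 2 /\ mu * leg (alpha n) = (INR n - 7 / 10) * PI.

(** The strips between consecutive levels have height [pi] in the phase, so the
    trapezoidal rule with half weights at both ends bounds their total area. *)
Lemma trapezoid_sum k : (k < K)%nat ->
  2 * mu ^ 2 / PI * (sector (alpha (S k)) - sector (alpha 1%nat))
  + mu * cos (alpha 1%nat) + mu * cos (alpha (S k)) - INR (S k)
  <= sum_f_R0 (fun n => if n is O then 0 else 2 * (mu * cos (alpha n)) - 1) (S k).
Proof.
have pi0 := PI_RGT_0; elim: k => [|k IH] kK; first by rewrite /=; lra.
have {}IH := IH ltac:(lia).
have [ha1 e1] := alphaP (S k) ltac:(lia) ltac:(lia).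
have [ha2 e2] := alphaP (S (S k)) ltac:(lia) ltac:(lia).
have dl : mu * (leg (alpha (S (S k))) - leg (alpha (S k))) = PI.
  by rewrite Rmult_minus_distr_l e1 e2 (S_INR (S k)); ring.
have le12 : alpha (S k) <= alpha (S (S k)).
  apply: Rnot_lt_le => lt.
  have := leg_le (alpha (S (S k))) (alpha (S k)) ltac:(lra) ltac:(lra) ltac:(lra).
  by nra.
have := sector_trapezoid (alpha (S k)) (alpha (S (S k))) ltac:(lra) le12 ltac:(lra).
move: IH; rewrite [sum_f_R0 _ (S (S k))]tech5 (S_INR (S k)).
set s := sum_f_R0 _ _; set A := sector (alpha (S (S k))); set B := sector _.
set C := cos (alpha (S (S k))); set D := cos (alpha (S k)) => IH h.
have : 2 * mu ^ 2 / PI * (A - B) <= mu * (C + D).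
  have p2 : 0 <= 2 * mu ^ 2 / PI by apply: Rdiv_le_0_compat => //; nra.
  apply: (Rle_trans _ _ _ (Rmult_le_compat_l _ _ _ p2 h)); right.
  have -> : leg (alpha (S (S k))) - leg (alpha (S k)) = PI / mu.
    by rewrite -[in RHS]dl; field; lra.
  by field; lra.
by lra.
Qed.

End Trapezoids.

(** The whole region has area [pi mu^2 / 8], and [2 / pi] times this is [mu^2 / 4].
    The strips miss a piece below the level [3 pi / 10] and a piece above the level
    of [alpha K], both again bounded by trapezoids. Altogether the count exceeds
    [mu^2 / 4] by at least
    [(7/10 cos (alpha 1) - 3/10) mu - K], with [K <= mu / pi + 7/10]. As
    [cos (alpha 1) >= 0.911] for [mu >= 40], the slope is
    [0.6377 - 0.3 - 0.3184 > 0.019]. *)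
Lemma count_large mu : 40 <= mu -> exists (M : nat) (c : nat -> nat),
  (forall m, (m < M)%nat -> zeros_upto m (mu ^ 2 / 4) (c m)) /\
  mu ^ 2 / 4 + 14 / 10000 * mu <= INR (weighted_sum c M).
Proof.
move=> mu40; have pi0 := PI_RGT_0; have pi1 := PI_gt; have pi2 := PI_lt.
have mu0 : 0 < mu by lra.
have imu : 0 < mu / PI by apply: Rdiv_lt_0_compat.
have [K [hK1 hK2]] := nfloor_ex (mu / PI + 7 / 10) ltac:(lra).
have [M' [_ hM]] := nfloor_ex mu ltac:(lra).
pose M := S M'; have muM : mu <= INR M by rewrite S_INR; lra.
have [alpha ha] := angles_exist mu K mu0 hK1.
exists M, (levels mu alpha K); split.
  move=> m _; case: (levelsP mu alpha K m) => [->|[h1 h2 h3]].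
    by exists (fun=> 0); split=> [i ?|i j ? ?]; lia.
  have [a1 e1] := ha _ h1 h2.
  by apply: (zeros_of_angle m mu (alpha (levels mu alpha K m))) => //; lra.
have ip : / PI < 31832 / 100000.
  rewrite -(Rinv_inv (31832 / 100000)); apply: Rinv_lt_contravar; last by lra.
  by apply: Rmult_lt_0_compat => //; lra.
have K1 : (1 <= K)%nat.
  apply: INR_le; rewrite [INR 1]/=.
  have : 12 <= mu / PI.
    apply: (Rmult_le_reg_r PI) => //; rewrite /Rdiv Rmult_assoc Rinv_l; lra.
  by move: hK2; rewrite /=; lra.
have ek : K = S (K - 1)%nat by lia.
have := levels_sum mu alpha mu0 K M muM (fun n h1 h2 => proj1 (ha n h1 h2)).
have := trapezoid_sum mu alpha K mu0 ha (K - 1) ltac:(lia).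
rewrite -ek; set S := sum_f_R0 _ _ => h1 h2.
have [aK eK] := ha K K1 ltac:(lia).
have [a1 e1] := ha 1%nat ltac:(lia) K1.
have cK : 0 <= cos (alpha K) by apply: cos_ge_0; lra.
have s0 : sector 0 = 0 by rewrite /sector Rmult_0_r sin_0; field.
have l0 : leg 0 = 0 by rewrite /leg sin_0; ring.
have spi : sector (PI / 2) = PI / 8.
  rewrite /sector (_ : 2 * (PI / 2) = PI); last by field.
  by rewrite sin_PI cos_PI; field.
have lpi : leg (PI / 2) = 1 by rewrite /leg sin_PI2 cos_PI2; ring.
have p2 : 0 <= 2 * mu ^ 2 / PI by apply: Rdiv_le_0_compat => //; nra.
(* the two pieces of the region that the strips leave out *)
have h3 : 2 * mu ^ 2 / PI * sector (alpha 1%nat)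
          <= 3 / 10 * mu * (1 + cos (alpha 1%nat)).
  have := sector_trapezoid 0 (alpha 1%nat) ltac:(lra) ltac:(lra) ltac:(lra).
  rewrite s0 l0 cos_0 !Rminus_0_r => /(Rmult_le_compat_l _ _ _ p2) h.
  apply: (Rle_trans _ _ _ h); right.
  have -> : leg (alpha 1%nat) = 3 / 10 * PI / mu.
    by apply: (Rmult_eq_reg_l mu); [rewrite e1 /=; field | ]; lra.
  by field; lra.
have h4 : 2 * mu ^ 2 / PI * (PI / 8 - sector (alpha K)) <= mu * cos (alpha K).
  have := sector_trapezoid (alpha K) (PI / 2) ltac:(lra) ltac:(lra) ltac:(lra).
  rewrite spi lpi cos_PI2 Rplus_0_r => /(Rmult_le_compat_l _ _ _ p2) h.
  apply: (Rle_trans _ _ _ h).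
  have -> : leg (alpha K) = (INR K - 7 / 10) * PI / mu.
    by apply: (Rmult_eq_reg_l mu); [rewrite eK; field | ]; lra.
  rewrite (_ : _ * _ = (mu / PI + 7 / 10 - INR K) * (mu * cos (alpha K))).
    have : 0 <= mu * cos (alpha K) by nra.
    by nra.
  by field; lra.
have c1 : 911 / 1000 <= cos (alpha 1%nat).
  have a42 : alpha 1%nat <= 42 / 100.
    apply: Rnot_lt_le => lt.
    have := leg_le (42 / 100) (alpha 1%nat) ltac:(lra) ltac:(lra) ltac:(lra).
    have := leg_ge_taylor (42 / 100) ltac:(lra).
    have : INR 1 = 1 by [].
    by nra.
  by have := cos_ge_taylor (alpha 1%nat) ltac:(lra); nra.
have e8 : 2 * mu ^ 2 / PI * (PI / 8) = mu ^ 2 / 4 by field; lra.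
have hK3 : INR K <= 31832 / 100000 * mu + 7 / 10.
  have := Rmult_le_compat_l mu _ _ ltac:(lra) (Rlt_le _ _ ip).
  by rewrite /Rdiv in hK1 *; lra.
have := Rmult_le_compat_l mu _ _ (Rlt_le _ _ mu0) c1.
lra.
Qed.

(** At the integer part [i] of [mu^2 / 4] the table gives [i + 2] zeros; one unit
    covers the fractional part, and the other one the linear term, which is at
    most [0.056]. *)
Lemma count_moderate mu : 12 <= mu <= 40 -> exists (M : nat) (c : nat -> nat),
  (forall m, (m < M)%nat -> zeros_upto m (mu ^ 2 / 4) (c m)) /\
  mu ^ 2 / 4 + 14 / 10000 * mu <= INR (weighted_sum c M).
Proof.
move=> hmu; have [n [hn1 hn2]] := nfloor_ex (mu ^ 2 / 4) ltac:(nra).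
have n36 : (36 <= n)%nat.
  have e35 : INR 35 = 35 by rewrite INR_IZR_INZ.
  suff : (35 < n)%nat by lia.
  by apply: INR_lt; rewrite e35; nra.
have n400 : (n <= 400)%nat.
  have e400 : INR 400 = 400 by rewrite INR_IZR_INZ.
  by apply: INR_le; rewrite e400; nra.
exists (length zero_table), (table_count (Z.of_nat n)); split.
  move=> m hm; apply: (zeros_upto_below _ (IZR (Z.of_nat n))).
    by apply: table_zeros => //; lia.
  by rewrite -INR_IZR_INZ.
have /Z.leb_le/IZR_le := proj1 (List.forallb_forall _ _) table_count_large
  (n - 36)%nat (proj2 (List.in_seq 365 0 (n - 36)) ltac:(lia)).
rewrite (_ : (36 + Z.of_nat (n - 36))%Z = Z.of_nat n); last by lia.
rewrite plus_IZR -!INR_IZR_INZ; lra.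
Qed.

Lemma bessel_count mu : 12 <= mu -> exists (M : nat) (c : nat -> nat),
  (forall m, (m < M)%nat -> zeros_upto m (mu ^ 2 / 4) (c m)) /\
  mu ^ 2 / 4 + 14 / 10000 * mu <= INR (weighted_sum c M).
Proof.
move=> h; case: (Rle_dec 40 mu) => h40; first exact: count_large.
by apply: count_moderate; lra.
Qed.

End BesselZeros.

Module NeumannDisk.
Import mathcomp.algebra_tactics.ring mathcomp.algebra_tactics.lra.
Set Implicit Arguments.
Unset Strict Implicit.
Unset Printing Implicit Defensive.
Import Order.TTheory GRing.Theory Num.Theory numFieldNormedType.Exports.
Local Open Scope classical_set_scope.
Local Open Scope ring_scope.

(** * Smooth functions built from the coordinates and the radius *)

Section Smooth.
Variable R : realType.
Implicit Types (f g h : R -> R) (u v : R * R -> R).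

(** Smoothness on the line, by coinduction: [f] belongs to a class of functions
    that is stable under derivation. *)
Definition smooth1 f := exists P : (R -> R) -> Prop, P f /\
  forall f, P f -> exists2 g, P g & forall x : R, is_derive x 1 f (g x).

Lemma smooth1_derive f : smooth1 f ->
  exists2 g, smooth1 g & forall x : R, is_derive x 1 f (g x).
Proof.
by move=> [P [Pf clP]]; have [g Pg fg] := clP _ Pf; exists g => //; exists P.
Qed.

Definition coord (i : bool) (z : R * R) : R := if i then z.2 else z.1.
Definition rho2 (z : R * R) : R := z.1 ^+ 2 + z.2 ^+ 2.

(** A class that contains the eigenfunctions and the cutoffs, and on which
    differentiability and stability under partial derivatives follow by a mere
    induction. *)
Inductive radial_algebra : (R * R -> R) -> Prop :=
| radial_cst c : radial_algebra (fun=> c)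
| radial_coord i : radial_algebra (coord i)
| radial_add u v : radial_algebra u -> radial_algebra v ->
    radial_algebra (fun z => u z + v z)
| radial_mul u v : radial_algebra u -> radial_algebra v ->
    radial_algebra (fun z => u z * v z)
| radial_comp h : smooth1 h -> radial_algebra (fun z => h (rho2 z)).

Lemma coord_continuous i : continuous (coord i).
Proof. by case: i => z; [exact: cvg_snd | exact: cvg_fst]. Qed.

Lemma coord_differentiable i z : differentiable (coord i) z.
Proof.
case: i.
  exact: (@linear_differentiable R (R * R)%type R (@snd R R) z (@coord_continuous true)).
exact: (@linear_differentiable R (R * R)%type R (@fst R R) z (@coord_continuous false)).
Qed.

Lemma coord_derive i j z : 'D_(axis_vec R i) (coord j) z = (i == j)%:R.
Proof.
rewrite deriveE; last exact: coord_differentiable.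
case: j.
  rewrite -[coord true]/(@snd R R) (@diff_lin R (R * R)%type R (@snd R R)); last first.
    exact: (@coord_continuous true).
  by case: i.
rewrite -[coord false]/(@fst R R) (@diff_lin R (R * R)%type R (@fst R R)); last first.
  exact: (@coord_continuous false).
by case: i.
Qed.

Lemma rho2E : rho2 = (fun z => coord false z * coord false z
                             + coord true z * coord true z).
Proof. by apply/funext => z; rewrite /rho2 !expr2. Qed.

Lemma rho2_differentiable z : differentiable rho2 z.
Proof.
rewrite rho2E; apply: differentiableD;
  by apply: differentiableM; exact: coord_differentiable.
Qed.

Lemma rho2_derive i z : 'D_(axis_vec R i) rho2 z = 2 * coord i z.
Proof.
have dc j : derivable (coord j) z (axis_vec R i).
  by apply: diff_derivable; exact: coord_differentiable.
rewrite rho2E deriveD; [|exact: derivableM|exact: derivableM].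
rewrite !deriveM // !coord_derive.
by case: i {dc}; rewrite /= /GRing.scale /=; ring.
Qed.

Lemma comp_rho2_differentiable h z : derivable h (rho2 z) 1 ->
  differentiable (fun z => h (rho2 z)) z.
Proof.
move=> dh; apply: (@differentiable_comp _ _ _ _ rho2 h).
  exact: rho2_differentiable.
exact/derivable1_diffP.
Qed.

Lemma comp_rho2_derive h z i : derivable h (rho2 z) 1 ->
  'D_(axis_vec R i) (fun z => h (rho2 z)) z = 2 * coord i z * 'D_1 h (rho2 z).
Proof.
move=> dh; rewrite deriveE; last exact: comp_rho2_differentiable.
rewrite (@diff_comp _ _ _ _ rho2 h) ?/=; first last.
- exact/derivable1_diffP.
- exact: rho2_differentiable.
rewrite deriv1E // derive1E -deriveE; last exact: rho2_differentiable.
by rewrite rho2_derive.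
Qed.

Lemma radial_algebra_derive u : radial_algebra u ->
  (forall z, differentiable u z) /\
  (forall i, exists2 w, radial_algebra w & partial i u = w).
Proof.
elim=> {u} [c|j|u v ru [du IHu] rv [dv IHv]|u v ru [du IHu] rv [dv IHv]|h sh].
- split=> [z|i]; first exact: differentiable_cst.
  exists (fun=> 0); first exact: radial_cst.
  by apply/funext => z; exact: derive_cst.
- split=> [z|i]; first exact: coord_differentiable.
  exists (fun=> (i == j)%:R); first exact: radial_cst.
  by apply/funext => z; exact: coord_derive.
- split=> [z|i]; first by apply: differentiableD.
  have [wu rwu eu] := IHu i; have [wv rwv ev] := IHv i.
  exists (fun z => wu z + wv z); first exact: radial_add.
  by apply/funext => z; rewrite -eu -ev; apply: deriveD; exact: diff_derivable.
- split=> [z|i]; first by apply: differentiableM.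
  have [wu rwu eu] := IHu i; have [wv rwv ev] := IHv i.
  exists (fun z => u z * wv z + v z * wu z).
    by apply: radial_add; exact: radial_mul.
  by apply/funext => z; rewrite -eu -ev; apply: deriveM; exact: diff_derivable.
- have [g sg dg] := smooth1_derive sh.
  split=> [z|i]; first by apply: comp_rho2_differentiable.
  exists (fun z => 2 * coord i z * g (rho2 z)).
    apply: radial_mul; last exact: radial_comp.
    by apply: radial_mul; [exact: radial_cst | exact: radial_coord].
  apply/funext => z; rewrite /partial comp_rho2_derive //.
  by congr (_ * _); exact: derive_val.
Qed.

Lemma radial_algebra_partial u i : radial_algebra u -> radial_algebra (partial i u).
Proof. by move=> /radial_algebra_derive[_ /(_ i)[w rw ->]]. Qed.

Lemma radial_algebra_differentiable u z : radial_algebra u -> differentiable u z.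
Proof. by move=> /radial_algebra_derive[]. Qed.

Lemma radial_algebra_smooth u : radial_algebra u -> smooth u.
Proof.
move=> ru s z; apply: radial_algebra_differentiable.
by elim: s => //= i s IH; exact: radial_algebra_partial.
Qed.

Lemma radial_algebra_continuous u : radial_algebra u -> continuous u.
Proof.
move=> ru z; apply: differentiable_continuous.
exact: radial_algebra_differentiable.
Qed.

(** The functions [x^-k exp(-1/x)], extended by [0] on the left: up to linear
    combinations they are closed under derivation, and so smooth at [0]. *)
Definition flat (k : nat) (x : R) : R :=
  if 0 < x then x^-1 ^+ k * expR (- x^-1) else 0.

Lemma flat_le k (x : R) : 0 <= flat k x <= k.+2`!%:R * x ^+ 2.
Proof.
rewrite /flat; case: ifPn => x0; last first.
  by rewrite lexx /= mulr_ge0// sqr_ge0.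
have xV0 : 0 <= x^-1 by rewrite invr_ge0 ltW.
rewrite mulr_ge0 ?exprn_ge0 ?expR_ge0//= expRN ler_pdivrMr ?expR_gt0//.
have f0 : 0 < k.+2`!%:R :> R by rewrite ltr0n fact_gt0.
have h : x^-1 ^+ k.+2 / k.+2`!%:R <= expR x^-1.
  by apply: le_trans (expR_ge1Dxn k.+1 xV0); rewrite lerDr.
rewrite ler_pdivrMr// mulrC in h.
have -> : x^-1 ^+ k = x^-1 ^+ k.+2 * x ^+ 2.
  by rewrite -addn2 exprD -mulrA -exprMn mulVf ?gt_eqF// expr1n mulr1.
apply: (@le_trans _ _ (k.+2`!%:R * expR x^-1 * x ^+ 2)); last by rewrite mulrAC.
by apply: ler_wpM2r => //; exact: sqr_ge0.
Qed.

Lemma flat_derive_gt0 k (x : R) : 0 < x ->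
  is_derive x 1 (flat k) (flat k.+2 x - k%:R * flat k.+1 x).
Proof.
move=> x0; have xn : x != 0 by rewrite gt_eqF.
apply: (@near_eq_is_derive _ _ _ ((fun y => y^-1) ^+ k * (expR \o (fun y => - y^-1)))).
  near=> y; rewrite /flat ifT ?fctE//; near: y; exact: lt_nbhsr.
have dV : is_derive x 1 (fun x : R => x^-1) (- x ^- 2 *: 1).
  exact: (@is_deriveV _ id).
have dE : is_derive x 1 (expR \o (fun y => - y^-1))
            (expR (- x^-1) * (- (- x ^- 2 *: 1))).
  by apply: is_derive1_comp; exact: is_deriveN.
have dX : is_derive x 1 ((fun x : R => x^-1) ^+ k)
    ((k%:R * x^-1 ^+ k.-1) *: (- x ^- 2 *: 1)).
  exact: is_deriveX.
apply: (is_derive_eq (is_deriveM dX dE)).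
rewrite /flat x0 /GRing.scale /= fctE mulr1 opprK -!exprVn.
by case: k {dX} => [|k] /=; rewrite ?exprS; ring.
Unshelve. all: by end_near. Qed.

Lemma flat_derive k (x : R) :
  is_derive x 1 (flat k) (flat k.+2 x - k%:R * flat k.+1 x).
Proof.
have [x0|x0|<-] := ltgtP 0 x.
- exact: flat_derive_gt0.
- have flat0 n y : y < 0 -> flat n y = 0.
    by move=> y0; rewrite /flat ltNge (ltW y0).
  rewrite !flat0// mulr0 subr0.
  apply: (@near_eq_is_derive _ _ _ (cst 0)).
  near=> y; rewrite flat0//; near: y; exact: lt_nbhsl.
- have flat0 n : flat n 0 = 0 by rewrite /flat ltxx.
  rewrite !flat0 mulr0 subr0.
  have h : h^-1 *: ((flat k \o shift 0) (h *: 1) - flat k 0) @[h --> 0^'] --> (0:R).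
    rewrite flat0; apply/cvgr0Pnorm_lt => e e0; near=> h.
    have hn : h != 0 by near: h; exact: nbhs_dnbhs_neq.
    rewrite /= addr0 subr0 /GRing.scale /= mulr1 normrM normfV.
    rewrite ltr_pdivrMl ?normr_gt0//.
    have /andP[f0 fl] := flat_le k h.
    rewrite ger0_norm// (le_lt_trans fl)// -real_normK ?num_real// expr2.
    rewrite mulrA [in ltRHS]mulrC ltr_pM2r ?normr_gt0//.
    rewrite -ltr_pdivlMl ?ltr0n ?fact_gt0//.
    near: h; apply: dnbhs0_lt.
    by rewrite mulr_gt0// invr_gt0 ltr0n fact_gt0.
  apply: DeriveDef; first by apply/cvg_ex; exists 0.
  exact: cvg_lim h.
Unshelve. all: by end_near. Qed.

(** A class that witnesses the smoothness of [flat 0], composed with an affine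
    map. *)
Inductive flat_span (a b : R) : (R -> R) -> Prop :=
| flat_span_flat c k : flat_span a b (fun x => c * flat k (a + b * x))
| flat_span_add f g : flat_span a b f -> flat_span a b g ->
    flat_span a b (fun x => f x + g x).

Lemma flat_smooth1 a b : smooth1 (fun x => flat 0 (a + b * x)).
Proof.
exists (flat_span a b); split.
  rewrite (_ : (fun x => _) = (fun x => 1 * flat 0 (a + b * x))).
    exact: flat_span_flat.
  by apply/funext => x; rewrite mul1r.
move=> f; elim=> {f} [c k|f g _ [df sf ef] _ [dg sg eg]].
  exists (fun x => c * b * flat k.+2 (a + b * x)
                   + (- c * b * k%:R) * flat k.+1 (a + b * x)).
    by apply: flat_span_add; exact: flat_span_flat.
  move=> x; have d : is_derive x 1 (fun x => a + b * x) b.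
    apply: (is_derive_eq (is_deriveD (is_derive_cst a x 1)
                                     (is_deriveZ b (is_derive_id x 1)))).
    by rewrite add0r /GRing.scale /= mulr1.
  have D := is_deriveZ c (@is_derive1_comp _ (flat k) (fun x => a + b * x)
    _ _ _ (flat_derive k (a + b * x)) d).
  apply: (is_derive_eq D).
  by rewrite /GRing.scale /=; ring.
exists (fun x => df x + dg x); first exact: flat_span_add.
by move=> x; apply: is_deriveD.
Qed.

End Smooth.

(** * Integration over the plane *)

Section PlaneMeasure.
Variable R : realType.
Local Notation mR := (measurableTypeR R).
Local Notation plane := (mR * mR)%type.
Implicit Types (u v : R * R -> R).

(** An open set of the plane is a countable union of rational boxes. *)
Lemma open_measurable_plane (U : set (R * R)) : open U ->
  measurable (U : set plane).
Proof.
move=> oU.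
pose box (a b c d : rat) : set plane :=
  `]ratr a, ratr b[%classic `*` `]ratr c, ratr d[%classic.
pose B a b c d := if `[< box a b c d `<=` U >] then box a b c d else set0.
have -> : U = \bigcup_a \bigcup_b \bigcup_c \bigcup_d B a b c d.
  apply/seteqP; split=> [[x y] Uxy|z].
    have /nbhs_ballP[e /= e0 eU] : nbhs (x, y) U by exact: open_nbhs_nbhs.
    have [|a ha] := @rat_in_itvoo R (x - e) x; first by rewrite ltrBlDr ltrDl.
    have [|b hb] := @rat_in_itvoo R x (x + e); first by rewrite ltrDl.
    have [|c hc] := @rat_in_itvoo R (y - e) y; first by rewrite ltrBlDr ltrDl.
    have [|d hd] := @rat_in_itvoo R y (y + e); first by rewrite ltrDl.
    exists a => //; exists b => //; exists c => //; exists d => //.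
    rewrite /B; case: asboolP => [_|[]]; rewrite /box /=.
      by rewrite !in_itv /= in ha hb hc hd *; lra.
    move=> [x' y'] /= []; rewrite !in_itv /= in ha hb hc hd *.
    move=> hx hy; apply: eU; split=> /=; rewrite /ball /= ltr_distlC; lra.
  move=> [a _ [b _ [c _ [d _]]]]; rewrite /B.
  by case: asboolP => // + h; exact.
do 4!apply: bigcupT_measurable_rat => ?.
rewrite /B; case: asboolP => _ //.
by apply: measurableX; exact: measurable_itv.
Qed.

Lemma continuous_measurable_plane u : continuous u ->
  @measurable_fun _ _ plane R setT u.
Proof.
move=> /continuousP cu; apply: (measurability _ (RGenOpens.measurableE R)).
move=> _ [_ [a [b ->] <-]]; rewrite setTI; apply: open_measurable_plane.
exact/cu/interval_open.
Qed.

Lemma measurable_unit_disk : measurable (@unit_disk R : set plane).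
Proof.
rewrite (_ : @unit_disk R = rho2 (R:=R) @^-1` `]-oo, 1[%classic).
  rewrite -[X in measurable X]setTI; apply: continuous_measurable_plane => //.
  by move=> z; apply: differentiable_continuous; exact: rho2_differentiable.
by apply/seteqP; split=> z; rewrite /= in_itv.
Qed.

Definition square (a : R) : set plane :=
  `[- a, a]%classic `*` `[- a, a]%classic.

Lemma measurable_square a : measurable (square a).
Proof. by apply: measurableX; exact: measurable_itv. Qed.

Lemma leb2_box (a b c d : R) (x y z t : bool) :
  @leb2 R ([set` Interval (BSide x a) (BSide y b)]
            `*` [set` Interval (BSide z c) (BSide t d)])
  = (lebesgue_measure [set` Interval (BSide x a) (BSide y b)]
     * lebesgue_measure [set` Interval (BSide z c) (BSide t d)])%E.
Proof. by apply: product_measure1E; exact: measurable_itv. Qed.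

Lemma leb2_square_lty a : (leb2 R (square a) < +oo)%E.
Proof.
rewrite leb2_box !lebesgue_measure_itv /=.
by case: ifP => _; rewrite ?mul0e // -EFinB -EFinM ltry.
Qed.

Lemma unit_disk_square z : @unit_disk R z -> square 1 z.
Proof.
rewrite /unit_disk /square /= => h; rewrite !in_itv /=.
have := sqr_ge0 z.1; have := sqr_ge0 z.2; nra.
Qed.

Lemma leb2_unit_disk_lty : (leb2 R (@unit_disk R) < +oo)%E.
Proof.
apply: le_lt_trans (leb2_square_lty 1); apply: le_measure; rewrite ?inE.
- exact: measurable_unit_disk.
- exact: measurable_square.
- exact: unit_disk_square.
Qed.

Lemma square_compact a : compact (square a : set (R * R)).
Proof. by apply: compact_setX; exact: segment_compact. Qed.

Lemma continuous_bounded_square u a : continuous u ->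
  exists M, forall z, square a z -> `|u z| <= M.
Proof.
move=> cu; have cK : compact (u @` (square a : set (R * R))).
  have := @continuous_compact (R * R)%type R u (square a); apply; last first.
    exact: square_compact.
  exact: continuous_subspaceT.
have [M [_ hM]] := compact_bounded cK.
exists (`|M| + 1) => z hz; apply: hM; last by exists z.
by rewrite ltr_pwDr// ler_norm.
Qed.

Lemma continuous_integrable_square u a : continuous u ->
  (leb2 R).-integrable (square a) (EFin \o u).
Proof.
move=> cu; apply: measurable_bounded_integrable.
- exact: measurable_square.
- exact: leb2_square_lty.
- apply: measurable_funTS; exact: continuous_measurable_plane.
- have [M hM] := continuous_bounded_square a cu.
  exists M; split; first exact: num_real.
  by move=> N MN z hz; apply: le_trans (hM z hz) (ltW MN).
Qed.

End PlaneMeasure.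

(** * Classical derivatives are weak derivatives *)

Section IntegrationByParts.
Variable R : realType.
Local Notation mR := (measurableTypeR R).
Local Notation plane := (mR * mR)%type.
Implicit Types (u v g : R * R -> R).

Lemma integral_derivative0 (f F : R -> R) (a : R) : 0 < a ->
  (forall x : R, is_derive x 1 f (F x)) -> continuous F ->
  (forall x, a <= `|x| -> f x = 0) -> (forall x, a <= `|x| -> F x = 0) ->
  (\int[@lebesgue_measure R]_x (F x)%:E = 0)%E.
Proof.
move=> a0 df cF f0 F0.
have aa : - a < a by lra.
have -> : (\int[@lebesgue_measure R]_x (F x)%:E =
           \int[@lebesgue_measure R]_(x in (`[(- a)%R, a]%classic : set mR)) (F x)%:E)%E.
  rewrite [RHS]integral_mkcond; apply: eq_integral => x _.
  rewrite patchE; case: ifPn => //; rewrite notin_setE /= in_itv /= => h.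
  rewrite F0// ler_normr; apply/orP; case: (@leP _ R a x) => ax; first by left.
  by right; lra.
rewrite (@continuous_FTC2 _ F f)//.
- by rewrite !f0 ?normrN ?gtr0_norm// subee.
- exact: continuous_subspaceT.
- have cf : continuous f.
    move=> x; apply: differentiable_continuous; exact/derivable1_diffP.
  split=> [x _ //| |]; first by apply: cvg_at_right_filter; exact: cf.
  by apply: cvg_at_left_filter; exact: cf.
- by move=> x _; rewrite derive1E; exact: derive_val.
Qed.

(** The lines parallel to the axis [i]. *)
Definition slice (i : bool) (c t : R) : R * R := if i then (c, t) else (t, c).

Lemma slice_derive i g (c t : R) : differentiable g (slice i c t) ->
  is_derive t 1 (fun t => g (slice i c t)) (partial i g (slice i c t)).
Proof.
move=> dg; have e h : slice i c (h *: 1 + t) = h *: axis_vec R i + slice i c t.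
  case: i {dg}; apply: injective_projections => //=;
    by rewrite [h *: 0]mulr0 add0r.
have dgv : derivable g (slice i c t) (axis_vec R i) by exact: diff_derivable.
have eqf : (fun h : R => h^-1 *:
      (((fun t => g (slice i c t)) \o shift t) (h *: 1) - g (slice i c t)))
    = (fun h : R => h^-1 *:
      ((g \o shift (slice i c t)) (h *: axis_vec R i) - g (slice i c t))).
  by apply/funext => h /=; rewrite e.
by apply: DeriveDef; rewrite ?/partial /derivable /derive eqf.
Qed.

Lemma slice_continuous i c : continuous (slice i c).
Proof.
case: i => t.
  exact: (cvg_pair (cvg_cst c) cvg_id).
exact: (cvg_pair cvg_id (cvg_cst c)).
Qed.

Lemma partial_eq0_outside i g (K : set (R * R)) : closed K ->
  (forall z, ~ K z -> g z = 0) -> forall z, ~ K z -> partial i g z = 0.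
Proof.
move=> cK g0 z Kz; rewrite /partial -(@derive_cst _ _ _ (0 : R) z (axis_vec R i)).
apply: near_eq_derive.
have : nbhs z (~` K) by apply: open_nbhs_nbhs; split=> //; exact: closed_openC.
by apply: filterS => y; exact: g0.
Qed.

Lemma square_closed (a : R) : closed (square a : set (R * R)).
Proof. by apply: compact_closed (@square_compact R a); exact: norm_hausdorff. Qed.

Lemma integrable_square_support u a : continuous u ->
  (forall z, ~ square a z -> u z = 0) ->
  (leb2 R).-integrable setT (EFin \o u).
Proof.
move=> cu u0; have := continuous_integrable_square a cu.
move=> /(integrable_mkcond _ (@measurable_square R a)).1.
congr (integrable _ _ _); apply/funext => z; rewrite patchE.
by case: ifPn => //; rewrite notin_setE => /u0 /= ->.
Qed.

(** Fubini reduces the claim to the fundamental theorem of calculus on each line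
    parallel to the axis [i]. *)
Lemma integral_partial0 i g (a : R) : 0 < a -> (forall z, differentiable g z) ->
  continuous (partial i g) -> (forall z, ~ square a z -> g z = 0) ->
  (\int[leb2 R]_z (partial i g z)%:E = 0)%E.
Proof.
move=> a0 dg cg g0.
have p0 := partial_eq0_outside i (@square_closed a) g0.
have ig := integrable_square_support cg p0.
have out c t : a + 1 <= `|t| -> ~ square a (slice i c t).
  by move=> ht; case: i {cg p0 ig}; rewrite /slice /square /= !in_itv /=;
    move: ht; rewrite ler_normr => /orP[] ?; lra.
have line c : (\int[@lebesgue_measure R]_t (partial i g (slice i c t))%:E = 0)%E.
  apply: (@integral_derivative0 (fun t => g (slice i c t)) _ (a + 1)).
  - by lra.
  - by move=> t; exact: slice_derive.
  - move=> t; apply: continuous_comp; [exact: slice_continuous | exact: cg].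
  - by move=> t /out /g0 ->.
  - by move=> t /out /p0 ->.
case: i cg p0 ig out line => cg p0 ig out line.
  rewrite /leb2 -(integral12_prod_meas1 ig) /fubini_F.
  under eq_integral do rewrite (line _).
  by rewrite integral0.
rewrite /leb2 -(integral21_prod_meas1 ig) /fubini_G.
under eq_integral do rewrite (line _).
by rewrite integral0.
Qed.

Lemma weak_partial_smooth i u : (forall z, differentiable u z) ->
  continuous (partial i u) -> weak_partial (@unit_disk R) i u (partial i u).
Proof.
move=> du cu phi [sphi _ Kphi].
set K := closure _ in Kphi.
have dphi z : differentiable phi z := sphi [::] z.
have dphi' z : differentiable (partial i phi) z := sphi [:: i] z.
have cphi z : {for z, continuous phi} by exact: differentiable_continuous.
have cphi' z : {for z, continuous (partial i phi)}.
  exact: differentiable_continuous.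
have cu0 z : {for z, continuous u} by exact: differentiable_continuous.
have phi0 z : ~ K z -> phi z = 0.
  by apply: contra_notP => /eqP h; exact: subset_closure.
have phi'0 : forall z, ~ K z -> partial i phi z = 0.
  by apply: partial_eq0_outside phi0; exact: closed_closure.
have outd z : ~ @unit_disk R z -> ~ K z by apply: contra_not => /Kphi.
have outs z : ~ @square R 1 z -> ~ K z.
  by apply: contra_not => /Kphi; exact: unit_disk_square.
pose g z := u z * phi z.
have dg z : differentiable g z by exact: differentiableM.
have pg : partial i g = (fun z => u z * partial i phi z + phi z * partial i u z).
  by apply/funext => z; apply: deriveM; exact: diff_derivable.
have cA : continuous (fun z => u z * partial i phi z).
  by move=> z; apply: cvgM; [exact: cu0 | exact: cphi'].
have cB : continuous (fun z => partial i u z * phi z).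
  by move=> z; apply: cvgM; [exact: cu | exact: cphi].
have iA := @integrable_square_support _ 1 cA.
have iB := @integrable_square_support _ 1 cB.
have e1 : \int[leb2 R]_(z in @unit_disk R) (u z * partial i phi z) =
          \int[leb2 R]_z (u z * partial i phi z).
  rewrite [LHS]Rintegral_mkcond; apply: eq_Rintegral => z _; rewrite patchE.
  by case: ifPn => //; rewrite notin_setE => /outd /phi'0 ->; rewrite mulr0.
have e2 : \int[leb2 R]_(z in @unit_disk R) (partial i u z * phi z) =
          \int[leb2 R]_z (partial i u z * phi z).
  rewrite [LHS]Rintegral_mkcond; apply: eq_Rintegral => z _; rewrite patchE.
  by case: ifPn => //; rewrite notin_setE => /outd /phi0 ->; rewrite mulr0.
rewrite e1 e2; apply/eqP; rewrite -subr_eq0 opprK; apply/eqP.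
rewrite -RintegralD//; first last.
- by apply: iB => z /outs /phi0 ->; rewrite mulr0.
- by apply: iA => z /outs /phi'0 ->; rewrite mulr0.
have -> : \int[leb2 R]_z (u z * partial i phi z + partial i u z * phi z)
        = \int[leb2 R]_z (partial i g z).
  by apply: eq_Rintegral => z _; rewrite pg [phi z * _]mulrC.
rewrite /Rintegral (@integral_partial0 i g 1)//.
- rewrite pg => z; apply: cvgD; first exact: cA.
  by apply: cvgM; [exact: cphi | exact: cu].
- by move=> z /outs /phi0; rewrite /g => ->; rewrite mulr0.
Qed.

End IntegrationByParts.

(** * The Green identity against a Sobolev function *)

Section Green.
Variable R : realType.
Local Notation mR := (measurableTypeR R).
Local Notation plane := (mR * mR)%type.
Local Notation disk := (@unit_disk R).
Implicit Types (u v g h : R * R -> R).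

Lemma continuous_bounded_disk h : continuous h ->
  exists2 M, 0 <= M & forall z, disk z -> `|h z| <= M.
Proof.
move=> ch; have [M hM] := continuous_bounded_square 1 ch.
exists `|M| => // z /unit_disk_square /hM h1.
exact: le_trans h1 (ler_norm _).
Qed.

Lemma bounded_integrable_disk h : @measurable_fun _ _ plane R disk h ->
  (exists M, forall z, disk z -> `|h z| <= M) ->
  (leb2 R).-integrable disk (EFin \o h).
Proof.
move=> mh [M hM]; apply: measurable_bounded_integrable => //.
- exact: measurable_unit_disk.
- exact: leb2_unit_disk_lty.
exists M; split; first exact: num_real.
by move=> N MN z hz; apply: le_trans (hM z hz) (ltW MN).
Qed.

Lemma continuous_L2 h : continuous h -> L2 disk h.
Proof.
move=> ch; split.
  by apply: measurable_funTS; exact: continuous_measurable_plane.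
have ch2 : continuous (fun z => h z ^+ 2).
  by move=> z; under eq_fun do rewrite expr2; apply: cvgM; exact: ch.
apply: bounded_integrable_disk.
  by apply: measurable_funTS; exact: continuous_measurable_plane.
by have [M _ hM] := continuous_bounded_disk ch2; exists M.
Qed.

Lemma L2_integrable v : L2 disk v -> (leb2 R).-integrable disk (EFin \o v).
Proof.
move=> [mv iv].
have i1 : (leb2 R).-integrable disk (EFin \o (fun=> 1 : R)).
  by apply: bounded_integrable_disk => //; exists 1 => z _; rewrite normr1.
have := integrableD (@measurable_unit_disk R) i1 iv.
apply: le_integrable => //; first exact: measurable_unit_disk.
  exact/measurable_EFinP.
move=> z _; rewrite -[leLHS]/((`|v z|)%:E) -[leRHS]/((`|1 + v z ^+ 2|)%:E).
rewrite lee_fin [leRHS]ger0_norm; last by rewrite addr_ge0 ?sqr_ge0.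
have h1 := sqr_ge0 (v z - 1); have h2 := sqr_ge0 (v z + 1).
have h3 := sqr_ge0 (v z).
by rewrite ler_norml; apply/andP; split; nra.
Qed.

Lemma L2_mul_integrable v h : L2 disk v -> continuous h ->
  (leb2 R).-integrable disk (EFin \o (fun z => v z * h z)).
Proof.
move=> Lv ch; have iv := L2_integrable Lv.
have := @integrableMl _ _ _ (leb2 R) disk (@measurable_unit_disk R) _ h iv.
apply.
  by apply: measurable_funTS; exact: continuous_measurable_plane.
have [M _ hM] := continuous_bounded_disk ch.
exists M; split; first exact: num_real.
by move=> N MN z hz; apply: le_trans (hM z hz) (ltW MN).
Qed.

(** As a function of [r = rho2 z], a cutoff that vanishes for
    [r >= (n + 1) / (n + 2)]. With [d = (n + 2) (1 - r) - 1] it is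
    [exp (- 1 / d)], so it is close to [1] as soon as [d] is large. *)
Definition cutoff (n : nat) (r : R) : R := flat 0 (n.+1%:R + - n.+2%:R * r).

Lemma flat0_le1 (d : R) : 0 <= flat 0 d <= 1.
Proof.
rewrite /flat; case: ifPn => d0; last by rewrite lexx ler01.
rewrite expr0 mul1r expR_ge0 /= -exp.expR0 ler_expR oppr_le0 invr_ge0.
exact: ltW.
Qed.

Lemma flat0_near1 (d : R) : 0 < d -> 1 - flat 0 d <= d^-1.
Proof.
move=> d0; rewrite /flat d0 expr0 mul1r.
by have := expR_ge1Dx (- d^-1); lra.
Qed.

(** The derivative of the cutoff, times the distance to the circle in the unit
    [1 / (n + 2)], is bounded, and small where [d] is large. *)
Lemma flat2_le3 (d : R) : 0 <= (d + 1) * flat 2 d <= 3.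
Proof.
rewrite /flat; case: ifPn => d0; last by rewrite mulr0 lexx /=; lra.
set s := d^-1; have s0 : 0 < s by rewrite invr_gt0.
have ds : d * s = 1 by rewrite mulfV// gt_eqF.
have h1 := expR_ge1Dx s.
have h2 : 1 + s ^+ 2 / 2 <= expR s by apply: le_trans (expR_ge1Dxn 1 (ltW s0)).
have -> : (d + 1) * (s ^+ 2 * expR (- s)) = (s + s ^+ 2) * expR (- s).
  by rewrite mulrA mulrDl mul1r [d * _]mulrA ds mul1r.
apply/andP; split; first by rewrite mulr_ge0 ?expR_ge0 ?addr_ge0 ?sqr_ge0 ?ltW.
by rewrite expRN ler_pdivrMr ?expR_gt0//; lra.
Qed.

Lemma flat2_small (d : R) : 1 <= d -> (d + 1) * flat 2 d <= 2 * d^-1.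
Proof.
move=> d1; have d0 : 0 < d by lra.
rewrite /flat d0; set s := d^-1; have s0 : 0 < s by rewrite invr_gt0.
have ds : d * s = 1 by rewrite mulfV// gt_eqF.
have e1 : expR (- s) <= 1 by rewrite -exp.expR0 ler_expR; lra.
have -> : (d + 1) * (s ^+ 2 * expR (- s)) = (s + s ^+ 2) * expR (- s).
  by rewrite mulrA mulrDl mul1r [d * _]mulrA ds mul1r.
have e0 := expR_ge0 (- s).
have s1 : s <= 1 by nra.
have : (s + s ^+ 2) * expR (- s) <= (s + s ^+ 2) * 1.
  by apply: ler_wpM2l => //; rewrite addr_ge0 ?sqr_ge0 ?ltW.
by rewrite expr2; nra.
Qed.

Section Eigenfunction.

(** The Neumann condition is used in the form that the radial derivative of [u]
    is bounded by the distance to the circle. *)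
Variables (lambda C : R) (u : R * R -> R).
Hypothesis ru : radial_algebra u.
Hypothesis helmholtz : forall z,
  partial true (partial true u) z + partial false (partial false u) z
  = - lambda * u z.
Hypothesis neumann : forall z, disk z ->
  `|coord true z * partial true u z + coord false z * partial false u z|
  <= C * (1 - rho2 z).

Let ui i := radial_algebra_partial i ru.
Let cu := radial_algebra_continuous ru.
Let cui i := radial_algebra_continuous (ui i).

Definition dist n (z : R * R) : R := n.+1%:R + - n.+2%:R * rho2 z.

(** The fields [eta n * partial i u], compactly supported in the disk, are tested
    against the weak gradient of [v]. *)
Let eta n (z : R * R) := cutoff n (rho2 z).
Let phi n i (z : R * R) := eta n z * partial i u z.

Let r_eta n : radial_algebra (eta n).
Proof. by apply: radial_comp; exact: flat_smooth1. Qed.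

Let r_phi n i : radial_algebra (phi n i).
Proof. by apply: radial_mul. Qed.

Let eta_partial n i z :
  partial i (eta n) z = - 2 * n.+2%:R * flat 2 (dist n z) * coord i z.
Proof.
have dh : is_derive (rho2 z) 1 (cutoff n) (- n.+2%:R * flat 2 (dist n z)).
  have d : is_derive (rho2 z) 1 (fun x => n.+1%:R + - n.+2%:R * x) (- n.+2%:R : R).
    apply: (is_derive_eq (is_deriveD
      (is_derive_cst (n.+1%:R : R) (rho2 z) 1)
      (is_deriveZ (- n.+2%:R) (is_derive_id (rho2 z) 1)))).
    by rewrite add0r /GRing.scale /= mulr1.
  have := @is_derive1_comp _ (flat 0) (fun x => n.+1%:R + - n.+2%:R * x)
    _ _ _ (flat_derive 0 (dist n z)) d.
  by rewrite mul0r subr0 mulrC.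
rewrite /partial comp_rho2_derive //.
by rewrite (@derive_val _ _ _ _ _ _ _ dh); ring.
Qed.

Let eta_support n z : eta n z != 0 -> rho2 z <= n.+1%:R / n.+2%:R.
Proof.
rewrite /eta /cutoff /flat; case: ifPn => [h _|_]; last by rewrite eqxx.
by rewrite ler_pdivlMr ?ltr0n//; lra.
Qed.

Let phi_test n i : test_function disk (phi n i).
Proof.
have r0 : n.+1%:R / n.+2%:R < 1 :> R.
  by rewrite ltr_pdivrMr ?ltr0n// mul1r ltr_nat.
pose B : set (R * R) := [set z | rho2 z <= n.+1%:R / n.+2%:R].
have cB : closed B.
  rewrite (_ : B = @rho2 R @^-1` [set x | x <= n.+1%:R / n.+2%:R]) //.
  apply: preimage_closed; last exact: closed_le.
  by move=> z _; apply: differentiable_continuous; exact: rho2_differentiable.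
have BD : B `<=` disk.
  by move=> z; rewrite /B /unit_disk /= /rho2 => h; apply: le_lt_trans h r0.
have KB : closure [set z | phi n i z != 0] `<=` B.
  rewrite ((closure_id B).1 cB); apply: closureS => z hz.
  apply: (@eta_support n); move: hz; apply: contraNN => /eqP h.
  by rewrite /phi h mul0r.
split.
- exact: radial_algebra_smooth.
- apply: (subclosed_compact _ (@square_compact R 1)) => [|z].
    exact: closed_closure.
  by move=> /KB /BD; exact: unit_disk_square.
- by move=> z /KB /BD.
Qed.

Let X z := coord true z * partial true u z + coord false z * partial false u z.

Let C_ge0 : 0 <= C.
Proof.
have h : disk (0, 0) by rewrite /unit_disk /= expr0n /= addr0.
have := neumann h; rewrite /rho2 /= expr0n /= addr0 subr0 mulr1.
by move=> h0; exact: le_trans (normr_ge0 _) h0.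
Qed.

Let boundary_term n z : disk z ->
  `|2 * n.+2%:R * flat 2 (dist n z) * X z|
  <= 2 * C * ((dist n z + 1) * flat 2 (dist n z)).
Proof.
move=> hz; have f0 : 0 <= flat 2 (dist n z) by have /andP[] := flat_le 2 (dist n z).
have n0 : 0 <= n.+2%:R :> R by [].
rewrite normrM ger0_norm; last by rewrite !mulr_ge0.
have -> : dist n z + 1 = n.+2%:R * (1 - rho2 z).
  by rewrite /dist -[n.+2]addn1 -[n.+1]addn1 !natrD; ring.
have := ler_wpM2l (mulr_ge0 (mulr_ge0 (ler0n R 2) n0) f0) (neumann hz).
by rewrite -/(X z) => h; apply: (le_trans h); rewrite le_eqVlt; apply/orP; left; apply/eqP; ring.
Qed.

Section Green.

Variables (v : R * R -> R) (gv : bool -> R * R -> R).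
Hypothesis hv : H1_gradient disk v gv.

Let Lv : L2 disk v := hv.1.
Let Lgv i : L2 disk (gv i) := (hv.2 i).1.

(** [F n] has integral [0] by the definition of weak derivatives, and converges
    to [G], the difference of the two integrands of the Green identity. *)
Let F n z := (v z * partial true (phi n true) z + gv true z * phi n true z)
           + (v z * partial false (phi n false) z + gv false z * phi n false z).
Let G z := (gv true z * partial true u z + gv false z * partial false u z)
           - v z * (lambda * u z).

Let FE n z : F n z = eta n z * G z
                     - v z * (2 * n.+2%:R * flat 2 (dist n z) * X z).
Proof.
have pphi i : partial i (phi n i) z
    = eta n z * partial i (partial i u) z + partial i u z * partial i (eta n) z.
  by apply: deriveM; apply: diff_derivable; exact: radial_algebra_differentiable.
rewrite /F !pphi !eta_partial /phi /G /X.
have -> : partial true (partial true u) z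
          = - lambda * u z - partial false (partial false u) z.
  by rewrite -helmholtz addrK.
by ring.
Qed.

Let iv h : continuous h ->
  (leb2 R).-integrable disk (EFin \o (fun z => v z * h z)).
Proof. exact: L2_mul_integrable. Qed.

Let igv i h : continuous h ->
  (leb2 R).-integrable disk (EFin \o (fun z => gv i z * h z)).
Proof. exact: L2_mul_integrable. Qed.

Let c_phi n i : continuous (phi n i).
Proof. exact: radial_algebra_continuous. Qed.

Let c_pphi n i : continuous (partial i (phi n i)).
Proof. by apply: radial_algebra_continuous; exact: radial_algebra_partial. Qed.

Let iFi n i : (leb2 R).-integrable disk
  (EFin \o (fun z => v z * partial i (phi n i) z + gv i z * phi n i z)).
Proof.
exact: (integrableD (@measurable_unit_disk R) (iv (@c_pphi n i))
                    (igv i (@c_phi n i))).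
Qed.

Let iF n : (leb2 R).-integrable disk (EFin \o F n).
Proof.
exact: (integrableD (@measurable_unit_disk R) (iFi n true) (iFi n false)).
Qed.

Let int_Fi n i : \int[leb2 R]_(z in disk)
  (v z * partial i (phi n i) z + gv i z * phi n i z) = 0.
Proof.
rewrite RintegralD; [|exact: measurable_unit_disk|exact: iv|exact: igv].
by rewrite ((hv.2 i).2 _ (phi_test n i)) addNr.
Qed.

Let int_F n : \int[leb2 R]_(z in disk) F n z = 0.
Proof.
rewrite RintegralD; [|exact: measurable_unit_disk|exact: iFi|exact: iFi].
by rewrite !int_Fi addr0.
Qed.

Let cl : continuous (fun z => lambda * u z).
Proof. by move=> z; apply: cvgM; [exact: cvg_cst | exact: cu]. Qed.

Let iA : (leb2 R).-integrable disk (EFin \o (fun z =>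
  gv true z * partial true u z + gv false z * partial false u z)).
Proof.
exact: (integrableD (@measurable_unit_disk R) (igv true (@cui true))
                    (igv false (@cui false))).
Qed.

Let iG : (leb2 R).-integrable disk (EFin \o G).
Proof. exact: (integrableB (@measurable_unit_disk R) iA (iv cl)). Qed.

(** The derivative of the cutoff blows up like [n] near the circle, and the radial
    derivative of [u] compensates exactly this. *)
Let F_bound n z : disk z -> `|F n z| <= `|G z| + 6 * C * `|v z|.
Proof.
move=> hz; rewrite FE (le_trans (ler_normB _ _))// lerD//.
  rewrite normrM ler_piMl// ger0_norm; have /andP[//] := flat0_le1 (dist n z).
rewrite normrM mulrC ler_wpM2r// (le_trans (boundary_term n hz))//.
have /andP[_ h] := flat2_le3 (dist n z).
have := ler_wpM2l (mulr_ge0 (ler0n R 2) C_ge0) h.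
by move/le_trans; apply; rewrite le_eqVlt; apply/orP; left; apply/eqP; ring.
Qed.

Let F_cvg z : disk z -> F n z @[n --> \oo] --> G z.
Proof.
move=> hz; have r0 : 0 < 1 - rho2 z by rewrite subr_gt0.
apply/cvgrPdist_le => e e0; near=> n.
have K0 : 0 <= `|G z| + 4 * C * `|v z| by rewrite addr_ge0 ?mulr_ge0.
have hd : (`|G z| + 4 * C * `|v z|) / e + 1 <= dist n z.
  have h : ((`|G z| + 4 * C * `|v z|) / e + 2) / (1 - rho2 z) <= n%:R.
    by near: n; exact: nbhs_infty_ger.
  rewrite ler_pdivrMr// in h.
  have -> : dist n z = n%:R * (1 - rho2 z) + 2 * (1 - rho2 z) - 1.
    by rewrite /dist -[n.+2]addn2 -[n.+1]addn1 !natrD; ring.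
  by move: h; set K := _ / e; lra.
have d1 : 1 <= dist n z by apply: le_trans hd; rewrite lerDr divr_ge0// ltW.
have d0 : 0 < dist n z by lra.
have hde : (`|G z| + 4 * C * `|v z|) * (dist n z)^-1 <= e.
  have h : (`|G z| + 4 * C * `|v z|) / e <= dist n z.
    by apply: le_trans hd; rewrite lerDl.
  by move: h; rewrite ler_pdivrMr // ler_pdivrMr // (mulrC e).
have -> : G z - F n z = (1 - eta n z) * G z
    + v z * (2 * n.+2%:R * flat 2 (dist n z) * X z) by rewrite FE; ring.
apply: le_trans hde; apply: (le_trans (ler_normD _ _)).
rewrite [leRHS]mulrDl lerD//.
  rewrite normrM mulrC ler_wpM2l// ger0_norm; first exact: flat0_near1.
  by have /andP[_] := flat0_le1 (dist n z); rewrite subr_ge0.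
rewrite normrM.
have := le_trans (boundary_term n hz)
   (ler_wpM2l (mulr_ge0 (ler0n R 2) C_ge0) (flat2_small d1)).
move=> /(ler_wpM2l (normr_ge0 (v z)))/le_trans; apply.
by rewrite le_eqVlt; apply/orP; left; apply/eqP; ring.
Unshelve. all: by end_near. Qed.

Let int_G : \int[leb2 R]_(z in disk) G z = 0.
Proof.
have iv1 := L2_integrable Lv.
have idom : (leb2 R).-integrable disk
    (EFin \o (fun z => `|G z| + 6 * C * `|v z|)).
  have iGn := integrable_norm iG; have ivn := integrable_norm iv1.
  have := integrableZl (@measurable_unit_disk R) (6 * C) ivn.
  exact: (integrableD (@measurable_unit_disk R) iGn).
have [] := @dominated_convergence _ _ _ (leb2 R) disk (@measurable_unit_disk R)
  (fun n => EFin \o F n) (EFin \o G) (EFin \o (fun z => `|G z| + 6 * C * `|v z|)).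
- by move=> n; exact: measurable_int (iF n).
- exact: measurable_int iG.
- apply: aeW => z hz; apply/cvg_EFin; first exact: nearW.
  exact: F_cvg.
- exact: idom.
- by apply: aeW => z n hz /=; rewrite lee_fin; exact: F_bound.
move=> _ _ h; rewrite /Rintegral.
have -> : (\int[leb2 R]_(z in disk) (G z)%:E = 0)%E; last by [].
apply: (cvg_unique _ h) => //=.
have e n : (\int[leb2 R]_(z in disk) (F n z)%:E = 0)%E.
  rewrite -[RHS]/((0 : R)%:E) -(int_F n) /Rintegral fineK//.
  exact: (integrable_fin_num (@measurable_unit_disk R) (iF n)).
rewrite (_ : (fun n => _) = cst 0%E); first exact: cvg_cst.
by apply/funext => n; exact: e.
Qed.

Lemma green_identity :
  \int[leb2 R]_(z in disk) (\sum_i partial i u z * gv i z) =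
  \int[leb2 R]_(z in disk) (lambda * u z * v z).
Proof.
have : \int[leb2 R]_(z in disk)
    (gv true z * partial true u z + gv false z * partial false u z)
  - \int[leb2 R]_(z in disk) (v z * (lambda * u z)) = 0.
  rewrite -RintegralB; [exact: int_G|exact: measurable_unit_disk|exact: iA|].
  exact: iv.
move/eqP; rewrite subr_eq0 => /eqP h.
transitivity (\int[leb2 R]_(z in disk)
    (gv true z * partial true u z + gv false z * partial false u z)).
  by apply: eq_Rintegral => z _; rewrite big_bool /=; ring.
by rewrite h; apply: eq_Rintegral => z _; rewrite mulrC.
Qed.

End Green.

Lemma neumann_eigenspaceI : neumann_eigenspace disk lambda u.
Proof.
split.
  apply: continuous_L2 => z; apply: cvgM; [exact: cvg_cst | exact: cu].
exists (fun i => partial i u); last by move=> v gv; exact: green_identity.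
split; first exact: (continuous_L2 cu).
move=> i; split; first exact: (continuous_L2 (@cui i)).
apply: weak_partial_smooth; last exact: cui.
by move=> z; exact: radial_algebra_differentiable.
Qed.

End Eigenfunction.

End Green.

(** * Separated eigenfunctions of the disk *)

Section HarmonicPolynomials.
Variable R : realType.
Local Notation mR := (measurableTypeR R).
Local Notation plane := (mR * mR)%type.
Local Notation disk := (@unit_disk R).

(** The real ([false]) and imaginary ([true]) parts of [(x + i y)^m]. *)
Fixpoint harmonic (b : bool) (m : nat) (z : R * R) : R :=
  if m is k.+1 then
    z.1 * harmonic b k z + (if b then 1 else -1) * z.2 * harmonic (~~ b) k z
  else (~~ b)%:R.

Lemma harmonicS b m : harmonic b m.+1 = (fun z => coord false z * harmonic b m z
  + (if b then 1 else -1) * (coord true z * harmonic (~~ b) m z)).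
Proof. by apply/funext => z /=; rewrite mulrA. Qed.

Lemma radial_algebra_harmonic b m : radial_algebra (harmonic b m).
Proof.
elim: m b => [|m IH] b; first exact: radial_cst.
rewrite harmonicS; apply: radial_add.
  by apply: radial_mul; [exact: radial_coord | exact: IH].
apply: radial_mul; first exact: radial_cst.
by apply: radial_mul; [exact: radial_coord | exact: IH].
Qed.

Lemma partialM i (u v : R * R -> R) z : differentiable u z -> differentiable v z ->
  partial i (fun z => u z * v z) z = u z * partial i v z + v z * partial i u z.
Proof. by move=> du dv; apply: deriveM; exact: diff_derivable. Qed.

Lemma partialD i (u v : R * R -> R) z : differentiable u z -> differentiable v z ->
  partial i (fun z => u z + v z) z = partial i u z + partial i v z.
Proof. by move=> du dv; apply: deriveD; exact: diff_derivable. Qed.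

Lemma partial_cst i c z : partial i (fun=> c : R) z = 0 :> R.
Proof. exact: derive_cst. Qed.

Lemma partial_coord i j z : partial i (@coord R j) z = (i == j)%:R.
Proof. exact: coord_derive. Qed.

Lemma harmonic_differentiable b m z : differentiable (harmonic b m) z.
Proof. exact: radial_algebra_differentiable (radial_algebra_harmonic b m). Qed.

Lemma partial_harmonic i b m z : partial i (harmonic b m) z =
  m%:R * ((if i && ~~ b then -1 else 1) * harmonic (b (+) i) m.-1 z).
Proof.
elim: m b z => [|m IH] b z; first by rewrite mul0r; exact: partial_cst.
rewrite harmonicS partialD; first last.
- apply: differentiableM; first exact: differentiable_cst.
  by apply: differentiableM; [exact: coord_differentiable|exact: harmonic_differentiable].
- by apply: differentiableM; [exact: coord_differentiable|exact: harmonic_differentiable].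
rewrite (partialM _ (coord_differentiable false z) (harmonic_differentiable b m z)).
rewrite (@partialM _ (fun=> if b then 1 else -1)
  (fun z => coord true z * harmonic (~~ b) m z)); first last.
- by apply: differentiableM; [exact: coord_differentiable|exact: harmonic_differentiable].
- exact: differentiable_cst.
rewrite (partialM _ (coord_differentiable true z) (harmonic_differentiable (~~ b) m z)).
rewrite partial_cst !partial_coord !IH -[m.+1.-1]/m -natr1 /coord.
case: m {IH} => [|m].
  by case: i; case: b; rewrite /=; ring.
by case: i; case: b; rewrite /=; ring.
Qed.

Lemma harmonic_euler b m z :
  z.1 * partial false (harmonic b m) z + z.2 * partial true (harmonic b m) z
  = m%:R * harmonic b m z.
Proof.
rewrite !partial_harmonic; case: m => [|m] /=; first by rewrite !mul0r !mulr0 addr0.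
by case: b => /=; ring.
Qed.

Lemma harmonic_laplace b m z :
  partial true (partial true (harmonic b m)) z
  + partial false (partial false (harmonic b m)) z = 0.
Proof.
have e i : partial i (harmonic b m) = (fun z =>
    (m%:R * (if i && ~~ b then -1 else 1)) * harmonic (b (+) i) m.-1 z).
  by apply/funext => y; rewrite partial_harmonic mulrA.
rewrite !e !partialM; try exact: harmonic_differentiable; try exact: differentiable_cst.
rewrite !partial_cst !partial_harmonic.
by case: b {e} => /=; ring.
Qed.

Lemma harmonic_scale b m (t : R) z :
  harmonic b m (t * z.1, t * z.2) = t ^+ m * harmonic b m z.
Proof.
elim: m b => [|m IH] b /=; first by rewrite expr0 mul1r.
by rewrite !IH exprS; ring.
Qed.

Lemma harmonic_axis b m (x : R) : harmonic b m (x, 0) = if b then 0 else x ^+ m.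
Proof.
elim: m b => [|m IH] b /=; first by case: b; rewrite ?expr0.
by rewrite !IH mulr0 mul0r addr0; case: b => /=; rewrite ?mulr0 // exprS.
Qed.

End HarmonicPolynomials.

Section SeparatedEigenfunctions.
Variable R : realType.
Local Notation mR := (measurableTypeR R).
Local Notation plane := (mR * mR)%type.
Local Notation disk := (@unit_disk R).

(** In terms of [r = rho2 z], and for [P] harmonic and homogeneous of degree [m],
    the Laplacian of [h r * P z] is [4 (r h'' r + (m + 1) h' r) P z], and its
    derivative along [z] is [(m h r + 2 r h' r) P z]: the hypotheses are the
    Helmholtz equation and the Neumann condition. *)
Variables (m : nat) (T : R) (h h1 h2 : R -> R).
Hypothesis sh : smooth1 h.
Hypothesis dh : forall r : R, is_derive r 1 h (h1 r).
Hypothesis dh1 : forall r : R, is_derive r 1 h1 (h2 r).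
Hypothesis ch2 : continuous h2.
Hypothesis ode : forall r, r * h2 r + m.+1%:R * h1 r + T * h r = 0.
Hypothesis neumann1 : m%:R * h 1 + 2 * h1 1 = 0.

Definition separated (b : bool) (z : R * R) : R := h (rho2 z) * harmonic b m z.

Lemma radial_algebra_separated b : radial_algebra (separated b).
Proof.
by apply: radial_mul; [exact: radial_comp | exact: radial_algebra_harmonic].
Qed.

Let dif_h (f f' : R -> R) (df : forall r : R, is_derive r 1 f (f' r)) z :
  differentiable (fun z : R * R => f (rho2 z)) z.
Proof. exact: comp_rho2_differentiable. Qed.

Let par_h (f f' : R -> R) (df : forall r : R, is_derive r 1 f (f' r)) i z :
  partial i (fun z : R * R => f (rho2 z)) z = 2 * coord i z * f' (rho2 z).
Proof.
rewrite /partial comp_rho2_derive //; congr (_ * _); exact: derive_val.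
Qed.

Let partial_separated b i : partial i (separated b) = (fun z =>
  h (rho2 z) * partial i (harmonic b m) z
  + harmonic b m z * (2 * (coord i z * h1 (rho2 z)))).
Proof.
apply/funext => z; rewrite partialM; first last.
- exact: harmonic_differentiable.
- exact: (dif_h dh).
by rewrite (par_h dh) -mulrA.
Qed.

Lemma separated_helmholtz b z :
  partial true (partial true (separated b)) z
  + partial false (partial false (separated b)) z = - (4 * T) * separated b z.
Proof.
have dp i (y : R * R) : differentiable (partial i (@harmonic R b m)) y.
  apply: radial_algebra_differentiable; apply: radial_algebra_partial.
  exact: radial_algebra_harmonic.
have dc i y : differentiable (fun z : R * R => coord i z * h1 (rho2 z)) y.
  by apply: differentiableM; [exact: coord_differentiable | exact: (dif_h dh1)].
have d2c i y : differentiable (fun z : R * R => 2 * (coord i z * h1 (rho2 z))) y.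
  by apply: differentiableM; [exact: differentiable_cst | exact: dc].
have e i : partial i (partial i (separated b)) z =
    h (rho2 z) * partial i (partial i (harmonic b m)) z
    + 4 * h1 (rho2 z) * (coord i z * partial i (harmonic b m) z)
    + 2 * h1 (rho2 z) * harmonic b m z
    + 4 * coord i z ^+ 2 * h2 (rho2 z) * harmonic b m z.
  rewrite partial_separated partialD; first last.
  - by apply: differentiableM; [exact: harmonic_differentiable | exact: d2c].
  - by apply: differentiableM; [exact: (dif_h dh) | exact: dp].
  rewrite (partialM _ (dif_h dh z) (dp i z)) (par_h dh).
  rewrite (partialM _ (@harmonic_differentiable _ b m z) (d2c i z)).
  rewrite (@partialM _ _ (fun=> 2)); [|exact: differentiable_cst|exact: dc].
  rewrite (partialM _ (coord_differentiable i z) (dif_h dh1 z)) (par_h dh1).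
  by rewrite partial_cst partial_coord eqxx (_ : true%:R = 1 :> R) //; ring.
rewrite !e.
have lap := harmonic_laplace b m z.
have eul := harmonic_euler b m z.
have := ode (rho2 z); rewrite -[m.+1]addn1 natrD => o.
rewrite /separated /coord.
have -> : - (4 * T) * (h (rho2 z) * harmonic b m z) =
    4 * harmonic b m z * (rho2 z * h2 (rho2 z) + (m%:R + 1) * h1 (rho2 z)).
  have -> : rho2 z * h2 (rho2 z) + (m%:R + 1) * h1 (rho2 z) = - (T * h (rho2 z)).
    by apply/eqP; rewrite -addr_eq0; apply/eqP.
  by ring.
have -> : 4 * harmonic b m z * (rho2 z * h2 (rho2 z) + (m%:R + 1) * h1 (rho2 z))
  = 4 * harmonic b m z * rho2 z * h2 (rho2 z) + 4 * h1 (rho2 z) * harmonic b m z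
    + 4 * h1 (rho2 z) * (m%:R * harmonic b m z) by ring.
rewrite -eul.
have -> : partial true (partial true (harmonic b m)) z =
    - partial false (partial false (harmonic b m)) z.
  by apply/eqP; rewrite -addr_eq0; apply/eqP.
move: (h (rho2 z)) (h1 (rho2 z)) (h2 (rho2 z)) => c0 c1 c2; rewrite /rho2; ring.
Qed.

(** The derivative along [z] is [harmonic b m z * k (rho2 z)] with a differentiable
    [k] that vanishes at [1]; the mean value theorem applies to [k]. *)
Lemma separated_neumann b : exists C, forall z, disk z ->
  `|coord true z * partial true (separated b) z
    + coord false z * partial false (separated b) z| <= C * (1 - rho2 z).
Proof.
have [M M0 hM] := continuous_bounded_disk
  (radial_algebra_continuous (@radial_algebra_harmonic R b m)).
pose k r := m%:R * h r + 2 * (r * h1 r).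
pose dk r := m%:R * h1 r + 2 * (h1 r + r * h2 r).
have dkk (r : R) : is_derive r 1 k (dk r).
  have d1 := is_deriveZ m%:R (dh r).
  have d2 := is_deriveZ 2 (is_deriveM (is_derive_id r 1) (dh1 r)).
  apply: (is_derive_eq (is_deriveD d1 d2)).
  by rewrite /dk /GRing.scale /=; ring.
have ch1 : continuous h1.
  by move=> r; apply: differentiable_continuous; exact/derivable1_diffP.
have cdk : continuous dk.
  move=> r; apply: cvgD; first by apply: cvgM; [exact: cvg_cst | exact: ch1].
  apply: cvgM; first exact: cvg_cst.
  by apply: cvgD; [exact: ch1 | apply: cvgM; [exact: cvg_id | exact: ch2]].
have [K K0 hK] : exists2 K, 0 <= K & forall r : R, 0 <= r <= 1 -> `|dk r| <= K.
  have cK : compact (dk @` (`[0, 1]%classic : set R)).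
    apply: continuous_compact; last exact: segment_compact.
    exact: continuous_subspaceT.
  have [N [_ hN]] := compact_bounded cK.
  exists (`|N| + 1) => [|r hr]; first by rewrite addr_ge0.
  by apply: hN; [rewrite ltr_pwDr// ler_norm | exists r].
exists (M * K) => z hz.
have -> : coord true z * partial true (separated b) z
    + coord false z * partial false (separated b) z = harmonic b m z * k (rho2 z).
  rewrite !partial_separated /k.
  have -> : harmonic b m z * (m%:R * h (rho2 z) + 2 * (rho2 z * h1 (rho2 z)))
    = h (rho2 z) * (m%:R * harmonic b m z)
      + 2 * harmonic b m z * rho2 z * h1 (rho2 z) by ring.
  rewrite -harmonic_euler /coord; move: (h (rho2 z)) (h1 (rho2 z)) => c0 c1.
  by rewrite /rho2; ring.
have r0 : 0 <= rho2 z by rewrite /rho2 addr_ge0 ?sqr_ge0.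
have r1 : rho2 z < 1 by [].
have ck : continuous k.
  by move=> r; apply: differentiable_continuous; exact/derivable1_diffP.
have [c hc ec] := MVT r1 (fun x _ => dkk x) (continuous_subspaceT ck).
have k1 : k 1 = 0 by rewrite /k mul1r.
rewrite k1 sub0r in ec.
have -> : k (rho2 z) = - (dk c * (1 - rho2 z)) by rewrite -ec opprK.
rewrite normrM normrN normrM (@ger0_norm _ (1 - rho2 z)); last by rewrite subr_ge0 ltW.
rewrite in_itv /= in hc; case/andP: hc => c0 c1.
have hc : `|dk c| <= K by apply: hK; rewrite (ltW c1) (le_trans r0 (ltW c0)).
rewrite mulrA ler_wpM2r ?subr_ge0 ?(ltW r1)//.
by apply: ler_pM => //; exact: hM.
Qed.

Lemma separated_eigenspace b : neumann_eigenspace disk (4 * T) (separated b).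
Proof.
have [C hC] := separated_neumann b.
apply: (@neumann_eigenspaceI _ _ C) => //.
- exact: radial_algebra_separated.
- exact: separated_helmholtz.
Qed.

End SeparatedEigenfunctions.

(** * Independence and multiplicities *)

Section Independence.
Variable R : realType.
Local Notation mR := (measurableTypeR R).
Local Notation plane := (mR * mR)%type.
Local Notation disk := (@unit_disk R).

(** Where a continuous function does not vanish, it does not vanish on a box, which
    has positive measure. *)
Lemma ae_zero_disk (u : R * R -> R) : continuous u ->
  ae_zero disk u -> forall z, disk z -> u z = 0.
Proof.
move=> cu uz [x y] hz; apply/eqP; apply: contrapT => /negP uxy.
pose U : set (R * R) := [set z | rho2 z < 1] `&` [set z | u z != 0].
have oU : open U.
  apply: openI.
    apply: (@open_comp _ _ (@rho2 R) [set t | t < 1]); last exact: open_lt.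
    by move=> z _; apply: differentiable_continuous; exact: rho2_differentiable.
  by apply: (@open_comp _ _ u [set t | t != 0]); [move=> z _; exact: cu | exact: open_neq].
have /nbhs_ballP[e /= e0 eU] : nbhs (x, y) U by apply: open_nbhs_nbhs; split.
have e1 : x - e < x + e by lra.
have e2 : y - e < y + e by lra.
pose B : set plane := `]x - e, x + e[%classic `*` `]y - e, y + e[%classic.
have BU : B `<=` U.
  move=> [x' y'] [] /=; rewrite !in_itv /= => hx hy; apply: eU.
  by split=> /=; rewrite /ball /= ltr_distlC; lra.
have mB : measurable B by apply: measurableX; exact: measurable_itv.
have : (leb2 R).-negligible B.
  apply: negligibleS uz => z /BU[z1 z2] /= /(_ z1) /eqP.
  by apply/negP.
move=> /(measure_negligible mB) B0.
have : leb2 R B = 0%E by exact: B0.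
rewrite (leb2_box _ _ _ _ false true false true).
rewrite !lebesgue_measure_itv /= !lte_fin e1 e2 -!EFinB -EFinM => -[] /eqP.
by rewrite mulf_eq0 => /orP[] /eqP; lra.
Qed.

Variables (M : nat) (h : nat -> R -> R).
Hypothesis ch : forall m, continuous (h m).
Hypothesis h0 : forall m, h m 0 != 0.

(** Different degrees are separated by the behaviour along rays to the origin: if
    the components of degree less than [m] vanish, then the sum at [t z], divided
    by [t^m], tends to [h m 0 * P m z]. *)
Lemma harmonic_components (P : nat -> R * R -> R) :
  (forall m (t : R) z, P m (t * z.1, t * z.2) = t ^+ m * P m z) ->
  (forall z, disk z -> \sum_(m < M) h m (rho2 z) * P m z = 0) ->
  forall m z, (m < M)%N -> P m z = 0.
Proof.
move=> scale PS m z; elim/ltn_ind: m => m IH mM.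
pose G (t : R) := \sum_(k < M)
  (if (k < m)%N then 0 else h k (t ^+ 2 * rho2 z) * (t ^+ (k - m) * P k z)).
have cG : G t @[t --> 0^'+] --> G 0.
  apply: cvg_at_right_filter.
  rewrite /G; apply: (@cvg_big R 'I_M +%R 0 xpredT (@add_continuous R) R
    (nbhs (0 : R)) (index_enum _)
    (fun k t => if (k < m)%N then 0
       else h k (t ^+ 2 * rho2 z) * (t ^+ (k - m) * P k z))
    (fun k => if (k < m)%N then 0
       else h k (0 ^+ 2 * rho2 z) * (0 ^+ (k - m) * P k z))) => k _.
  case: ifP => _; first exact: cvg_cst.
  apply: cvgM.
    apply: (@cvg_comp _ _ _ (fun t : R => t ^+ 2 * rho2 z) (h k)); last exact: ch.
    by apply: cvgM; [exact: exprn_continuous | exact: cvg_cst].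
  by apply: cvgM; [exact: exprn_continuous | exact: cvg_cst].
have G0 : G t @[t --> 0^'+] --> 0.
  have r0 : 0 <= rho2 z by rewrite /rho2 addr_ge0 ?sqr_ge0.
  apply: (@cvg_near_cst R R 0 G); near=> t.
  have t0 : 0 < t by [].
  have [t1 tr] : t <= 1 /\ t * (1 + rho2 z) < 1.
    split; first by near: t; exact: nbhs_right_le.
    rewrite -ltr_pdivlMr ?mul1r; last by lra.
    by near: t; apply: nbhs_right_lt; rewrite invr_gt0; lra.
  have hz : disk (t * z.1, t * z.2).
    rewrite /unit_disk /= !exprMn -mulrDr -/(rho2 z).
    rewrite expr2 -mulrA (le_lt_trans (ler_piMl _ t1)) ?mulr_ge0 ?(ltW t0)//.
    by lra.
  have := PS _ hz; rewrite /rho2 /= !exprMn -mulrDr -/(rho2 z) => e.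
  suff : t ^+ m * G t = 0.
    by move/eqP; rewrite mulf_eq0 expf_eq0 (gt_eqF t0) andbF => /eqP.
  rewrite -[RHS]e mulr_sumr; apply: eq_bigr => k _.
  case: ltnP => mk; first by rewrite scale (IH _ mk (ltn_trans mk mM)) !mulr0.
  have -> : P k (t * z.1, t * z.2) = t ^+ m * (t ^+ (k - m) * P k z).
    by rewrite scale mulrA -exprD subnKC.
  by ring.
have : G 0 = 0 by apply: cvg_unique cG G0.
rewrite /G (bigD1 (Ordinal mM)) //= ltnn subnn expr0 mul1r expr0n mul0r.
rewrite big1 => [|k kn].
  by rewrite addr0 => /eqP; rewrite mulf_eq0 (negbTE (h0 m)) => /eqP.
case: ltnP => // mk; rewrite expr0n subn_eq0 leqNgt.
have -> : (m < k)%N by rewrite ltn_neqAle mk andbT; apply: contraNneq kn => e; apply/eqP/val_inj.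
by rewrite mul0r mulr0.
Unshelve. all: by end_near. Qed.

(** The function [Im (x + i y)^0] vanishes, so that there is no index [(0, true)]. *)
Definition angular_index (x : 'I_M * bool) := x.2 ==> (0 < x.1)%N.

(** The component of degree [m] is a combination of the real and imaginary parts of
    [(x + i y)^m]; at [(1, 0)] only the real part is nonzero, and the imaginary
    part has there the derivative [m] in the direction of [y]. *)
Lemma separated_independent (d : 'I_M * bool -> R) :
  (forall z, disk z -> \sum_x d x * separated x.1 (h x.1) x.2 z = 0) ->
  forall x, angular_index x -> d x = 0.
Proof.
move=> dS [i b] ib.
pose a (m : nat) b : R := if insub m is Some i then d (i, b) else 0.
have ae (j : 'I_M) c : a j c = d (j, c) by rewrite /a valK.
pose P m z := a m false * harmonic false m z + a m true * harmonic true m z.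
have P0 m z : (m < M)%N -> P m z = 0.
  apply: harmonic_components => [k t y|y hy].
    by rewrite /P !harmonic_scale; ring.
  rewrite -[RHS](dS y hy).
  transitivity (\sum_(j < M) \sum_c d (j, c) * separated j (h j) c y); last first.
    by rewrite pair_bigA; apply: eq_bigr => -[].
  by apply: eq_bigr => j _; rewrite big_bool /P /separated !ae /=; ring.
have h1 : a i false = 0.
  have := P0 i (1, 0) (ltn_ord i).
  by rewrite /P !harmonic_axis mulr0 addr0 expr1n mulr1.
case: b ib => ib; last by rewrite -ae.
rewrite -ae; apply/eqP; apply: contraTT ib => an.
have e : harmonic true i = (fun=> 0 : R).
  apply/funext => z; have := P0 i z (ltn_ord i); rewrite /P h1 mul0r add0r.
  by move/eqP; rewrite mulf_eq0 (negbTE an) => /eqP.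
have := @partial_harmonic R true true i (1, 0); rewrite e partial_cst harmonic_axis /=.
rewrite expr1n !mulr1 => /esym /eqP; rewrite pnatr_eq0 => /eqP i0.
by rewrite /angular_index /= i0.
Qed.

Lemma separated_ae_free (J : {set 'I_M * bool}) :
  (forall x, x \in J -> angular_index x) ->
  ae_free disk (fun k : 'I_#|J| =>
    separated (enum_val k).1 (h (enum_val k).1) (enum_val k).2).
Proof.
move=> aJ c cS k.
pose F (x : 'I_M * bool) : R * R -> R := separated x.1 (h x.1) x.2.
pose d (x : 'I_M * bool) := \sum_(l < #|J| | enum_val l == x) c l.
have e z : \sum_x d x * F x z = \sum_l c l * F (enum_val l) z.
  rewrite (partition_big (@enum_val _ (mem J)) xpredT) //=.
  apply: eq_bigr => x _; rewrite mulr_suml.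
  by apply: eq_bigr => l /eqP ->.
have <- : d (enum_val k) = c k.
  rewrite /d (eq_bigl (pred1 k)) ?big_pred1_eq // => l /=.
  by apply/eqP/eqP => [/enum_val_inj|->].
apply: separated_independent; last by apply: aJ; exact: enum_valP.
move=> z hz; rewrite e; move: z hz; apply: ae_zero_disk; last exact: cS.
move=> z; apply: (@cvg_big R 'I_#|J| +%R 0 xpredT (@add_continuous R) _ (nbhs z)
  (index_enum _) (fun l z => c l * F (enum_val l) z)
  (fun l => c l * F (enum_val l) z)) => l _.
apply: cvgM; first exact: cvg_cst.
apply: cvgM; last first.
  by apply: radial_algebra_continuous; exact: radial_algebra_harmonic.
apply: (@cvg_comp _ _ _ (@rho2 R) (h (enum_val l).1)); last exact: ch.
by apply: differentiable_continuous; exact: rho2_differentiable.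
Qed.

End Independence.

Section Counting.
Variable R : realType.
Local Notation disk := (@unit_disk R).
Variables (h : nat -> R -> R -> R) (zero : nat -> R -> Prop).
Hypothesis ch : forall m T, continuous (h m T).
Hypothesis h0 : forall m T, h m T 0 != 0.
Hypothesis eigen : forall m T b, zero m T ->
  neumann_eigenspace disk (4 * T) (separated m (h m T) b).

Section FixedT.
Variables (M : nat) (T : R).

Definition modes : {set 'I_M * bool} :=
  [set x | angular_index x && `[< zero x.1 T >]].

Let e (k : 'I_#|modes|) : R * R -> R :=
  separated (enum_val k).1 (h (enum_val k).1 T) (enum_val k).2.

Let free_e : ae_free disk e.
Proof.
apply: (@separated_ae_free R M (fun m => h m T)) => [m|m|x].
- exact: ch.
- exact: h0.
- by rewrite inE => /andP[].
Qed.

Let eigen_e k : neumann_eigenspace disk (4 * T) (e k).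
Proof. by apply: eigen; have := enum_valP k; rewrite inE => /andP[_ /asboolP]. Qed.

Lemma multiplicity_modes : (#|modes|%:R%:E <= multiplicity disk (4 * T))%E.
Proof. by apply: ereal_sup_ubound; exists #|modes| => //; exists e. Qed.

Lemma eigenvalue_modes : (0 < #|modes|)%N -> neumann_eigenvalue disk (4 * T).
Proof.
move=> J0; pose k := Ordinal J0; exists (e k) => // ek.
have := free_e (c := fun l => (l == k)%:R) _ k.
rewrite eqxx => h1; have : 1%:R = 0 :> R.
  apply: h1; rewrite (_ : (fun z => _) = e k) //; apply/funext => z.
  rewrite (bigD1 k) //= mul1r big1 ?addr0 // => l /negbTE ->.
  by rewrite mul0r.
by move/eqP; rewrite oner_eq0.
Qed.

End FixedT.

Lemma counting_modes (M : nat) (s : seq R) mu : uniq s ->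
  (forall T, T \in s -> 4 * T <= mu ^+ 2) ->
  ((\sum_(T <- s) #|modes M T|)%:R%:E <= neumann_counting disk mu)%E.
Proof.
move=> us sT.
pose r := [seq 4 * T | T <- s & (0 < #|modes M T|)%N].
have ur : uniq r.
  by rewrite map_inj_uniq ?filter_uniq // => x y /mulfI; apply; rewrite pnatr_eq0.
apply: (@le_trans _ _ (\sum_(l <- r) multiplicity disk l)%E).
  rewrite big_map big_filter natr_sum -sumEFin.
  rewrite (bigID (fun T => (0 < #|modes M T|)%N)) /= [X in (_ + X)%E]big1; last first.
    by move=> T; rewrite -eqn0Ngt => /eqP ->.
  by rewrite adde0; apply: lee_sum => T _; exact: multiplicity_modes.
apply: ereal_sup_ubound; exists [set` r]; last by rewrite -fsbig_seq.
split; first exact: finite_seq.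
move=> l /= /mapP[T]; rewrite mem_filter => /andP[J0 Ts] ->.
by split; [exact: eigenvalue_modes J0 | exact: sT].
Qed.

(** Summing the multiplicities over the distinct values [T] and then exchanging the
    sums, each mode [(m, b)] is counted once for every zero of order [m]; zeros of
    different orders that coincide cause no loss. *)
Lemma counting_zeros (M : nat) (c : nat -> nat) (z : nat -> nat -> R) mu :
  (forall m i, (m < M)%N -> (i < c m)%N -> zero m (z m i) /\ 4 * z m i <= mu ^+ 2) ->
  (forall m i j, (m < M)%N -> (i < j)%N -> (j < c m)%N -> z m i < z m j) ->
  ((\sum_(m < M) (if m == 0%N :> nat then 1 else 2) * c m)%N%:R%:E
    <= neumann_counting disk mu)%E.
Proof.
move=> zz zi.
pose s := undup [seq z m i | m <- iota 0 M, i <- iota 0 (c m)].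
have smem m i : (m < M)%N -> (i < c m)%N -> z m i \in s.
  by move=> mM ic; rewrite mem_undup; apply: allpairs_f_dep; rewrite mem_iota.
apply: le_trans (@counting_modes M s mu _ _); last first.
- move=> T; rewrite mem_undup => /allpairsPdep[m [i []]].
  rewrite !mem_iota !add0n => /andP[_ mM] /andP[_ ic] ->.
  by have [] := zz m i mM ic.
- exact: undup_uniq.
rewrite lee_fin ler_nat.
have -> : (\sum_(T <- s) #|modes M T| = \sum_(m < M)
    (if m == 0%N :> nat then 1 else 2) * count (fun T => `[< zero m T >]) s)%N.
  transitivity (\sum_(T <- s) \sum_(m < M) (if m == 0%N :> nat then 1 else 2)
      * `[< zero m T >])%N; last first.
    rewrite exchange_big /=; apply: eq_bigr => m _.
    by rewrite -big_distrr /= -sum1_count [in RHS]big_mkcond; congr (_ * _)%N.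
  apply: eq_bigr => T _; rewrite -sum1_card.
  under eq_bigl do rewrite inE.
  rewrite big_mkcond -(pair_bigA _ (fun (m : 'I_M) b =>
    if angular_index (m, b) && `[< zero m T >] then 1 else 0)%N) /=.
  apply: eq_bigr => m _; rewrite big_bool /angular_index /=.
  by case: (nat_of_ord m) => [|k] /=; case: asbool.
apply: leq_sum => m _; rewrite leq_mul2l; apply/orP; right.
have <- : size [seq z m i | i <- iota 0 (c m)] = c m by rewrite size_map size_iota.
rewrite -size_filter; apply: uniq_leq_size => [|T /mapP[i]].
  rewrite map_inj_in_uniq ?iota_uniq // => i j.
  rewrite !mem_iota !add0n => /andP[_ ic] /andP[_ jc] e.
  have [ij|ji|//] := ltngtP i j.
    by have := zi m i j (ltn_ord m) ij jc; rewrite e ltxx.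
  by have := zi m j i (ltn_ord m) ji ic; rewrite e ltxx.
rewrite mem_iota add0n => /andP[_ ic] ->; rewrite mem_filter smem // andbT.
by apply/asboolP; have [] := zz m i (ltn_ord m) ic.
Qed.

End Counting.

(** * Bessel modes *)

Section BesselModes.
Variable R : realType.
Local Notation disk := (@unit_disk R).

Lemma is_derive_epsilon (f : R -> R) (x l : R) :
  (forall e, 0 < e -> exists2 d, 0 < d &
    forall h, h != 0 -> `|h| < d -> `|(f (x + h) - f x) / h - l| < e) ->
  is_derive x 1 f l.
Proof.
move=> df.
have h : h^-1 *: ((f \o shift x) (h *: (1 : R)) - f x) @[h --> 0^'] --> l.
  apply/cvgrPdist_lt => e e0; have [d d0 hd] := df e e0.
  near=> h.
  have hn : h != 0 by near: h; exact: nbhs_dnbhs_neq.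
  have hd' : `|h| < d by near: h; exact: dnbhs0_lt.
  by rewrite distrC /GRing.scale /= mulr1 mulrC [h + x]addrC; exact: hd.
apply: DeriveDef; first by apply/cvg_ex; exists l.
exact: cvg_lim h.
Unshelve. all: by end_near. Qed.

(** The family [H] is given by its derivatives and its recurrence: this keeps the
    argument independent of how the reals and the series are constructed. *)
Variable H : nat -> R -> R.
Hypothesis H_derive : forall m (T : R), is_derive T 1 (H m) (- H m.+1 T).
Hypothesis H_rec : forall m T, T * H m.+2 T - m.+1%:R * H m.+1 T + H m T = 0.
Hypothesis H_at0 : forall m, H m 0 != 0.

Let H_scale_derive m T (r : R) :
  is_derive r 1 (fun r => H m (T * r)) (- T * H m.+1 (T * r)).
Proof.
have d : is_derive r 1 (fun r => T * r) T.
  apply: (is_derive_eq (is_deriveZ T (is_derive_id r 1))).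
  by rewrite /GRing.scale /= mulr1.
apply: (is_derive_eq (@is_derive1_comp _ (H m) (fun r => T * r) _ _ _
  (H_derive m (T * r)) d)).
by rewrite mulrC mulNr mulrN.
Qed.

Let H_scale_smooth m T : smooth1 (fun r => H m (T * r)).
Proof.
exists (fun f => exists c k, f = (fun r => c * H k (T * r))); split.
  by exists 1, m; apply/funext => r; rewrite mul1r.
move=> _ [c [k ->]]; exists (fun r => (c * - T) * H k.+1 (T * r)).
  by exists (c * - T), k.+1.
move=> r; apply: (is_derive_eq (is_deriveZ c (H_scale_derive k T r))).
by rewrite /GRing.scale /= mulrA.
Qed.

Let H_scale_continuous m (T : R) : continuous (fun r : R => H m (T * r)).
Proof.
move=> r; apply: differentiable_continuous; apply/derivable1_diffP.
exact: (@ex_derive _ _ _ _ _ _ _ (H_scale_derive m T r)).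
Qed.

Lemma bessel_mode_eigenspace m T b : m%:R * H m T - 2 * T * H m.+1 T = 0 ->
  neumann_eigenspace disk (4 * T) (separated m (fun r => H m (T * r)) b).
Proof.
move=> NT.
apply: (@separated_eigenspace R m T _ (fun r => - T * H m.+1 (T * r))
  (fun r => - T * (- T * H m.+2 (T * r)))).
- exact: H_scale_smooth.
- by move=> r; exact: H_scale_derive.
- by move=> r; exact: (is_deriveZ (- T) (H_scale_derive m.+1 T r)).
- move=> r; apply: cvgM; first exact: cvg_cst.
  by apply: cvgM; [exact: cvg_cst | exact: H_scale_continuous].
- move=> r; transitivity (T *
    (T * r * H m.+2 (T * r) - m.+1%:R * H m.+1 (T * r) + H m (T * r))).
    by ring.
  by rewrite H_rec mulr0.
- by rewrite mulr1 -NT; ring.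
Qed.

Lemma counting_bessel (M : nat) (c : nat -> nat) (z : nat -> nat -> R) mu :
  (forall m i, (m < M)%N -> (i < c m)%N ->
    m%:R * H m (z m i) - 2 * z m i * H m.+1 (z m i) = 0
    /\ 4 * z m i <= mu ^+ 2) ->
  (forall m i j, (m < M)%N -> (i < j)%N -> (j < c m)%N -> z m i < z m j) ->
  ((\sum_(m < M) (if m == 0%N :> nat then 1 else 2) * c m)%N%:R%:E
    <= neumann_counting disk mu)%E.
Proof.
apply: (@counting_zeros R (fun m T r => H m (T * r))
  (fun m T => m%:R * H m T - 2 * T * H m.+1 T = 0)).
- exact: H_scale_continuous.
- by move=> m T; rewrite mulr0.
- by move=> m T b; exact: bessel_mode_eigenspace.
Qed.

End BesselModes.

End NeumannDisk.

(** * From zeros of Bessel functions to the counting function *)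

Module DiskCounting.
Import BesselZeros NeumannDisk.
Set Implicit Arguments.
Unset Strict Implicit.
Unset Printing Implicit Defensive.
Import Order.TTheory GRing.Theory Num.Theory.
Local Open Scope ring_scope.

Local Notation R := Rdefinitions.R.

Lemma IZR_nat p : Rdefinitions.IZR (BinInt.Z.pos p) = (nat_of_pos p)%:R :> R.
Proof. by rewrite IZRposE INRE. Qed.

Lemma bessel_H_neq0 m : H m (0 : R) != 0.
Proof.
apply/eqP; rewrite BesselZeros.H_at0.
by apply: RIneq.Rinv_neq_0_compat; exact: Rfunctions.INR_fact_neq_0.
Qed.

Lemma bessel_H_rec m (T : R) : T * H m.+2 T - m.+1%:R * H m.+1 T + H m T = 0.
Proof. by have := BesselZeros.H_rec m T; rewrite INRE. Qed.

Lemma weighted_sumE c M :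
  weighted_sum c M = (\sum_(m < M) (if m == 0%N :> nat then 1 else 2) * c m)%N.
Proof.
elim: M => [|M IH]; first by rewrite big_ord0.
by rewrite big_ord_recr /= -IH; case: M {IH}.
Qed.

Lemma is_derive_Stdlib (f : R -> R) (x l e : R) :
  Ranalysis1.derivable_pt_lim f x l -> 0 < e -> exists2 d, 0 < d &
    forall h, h != 0 -> `|h| < d -> `|(f (x + h) - f x) / h - l| < e.
Proof.
move=> df /RltP e0; have [d hd] := df e e0.
exists (RIneq.pos d); first by apply/RltP; exact: RIneq.cond_pos.
move=> h /eqP h0 /RltP hd'; have /RltP := hd h h0 hd'.
by rewrite RabsE RdivE.
Qed.

Lemma weighted_zeros_counting (mu : R) (M : nat) (c : nat -> nat) :
  (forall m, (m < M)%N -> zeros_upto m (mu ^+ 2 / 4) (c m)) ->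
  ((weighted_sum c M)%:R%:E <= neumann_counting (@unit_disk R) mu)%E.
Proof.
move=> zc.
pose good m (y : nat -> R) :=
  (forall i, (i < c m)%N -> N m (y i) = 0 /\ 4 * y i <= mu ^+ 2) /\
  (forall i j, (i < j)%N -> (j < c m)%N -> y i < y j).
have [z hz] : {z : nat -> nat -> R & forall m, (m < M)%N -> good m (z m)}.
  apply: (@boolp.choice _ _ (fun m y => (m < M)%N -> good m y)) => m.
  case: (boolP (m < M)%N) => [mM|]; last by exists (fun=> 0).
  have [y [y1 y2]] := zc m mM; exists y => _; split.
    move=> i ic; have [[_ /RleP h] N0] := y1 i (elimT ssrnat.ltP ic).
    by split=> //; rewrite mulrC -ler_pdivlMr.
  by move=> i j ij jc; apply/RltP; apply: y2; exact/ssrnat.ltP.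
rewrite weighted_sumE.
apply: (@counting_bessel R H _ _ _ M c z mu).
- move=> m T; apply: is_derive_epsilon => e; apply: is_derive_Stdlib.
  by apply/Derive.is_derive_Reals; exact: H_derive.
- exact: bessel_H_rec.
- exact: bessel_H_neq0.
- move=> m i mM ic; have [gm _] := hz m mM; have [p ?] := gm i ic; split=> //.
  by rewrite -[RHS]p /N INRE IZR_nat.
- by move=> m i j mM; have [_] := hz m mM; exact.
Qed.

Lemma bessel_count_ring (mu : R) : 12 <= mu -> exists (M : nat) (c : nat -> nat),
  (forall m, (m < M)%N -> zeros_upto m (mu ^+ 2 / 4) (c m)) /\
  mu ^+ 2 / 4 + 14 / 10000 * mu <= (weighted_sum c M)%:R.
Proof.
move=> mu12; have [|M [c [zc cmu]]] := bessel_count mu.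
  by apply/RleP; rewrite IZR_nat.
exists M, c; split=> [m /ssrnat.ltP /zc|]; first by rewrite RdivE RpowE IZR_nat.
by move/RleP: cmu; rewrite RplusE RmultE !RdivE RpowE !IZR_nat INRE.
Qed.

End DiskCounting.

Local Open Scope ring_scope.

Theorem theorem1p6 (mu : Rdefinitions.R) :
  12 <= mu ->
  (neumann_counting (@unit_disk Rdefinitions.R) mu >=
     (mu ^+ 2 / 4 + 14 / 10000 * mu)%:E)%E.
Proof.
move=> /DiskCounting.bessel_count_ring[M [c [zeros count]]].
apply: Order.POrderTheory.le_trans (DiskCounting.weighted_zeros_counting zeros).
by rewrite lee_fin.
Qed.
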